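(* Let $\alpha>0$ and $\kappa \in C^{1,\alpha}(\mathbb{R}) \cap L^{\infty}(\mathbb{R})$, and let $\Gamma$ be the harmonic extension of $\kappa$ to $\mathbb{R}^2_+$. Let $(\xi_\star, \mu_\star) \in \mathbb{R}^2_+$ be a non-degenerate critical point for $\Gamma$. Then there exist two constants $\varepsilon_0 \in (0, 1)$ and $C > 0$ such that the following holds true. For every $\varepsilon \in (0, \varepsilon_0]$, there exists a solution $u = u_\varepsilon$ to $$(-\Delta)^{\frac{1}{2}} u = (1 + \varepsilon \kappa(x)) e^u \quad \text{in } \mathbb{R}$$ of the form $u_\varepsilon = \mathcal{U}_{\mu_\varepsilon, \xi_\varepsilon} + \phi_\varepsilon$, for some $\xi_\varepsilon \in \mathbb{R}$ and $\mu_\varepsilon \in (0, +\infty)$ such that $(\xi_\varepsilon, \mu_\varepsilon) \to (\xi_\star, \mu_\star)$ as $\varepsilon \to 0^+$, and with $\phi_\varepsilon \in L^\infty(\mathbb{R})$ satisfying $\| \phi_\varepsilon \|_{L^\infty(\mathbb{R})} \le C \varepsilon$.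
   Context: Half-Laplacian: $(-\Delta)^{\frac{1}{2}} u(x) := \frac{1}{\pi}\, \mathrm{P.V.}\int_{\mathbb{R}} \frac{u(x)-u(y)}{(x-y)^2}\,dy$ for sufficiently smooth $u$; the same formula is used for functions with logarithmic growth such as $\mathcal{U}_{\mu,\xi}$. $C^{1,\alpha}(\mathbb{R})$ is the space of $C^1$ functions whose derivative is globally $\alpha$-Hölder continuous. Bubbles: for $\mu>0$, $\xi\in\mathbb{R}$, $\mathcal{U}_{\mu, \xi}(x) := \log \left( \frac{2 \mu}{\mu^2 + (x - \xi)^2} \right)$. $\mathbb{R}^2_+ := \{(\xi,\mu): \xi\in\mathbb{R},\ \mu>0\}$. The harmonic extension of $\kappa$ is $\Gamma(\xi, \mu) := \frac{1}{\pi} \int_{\mathbb{R}} \frac{\kappa(\xi + \mu y)}{1 + y^2} \, dy$ for $(\xi,\mu)\in\mathbb{R}^2_+$. A point $(\xi_\star,\mu_\star)\in\mathbb{R}^2_+$ is a non-degenerate critical point for $\Gamma$ if $\nabla\Gamma(\xi_\star,\mu_\star)=0$ and $\det D^2\Gamma(\xi_\star,\mu_\star)\neq 0$. *)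

(* Defs.v *)
From HB Require Import structures.
From mathcomp Require Import all_boot all_order all_algebra.
From mathcomp Require Import all_classical all_reals all_analysis.

Set Implicit Arguments.
Unset Strict Implicit.
Unset Printing Implicit Defensive.

Import Order.TTheory GRing.Theory Num.Theory.
Import numFieldNormedType.Exports.

Local Open Scope classical_set_scope.
Local Open Scope ring_scope.

Section Definitions.
Context {R : realType}.

Local Notation leb := (@lebesgue_measure R).

Definition is_C1 (f : R -> R) : Prop :=
  (forall x, derivable f x 1) /\ continuous (derive1 f).

Definition holder_on (A : set R) (a : R) (f : R -> R) : Prop :=
  exists K : R, forall x y, A x -> A y -> `|f x - f y| <= K * `|x - y| `^ a.

(* Only the derivative is required to be Hoelder; no bound is imposed on f
   or on its derivative. *)
Definition is_C1alpha (a : R) (f : R -> R) : Prop :=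
  is_C1 f /\ holder_on setT a (derive1 f).

Definition is_C1loc (f : R -> R) : Prop :=
  is_C1 f /\
  exists2 b : R, 0 < b & forall M : R, holder_on `[(- M), M] b (derive1 f).

Definition pv_integrand (u : R -> R) (x y : R) : R :=
  (u x - u y) / (x - y) ^+ 2.

Definition outside_ball (x r : R) : set R := [set y | r < `|x - y|].

Definition pv_truncation (u : R -> R) (x r : R) : R :=
  \int[leb]_(y in outside_ball x r) pv_integrand u x y.

Definition half_laplacian_exists (u : R -> R) (x : R) : Prop :=
  (forall r : R, 0 < r ->
     leb.-integrable (outside_ball x r) (EFin \o pv_integrand u x)) /\
  cvg (pv_truncation u x r @[r --> 0^'+]).

(* Meaningful only when [half_laplacian_exists u x]: both the integral and
   [lim] are total and take default values otherwise. *)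
Definition half_laplacian (u : R -> R) (x : R) : R :=
  pi^-1 * lim (pv_truncation u x r @[r --> 0^'+]).

(* Classical solutions of (-Delta)^(1/2) u = h(x) e^u on R.  Local C^{1,b}
   regularity is the usual smoothness under which the operator of order one
   is defined pointwise. *)
Definition is_solution (h u : R -> R) : Prop :=
  is_C1loc u /\
  forall x, half_laplacian_exists u x /\
            half_laplacian u x = h x * expR (u x).

Definition bubble (mu xi x : R) : R :=
  ln (2 * mu / (mu ^+ 2 + (x - xi) ^+ 2)).

(* Points of the half-plane are pairs (xi, mu) with 0 < mu. *)
Definition harmonic_extension (kappa : R -> R) (p : R * R) : R :=
  pi^-1 * \int[leb]_(y in setT) (kappa (p.1 + p.2 * y) / (1 + y ^+ 2)).

Definition plane_basis (i : 'I_2) : R * R :=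
  if i == ord0 then (1, 0) else (0, 1).

Definition partial (i : 'I_2) (F : R * R -> R) (p : R * R) : R :=
  'D_(plane_basis i) F p.

Definition gradient (F : R * R -> R) (p : R * R) : 'rV[R]_2 :=
  \row_i partial i F p.

Definition hessian (F : R * R -> R) (p : R * R) : 'M[R]_2 :=
  \matrix_(i, j) partial i (partial j F) p.

Definition nondegenerate_critical_point (F : R * R -> R) (p : R * R) : Prop :=
  [/\ 0 < p.2, gradient F p = 0 & \det (hessian F p) != 0].

End Definitions.

(* Main.v *)
Require Import Defs.
From mathcomp Require Import all_boot all_order all_algebra.
From mathcomp Require Import all_classical all_reals all_analysis.
From mathcomp Require Import measurable_realfun gauss_integral ess_sup_inf.
From mathcomp Require Import ring lra.

(** The idea is a Lyapunov-Schmidt reduction, carried out for an integral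
equation in the sup norm.

After translation and scaling the bubble is [ln (om y)] with
[om y = 2 / (1 + y ^+ 2)], and [kappa] becomes [K y = kappa (xis + mus * y)].
In the variable [theta = 2 atan y] the weight [om] is arc length on the circle
and the logarithmic kernel acts diagonally on trigonometric functions. A
function [u] solves the equation when it is, up to a constant, [- pi^-1] times
the logarithmic potential of [(1 + e * K) * expR u]
([half_laplacian_logpot]). Writing [u = ln om + e * psi], this density is
[om * (1 + e * h)] with [h = psi + K + e * G], where [G] is the remainder of
order two of the nonlinearity. Hence [h] must have mean zero and [psi] must be
[- pi^-1] times the potential of [h * om], up to a constant.

On the circle this potential splits as an operator [Lp] with a positive kernel
minus a multiple of the first modes [c1], [s1] of [h]
([profile_potential]). The mass of the kernel is [ln 2 < 1] ([Lp_1],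
[Lp_le]), so the part of the problem transverse to [c1], [s1] is solved by the
contraction principle, for sources without first modes ([lin_sol_ex]); this is
the operator [lsol]. The first modes of [psi] are then free, and they must be
chosen so that [K + e * G] has no first modes.

The first modes of [K] vanish because the point is critical for the harmonic
extension, and the second modes of [K] are, up to a factor, the entries of the
Hessian there ([critical_point_modes]). Those of [G] are, at leading order, an affine
function of the first modes of [psi]: the quadratic terms drop out because cubic
trigonometric monomials have zero mean ([int_cubic]), and the linear part is the
matrix with rows [(K_c2, K_s2)] and [(K_s2, - K_c2)] of second modes of [K],
which is invertible by nondegeneracy ([corr_first]). The remaining terms depend
on the unknown only through [e] times it, so that the whole system is a
contraction for small [e] ([perturbation_ex]).

The solution obtained in this way is [bubble mus xis + e * psi] with [psi]
bounded uniformly in [e], and with the parameters of the bubble constant.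

The half-Laplacian of a potential is computed without Fourier analysis: its
principal value is an absolutely convergent integral of second differences,
which is compared with Poisson integrals of the potential, themselves known by
the semigroup property of the Poisson kernel ([poisson_om], [log_poisson]). *)

Import Order.TTheory GRing.Theory Num.Theory.
Import numFieldNormedType.Exports.

Local Open Scope classical_set_scope.
Local Open Scope ring_scope.

Set Implicit Arguments.
Unset Strict Implicit.
Unset Printing Implicit Defensive.

(** * Integration on the line *)

Section MeasurableFacts.
Context d (T : measurableType d) (R : realType).
Implicit Types (f g : T -> R).

Lemma mfD f g : measurable_fun setT f -> measurable_fun setT g ->
  measurable_fun setT (fun x => f x + g x).
Proof. exact: measurable_funD. Qed.
Lemma mfB f g : measurable_fun setT f -> measurable_fun setT g ->
  measurable_fun setT (fun x => f x - g x).
Proof. exact: measurable_funB. Qed.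
Lemma mfN f : measurable_fun setT f -> measurable_fun setT (fun x => - f x).
Proof. exact: measurable_funN. Qed.
Lemma mfM f g : measurable_fun setT f -> measurable_fun setT g ->
  measurable_fun setT (fun x => f x * g x).
Proof. exact: measurable_funM. Qed.
Lemma mfX f n : measurable_fun setT f ->
  measurable_fun setT (fun x => f x ^+ n).
Proof. exact: measurable_funX. Qed.
Lemma mfln f : measurable_fun setT f -> measurable_fun setT (fun x => ln (f x)).
Proof. by move=> mf; apply: measurableT_comp. Qed.
Lemma mfexp f : measurable_fun setT f ->
  measurable_fun setT (fun x => expR (f x)).
Proof. by move=> mf; apply: measurableT_comp. Qed.
Lemma mfpow f (p : R) : measurable_fun setT f ->
  measurable_fun setT (fun x => f x `^ p).
Proof. by move=> mf; exact: (measurableT_comp (measurable_powR p) mf). Qed.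
Lemma mfnorm f : measurable_fun setT f -> measurable_fun setT (fun x => `|f x|).
Proof. by move=> mf; apply: measurableT_comp. Qed.
Lemma mfV f : measurable_fun setT f -> measurable_fun setT (fun x => (f x)^-1).
Proof.
move=> mf; rewrite (_ : (fun x => _) = fun x => f x * (f x ^+ 2) `^ (-1)).
  by apply: mfM => //; apply: mfpow; apply: mfX.
apply/funext => x; rewrite powR_inv1 ?sqr_ge0//.
have [->|f0] := eqVneq (f x) 0; first by rewrite invr0 mul0r.
by rewrite expr2 invfM mulrA divff// mul1r.
Qed.
Lemma mfC (f : R -> R) : continuous f -> measurable_fun setT f.
Proof. exact: continuous_measurable_fun. Qed.
Lemma mfcomp (h : R -> R) f : measurable_fun setT h -> measurable_fun setT f ->
  measurable_fun setT (fun x => h (f x)).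
Proof. by move=> mh mf; apply: measurableT_comp mh mf. Qed.
End MeasurableFacts.

(** Proves measurability by following the syntax of a real expression; opaque
functions are found in the context. *)
Ltac msolve := cbv beta;
  repeat first [ assumption | exact: measurable_cst |
  lazymatch goal with
  | |- measurable_fun _ (fun x => x) => exact: measurable_id
  | |- measurable_fun _ (fun x => x.1) => exact: measurable_fst
  | |- measurable_fun _ (fun x => x.2) => exact: measurable_snd
  | |- measurable_fun _ (fun x => @?f x - @?g x) => refine (@mfB _ _ _ f g _ _)
  | |- measurable_fun _ (fun x => @?f x + @?g x) => refine (@mfD _ _ _ f g _ _)
  | |- measurable_fun _ (fun x => @?f x * @?g x) => refine (@mfM _ _ _ f g _ _)
  | |- measurable_fun _ (fun x => - @?f x) => refine (@mfN _ _ _ f _)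
  | |- measurable_fun _ (fun x => @?f x ^+ ?n) => refine (@mfX _ _ _ f n _)
  | |- measurable_fun _ (fun x => (@?f x) ^-1) => refine (@mfV _ _ _ f _)
  | |- measurable_fun _ (fun x => `|@?f x|) => refine (@mfnorm _ _ _ f _)
  | |- measurable_fun _ (fun x => ln (@?f x)) => refine (@mfln _ _ _ f _)
  | |- measurable_fun _ (fun x => expR (@?f x)) => refine (@mfexp _ _ _ f _)
  | |- measurable_fun _ (fun x => @?f x `^ ?p) => refine (@mfpow _ _ _ f p _)
  | |- measurable_fun _ (fun x => ?h (@?f x)) =>
     refine (@mfcomp _ _ _ h f _ _)
  end ].

Section Toolbox.
Context {R : realType}.
Notation mu := (@lebesgue_measure R).
Implicit Types (f g h : R -> R).

Definition itg f := mu.-integrable setT (EFin \o f).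

Lemma itg_meas f : itg f -> measurable_fun setT f.
Proof. by move=> /integrableP[/measurable_EFinP]. Qed.

Lemma itg_dom g f : measurable_fun setT f -> itg g ->
  (forall x, `|f x| <= g x) -> itg f.
Proof.
move=> mf ig fg; apply: le_integrable ig => //; first exact/measurable_EFinP.
by move=> x _ /=; rewrite lee_fin (le_trans (fg x))// ler_norm.
Qed.

Lemma itgD f g : itg f -> itg g -> itg (fun x => f x + g x).
Proof. by move=> If Ig; rewrite /itg [X in integrable _ _ X](_ : _ = (EFin \o f) \+ (EFin \o g))%E//; exact: integrableD. Qed.
Lemma itgB f g : itg f -> itg g -> itg (fun x => f x - g x).
Proof. by move=> If Ig; rewrite /itg [X in integrable _ _ X](_ : _ = (EFin \o f) \- (EFin \o g))%E//; exact: integrableB. Qed.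
Lemma itgZ k f : itg f -> itg (fun x => k * f x).
Proof. by move=> If; rewrite /itg [X in integrable _ _ X](_ : _ = (fun x => k%:E * (EFin \o f) x)%E)//; exact: integrableZl. Qed.
Lemma itgZr k f : itg f -> itg (fun x => f x * k).
Proof. by move=> If; under [fun x => _]eq_fun do rewrite mulrC; exact: itgZ. Qed.
Lemma itgN f : itg f -> itg (fun x => - f x).
Proof. by move=> If; under [fun x => _]eq_fun do rewrite -mulN1r; exact: itgZ. Qed.
Lemma itg_norm f : itg f -> itg (fun x => `|f x|).
Proof. by move=> If; apply: integrable_norm. Qed.

Lemma intD f g : itg f -> itg g ->
  \int[mu]_x (f x + g x) = \int[mu]_x f x + \int[mu]_x g x.
Proof. by move=> If Ig; rewrite RintegralD. Qed.
Lemma intB f g : itg f -> itg g ->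
  \int[mu]_x (f x - g x) = \int[mu]_x f x - \int[mu]_x g x.
Proof. by move=> If Ig; rewrite RintegralB. Qed.
Lemma intZ k f : itg f -> \int[mu]_x (k * f x) = k * \int[mu]_x f x.
Proof. by move=> If; rewrite RintegralZl. Qed.
Lemma intZr k f : itg f -> \int[mu]_x (f x * k) = (\int[mu]_x f x) * k.
Proof. by move=> If; rewrite RintegralZr. Qed.
Lemma intN f : itg f -> \int[mu]_x (- f x) = - \int[mu]_x f x.
Proof.
by move=> If; under eq_Rintegral do rewrite -mulN1r; rewrite intZ// mulN1r.
Qed.
Lemma le_int f g : itg f -> itg g -> (forall x, f x <= g x) ->
  \int[mu]_x f x <= \int[mu]_x g x.
Proof. by move=> If Ig fg; apply: le_Rintegral. Qed.
Lemma int_ge0 f : (forall x, 0 <= f x) -> 0 <= \int[mu]_x f x.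
Proof. by move=> f0; apply: Rintegral_ge0. Qed.
Lemma int_dom f g : measurable_fun setT f -> itg g ->
  (forall x, `|f x| <= g x) -> `|\int[mu]_x f x| <= \int[mu]_x g x.
Proof.
move=> mf ig fg; have If := itg_dom mf ig fg.
apply: le_trans (le_normr_Rintegral _ If) _ => //.
by apply: le_int => //; exact: itg_norm.
Qed.
Lemma eq_int f g : f =1 g -> \int[mu]_x f x = \int[mu]_x g x.
Proof. by move=> /funext ->. Qed.
Lemma eq_itg f g : f =1 g -> itg f -> itg g.
Proof. by move=> /funext ->. Qed.

(** Integrands such as logarithmic kernels are only controlled off one point;
the next lemmas discard it, since Lebesgue measure has no atoms. *)
Lemma meas_off_pt (p : R) f : measurable_fun setT f ->
  measurable_fun setT (fun x => if x == p then 0 else f x).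
Proof.
move=> mf; apply: measurable_fun_ifT => //.
by apply: (measurable_fun_eqr (f := id) (g := cst p)).
Qed.

Lemma eq_int_pt (p : R) f g : measurable_fun setT f -> measurable_fun setT g ->
  (forall x, x != p -> f x = g x) -> \int[mu]_x f x = \int[mu]_x g x.
Proof.
move=> mf mg fg; rewrite /Rintegral; congr fine.
apply: ae_eq_integral => //; [exact/measurable_EFinP|exact/measurable_EFinP|].
exists [set p]; split => //; first exact: lebesgue_measure_set1.
move=> x /= H; apply: contrapT => xp; apply: H => _.
by rewrite fg//; apply/eqP.
Qed.

Lemma eq_itg_pt (p : R) f g : measurable_fun setT g -> itg f ->
  (forall x, x != p -> f x = g x) -> itg g.
Proof.
move=> mg If fg; have mf := itg_meas If.
apply/integrableP; split; first exact/measurable_EFinP.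
rewrite (_ : (\int[mu]_x `|(EFin \o g) x|)%E = (\int[mu]_x `|(EFin \o f) x|)%E).
  by case/integrableP : If.
apply: ae_eq_integral => //.
- by apply: measurableT_comp => //; exact/measurable_EFinP.
- by apply: measurableT_comp => //; exact/measurable_EFinP.
exists [set p]; split => //; first exact: lebesgue_measure_set1.
move=> x /= H; apply: contrapT => xp; apply: H => _.
by rewrite fg//; apply/eqP.
Qed.

Lemma itg_dom1 (p : R) f g : measurable_fun setT f -> itg g ->
  (forall x, 0 <= g x) -> (forall x, x != p -> `|f x| <= g x) -> itg f.
Proof.
move=> mf Ig g0 fg.
apply: (eq_itg_pt (p := p) (f := fun x => if x == p then 0 else f x)) => //; last first.
  by move=> x /negbTE ->.
apply: (itg_dom (meas_off_pt p mf) Ig) => x.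
by case: eqP => [_|/eqP xp]; [rewrite normr0|exact: fg].
Qed.

Lemma int_dom2 (p q : R) f g : measurable_fun setT f -> itg g ->
  (forall x, 0 <= g x) ->
  (forall x, x != p -> x != q -> `|f x| <= g x) ->
  `|\int[mu]_x f x| <= \int[mu]_x g x.
Proof.
move=> mf Ig g0 fg.
have mf1 := meas_off_pt p mf; have mf2 := meas_off_pt q mf1.
rewrite (eq_int_pt (p := p) mf mf1); last by move=> x /negbTE ->.
rewrite (eq_int_pt (p := q) mf1 mf2); last by move=> x /negbTE ->.
apply: int_dom => // x.
case: eqP => [_|/eqP xq]; first by rewrite normr0.
by case: eqP => [_|/eqP xp]; [rewrite normr0|exact: fg].
Qed.

(** Lebesgue measure is the multiple by [b] of its image under an affine map of
slope [b], because both agree on intervals. *)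
Lemma ge0_int_affine (a b : R) (F : R -> \bar R) : 0 < b ->
  measurable_fun setT F -> (forall x, 0 <= F x)%E ->
  (\int[mu]_x F x = b%:E * \int[mu]_x F (a + b * x)%R)%E.
Proof.
move=> b0 mF F0.
pose phi := (fun y : R => a + b * y).
have mphi0 : measurable_fun setT phi by rewrite /phi; msolve.
have mphi : measurable_fun setT (phi : measurableTypeR R -> measurableTypeR R) by exact: mphi0.
pose P := measure_function_pushforward__canonical__measure_function_Measure mu mphi.
pose nu := mscale (NngNum (ltW b0)) P.
have E A : measurable A -> mu A = nu A.
  apply: (@lebesgue_measure_unique R nu) => _ [[c e] _ <-] /=.
  rewrite /nu /mscale /= /pushforward.
  have -> : phi @^-1` `]c, e] = `](c - a) / b, (e - a) / b]%classic.
    apply/seteqP; split => x /=; rewrite !in_itv/= ltr_pdivrMr// ler_pdivlMr//;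
      by rewrite /phi ltrBlDl lerBrDl (mulrC x).
  rewrite !lebesgue_measure_itv /= !lte_fin ltr_pM2r ?invr_gt0//.
  rewrite ltrD2r; case: ifPn => ce; last by rewrite mule0.
  by rewrite -!EFinB -EFinM; congr EFin; field; rewrite gt_eqF.
rewrite [LHS](@eq_measure_integral _ _ _ _ nu)//; last first.
  by move=> A mA _; exact: E.
by rewrite ge0_integral_mscale//= ge0_integral_pushforward.
Qed.

Lemma itg_affine (a b : R) f : 0 < b -> itg f -> itg (fun x => f (a + b * x)).
Proof.
move=> b0 If; have mf := itg_meas If.
have mg : measurable_fun setT (fun x => f (a + b * x)) by msolve.
case/integrableP : (If) => _; rewrite (@ge0_int_affine a b)//=; last first.
  by apply/measurable_EFinP; apply: mfnorm.
move=> H; apply/integrableP; split; first exact/measurable_EFinP.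
rewrite -(@lte_pmul2l _ b%:E)//; apply: lt_le_trans H _ => //.
by rewrite gt0_muley ?lte_fin// leey.
Qed.

Lemma int_affine (a b : R) f : 0 < b -> itg f ->
  \int[mu]_x f x = b * \int[mu]_x f (a + b * x).
Proof.
move=> b0 If; have mf := itg_meas If.
have Ig := itg_affine a b0 If.
pose f1 x := (f x)%:E; pose f2 x := (f (a + b * x))%:E.
have E1 : (\int[mu]_x f1^\+ x = b%:E * \int[mu]_x f2^\+ x)%E.
  rewrite (_ : f2^\+ = fun x => f1^\+ (a + b * x)%R)%E; last by rewrite !unlock.
  by apply: ge0_int_affine => //; apply: measurable_funepos; exact/measurable_EFinP.
have E2 : (\int[mu]_x f1^\- x = b%:E * \int[mu]_x f2^\- x)%E.
  rewrite (_ : f2^\- = fun x => f1^\- (a + b * x)%R)%E; last by rewrite !unlock.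
  by apply: ge0_int_affine => //; apply: measurable_funeneg; exact/measurable_EFinP.
have E : (\int[mu]_x f1 x = b%:E * \int[mu]_x f2 x)%E.
  rewrite integralE [in RHS]integralE E1 E2; apply/esym/muleBr => //.
  by apply: fin_num_adde_defr; exact: (integrable_pos_fin_num measurableT Ig).
have -> : b * \int[mu]_x f (a + b * x) = fine (b%:E * \int[mu]_x f2 x)%E.
  by rewrite /Rintegral fineM//; exact: (integrable_fin_num measurableT Ig).
exact: (congr1 (@fine R) E).
Qed.

Lemma ge0_int_opp (F : R -> \bar R) :
  measurable_fun setT F -> (forall x, 0 <= F x)%E ->
  (\int[mu]_x F x = \int[mu]_x F (- x)%R)%E.
Proof.
move=> mF F0.
pose phi := (fun y : R => - y).
have mphi0 : measurable_fun setT phi by rewrite /phi; msolve.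
have mphi : measurable_fun setT (phi : measurableTypeR R -> measurableTypeR R).
  by exact: mphi0.
pose nu := measure_function_pushforward__canonical__measure_function_Measure mu mphi.
rewrite [LHS](@eq_measure_integral _ _ _ _ nu)//; last first.
  by move=> A mA _; rewrite /nu/= -lebesgue_measureN.
by rewrite ge0_integral_pushforward.
Qed.

Lemma itg_opp f : itg f -> itg (fun x => f (- x)).
Proof.
move=> If; have mf := itg_meas If.
have mg : measurable_fun setT (fun x : R => f (- x)) by msolve.
case/integrableP : (If) => _; rewrite ge0_int_opp//=; last first.
  by apply/measurable_EFinP; apply: mfnorm.
by move=> H; apply/integrableP; split => //; exact/measurable_EFinP.
Qed.

Lemma int_opp f : measurable_fun setT f ->
  \int[mu]_x f x = \int[mu]_x f (- x).
Proof.
move=> mf.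
pose f1 x := (f x)%:E; pose f2 x := (f (- x))%:E.
have E1 : (\int[mu]_x f1^\+ x = \int[mu]_x f2^\+ x)%E.
  rewrite (_ : f2^\+ = fun x => f1^\+ (- x)%R)%E; last by rewrite !unlock.
  by apply: ge0_int_opp => //; apply: measurable_funepos; exact/measurable_EFinP.
have E2 : (\int[mu]_x f1^\- x = \int[mu]_x f2^\- x)%E.
  rewrite (_ : f2^\- = fun x => f1^\- (- x)%R)%E; last by rewrite !unlock.
  by apply: ge0_int_opp => //; apply: measurable_funeneg; exact/measurable_EFinP.
have E : (\int[mu]_x f1 x = \int[mu]_x f2 x)%E.
  by rewrite integralE [in RHS]integralE E1 E2.
exact: (congr1 (@fine R) E).
Qed.

Lemma itg_refl x f : itg f -> itg (fun t => f (x - t)).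
Proof.
move=> /itg_opp /(@itg_affine (- x) 1 _ ltr01) /eq_itg; apply => t.
by rewrite mul1r opprD opprK.
Qed.

Lemma itg_shift x f : itg f -> itg (fun t => f (x + t)).
Proof.
move=> /(@itg_affine x 1 _ ltr01) /eq_itg; apply => t; by rewrite mul1r.
Qed.

Lemma int_shift x f : itg f -> \int[mu]_t f t = \int[mu]_t f (x + t).
Proof.
move=> If; rewrite (int_affine x ltr01 If) mul1r; apply: eq_int => t.
by rewrite mul1r.
Qed.

Lemma int_refl x f : itg f -> \int[mu]_t f t = \int[mu]_t f (x - t).
Proof.
move=> If; have mf := itg_meas If.
rewrite (int_shift x If) int_opp//; msolve.
Qed.

(** Tonelli's theorem turns the majorant [g] of the inner integrals of [`|f|]
into integrability on the product, which Fubini's theorem requires. *)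
Lemma fubini_dom (f : R -> R -> R) g :
  measurable_fun setT (fun z : R * R => f z.1 z.2) ->
  (forall x, itg (f x)) -> (forall y, itg (f ^~ y)) -> itg g ->
  (forall x, \int[mu]_y `|f x y| <= g x) ->
  itg (fun x => \int[mu]_y f x y) /\
  \int[mu]_x \int[mu]_y f x y = \int[mu]_y \int[mu]_x f x y.
Proof.
move=> mf fx fy Ig fg.
have mF : measurable_fun setT (fun z : R * R => (f z.1 z.2)%:E).
  exact/measurable_EFinP.
have I2 : (mu \x mu)%E.-integrable setT (fun z : R * R => (f z.1 z.2)%:E).
  apply/integrable12ltyP => //=.
  case/integrableP : (Ig) => mg; apply: le_lt_trans.
  apply: ge0_le_integral => //.
  - by move=> x _; apply: integral_ge0 => y _; rewrite lee_fin.
  - have := @measurable_fun_fubini_tonelli_F _ _ (measurableTypeR R) (measurableTypeR R) R mu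
      (fun z : R * R => `|f z.1 z.2|%:E); apply => //.
    by apply/measurable_EFinP; apply: mfnorm.
  - by apply: measurableT_comp.
  move=> x _ /=.
  rewrite -(@fineK _ (\int[mu]_y _)%E); last first.
    exact: (integrable_fin_num measurableT (itg_norm (fx x))).
  by rewrite lee_fin (le_trans (fg x))// ler_norm.
have F1 x : (\int[mu]_y (f x y)%:E)%E = (\int[mu]_y f x y)%:E.
  by rewrite /Rintegral fineK//; exact: (integrable_fin_num measurableT (fx x)).
have F2 y : (\int[mu]_x (f x y)%:E)%E = (\int[mu]_x f x y)%:E.
  by rewrite /Rintegral fineK//; exact: (integrable_fin_num measurableT (fy y)).
split.
  have := integrable_fubini_F I2; rewrite /fubini_F /=.
  by apply: eq_integrable => // x _ /=; rewrite F1.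
have := Fubini I2 => /=.
under eq_integral do rewrite F1.
under [X in _ = X -> _]eq_integral do rewrite F2.
by move=> E; congr fine.
Qed.

(** Tonelli's theorem gives measurability for nonnegative integrands; the
positive and negative parts of [f] are written as [Num.max (s * f x y) 0]
with [s = 1] and [s = -1]. *)
Lemma meas_int_param (f : R -> R -> R) :
  measurable_fun setT (fun z : R * R => f z.1 z.2) ->
  (forall x, itg (f x)) -> measurable_fun setT (fun x => \int[mu]_y f x y).
Proof.
move=> mf fx.
have mp (s : R) : measurable_fun setT
    (fun x => (\int[mu]_y (Num.max (s * f x y) 0)%:E)%E).
  have := @measurable_fun_fubini_tonelli_F _ _ (measurableTypeR R) (measurableTypeR R) R mu
    (fun z : R * R => (Num.max (s * f z.1 z.2) 0)%:E); apply => //; last first.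
    by move=> z; rewrite lee_fin le_max lexx orbT.
  apply/measurable_EFinP; apply: measurable_maxr => //.
  by apply: (@mfM _ _ _ (cst s) (fun z : R * R => f z.1 z.2)).
have Is s x : itg (fun y => Num.max (s * f x y) 0).
  apply: (itg_dom (g := fun y => `|s * f x y|)).
  - apply: measurable_maxr => //; apply: (@mfM _ _ _ (cst s)) => //.
    exact: itg_meas (fx x).
  - by apply: itg_norm; apply: itgZ.
  move=> y; rewrite ger0_norm ?le_max ?lexx ?orbT//.
  by rewrite ge_max ler_norm normr_ge0.
rewrite (_ : (fun x => _) = fun x =>
    fine (\int[mu]_y (Num.max (1 * f x y) 0)%:E)%E -
    fine (\int[mu]_y (Num.max (-1 * f x y) 0)%:E)%E).
  by apply: mfB; apply: measurableT_comp.
apply/funext => x.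
rewrite -[RHS]intB; [|exact: Is|exact: Is].
apply: eq_int => y; rewrite mul1r mulN1r.
case: (leP 0 (f x y)) => H.
  by rewrite max_r ?oppr_le0// subr0.
by rewrite max_l ?oppr_ge0 ?(ltW H)// sub0r opprK.
Qed.

End Toolbox.

(** * The fundamental theorem of calculus across a singular point *)

(** A plain proposition, so that derivatives are supplied explicitly and not by
instance resolution. *)
Definition isd {R : realType} (f : R -> R) (x a : R) : Prop :=
  is_derive x (1:R) f a.

Section FTC.
Context {R : realType}.
Notation mu := (@lebesgue_measure R).
Implicit Types (f F : R -> R).

Lemma ftc_segment (a b : R) f F : a < b ->
  (forall x, a <= x <= b -> {for x, continuous f}) ->
  (forall x, a <= x <= b -> is_derive x 1 F (f x)) ->
  mu.-integrable `[a, b] (EFin \o f) /\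
  \int[mu]_(x in `[a, b]) f x = F b - F a.
Proof.
move=> ab cf dF.
have wcf : {within `[a, b], continuous f}.
  by apply: continuous_in_subspaceT => x; rewrite inE/= in_itv/= => /cf.
have cF x : a <= x <= b -> {for x, continuous F}.
  move=> /dF [df _]; apply/differentiable_continuous.
  by rewrite -derivable1_diffP.
split.
  by apply: continuous_compact_integrable => //; exact: segment_compact.
rewrite /Rintegral (continuous_FTC2 (F := F) ab wcf)//.
  split.
  - move=> x; rewrite in_itv/= => /andP[ax xb].
    by have [] : is_derive x 1 F (f x) by apply: dF; rewrite !ltW.
  - by apply: cvg_at_right_filter; apply: cF; rewrite lexx ltW.
  - by apply: cvg_at_left_filter; apply: cF; rewrite lexx ltW.
move=> x; rewrite in_itv/= => /andP[ax xb].
have [_ <-] : is_derive x 1 F (f x) by apply: dF; rewrite !ltW.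
by rewrite derive1E.
Qed.

(** A truncation that leaves two segments, on which the fundamental theorem of
calculus applies to regular integrands. *)
Let cut (p : R) (n : nat) f x :=
  if (n.+1%:R^-1 <= `|x - p|) && (`|x - p| <= n.+2%:R) then f x else 0.

Let cutE p n f x : cut p n f x =
  (f \_ `[p + n.+1%:R^-1, p + n.+2%:R]) x +
  (f \_ `[p - n.+2%:R, p - n.+1%:R^-1]) x.
Proof.
have n1 : (0:R) < n.+1%:R^-1 by rewrite invr_gt0.
rewrite /cut !patchE !mem_setE !in_itv/=.
move: (n.+1%:R^-1) (n.+2%:R) n1 => u v n1.
have [xp|xp] := leP p x.
  rewrite ger0_norm ?subr_ge0// lerBrDl lerBlDl.
  case: ifP => _; case: ifP => [/andP[H1 H2]|_]; rewrite ?addr0//.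
  - by exfalso; move: H1 H2 n1 xp; lra.
  - by exfalso; move: H1 H2 n1 xp; lra.
have -> : `|x - p| = p - x by rewrite ler0_norm ?opprB// subr_le0 ltW.
case: ifP => [/andP[H1 H2]|H]; case: ifP => [/andP[H3 H4]|H']; rewrite ?add0r//.
- by exfalso; move: H3 H4 n1 xp; lra.
- case: ifP => // /negbT; rewrite negb_and -!ltNge => /orP[]; move: H1 H2; lra.
- by exfalso; move: H3 H4 n1 xp; lra.
case: ifP => // /andP[H5 H6]; move/negbT: H; rewrite negb_and -!ltNge => /orP[];
  by move: H5 H6; lra.
Qed.

Let cut_int (p : R) n f F :
  (forall x, x != p -> {for x, continuous f}) ->
  (forall x, x != p -> is_derive x 1 F (f x)) ->
  itg (cut p n f) /\
  \int[mu]_x cut p n f x =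
    F (p + n.+2%:R) - F (p + n.+1%:R^-1) + (F (p - n.+1%:R^-1) - F (p - n.+2%:R)).
Proof.
move=> cf dF.
have n1 : (0:R) < n.+1%:R^-1 by rewrite invr_gt0.
have n12 : (n.+1%:R^-1 : R) < n.+2%:R.
  rewrite (@le_lt_trans _ _ 1)//; first by rewrite invf_le1// ler1n.
  by rewrite ltr1n.
have [I1 E1] : mu.-integrable `[p + n.+1%:R^-1, p + n.+2%:R] (EFin \o f) /\
    \int[mu]_(x in `[p + n.+1%:R^-1, p + n.+2%:R]) f x =
    F (p + n.+2%:R) - F (p + n.+1%:R^-1).
  apply: ftc_segment => [|x /andP[H _]|x /andP[H _]]; first by rewrite ltrD2l.
  - by apply: cf; apply/eqP => E; move: H n1; rewrite E; move: (n.+1%:R^-1) => u; lra.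
  - by apply: dF; apply/eqP => E; move: H n1; rewrite E; move: (n.+1%:R^-1) => u; lra.
have [I2 E2] : mu.-integrable `[p - n.+2%:R, p - n.+1%:R^-1] (EFin \o f) /\
    \int[mu]_(x in `[p - n.+2%:R, p - n.+1%:R^-1]) f x =
    F (p - n.+1%:R^-1) - F (p - n.+2%:R).
  apply: ftc_segment => [|x /andP[_ H]|x /andP[_ H]]; first by rewrite ltrD2l ltrN2.
  - by apply: cf; apply/eqP => E; move: H n1; rewrite E; move: (n.+1%:R^-1) => u; lra.
  - by apply: dF; apply/eqP => E; move: H n1; rewrite E; move: (n.+1%:R^-1) => u; lra.
have J1 : itg (f \_ `[p + n.+1%:R^-1, p + n.+2%:R]).
  rewrite /itg -restrict_EFin; exact: (proj1 (integrable_mkcond _ _) I1).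
have J2 : itg (f \_ `[p - n.+2%:R, p - n.+1%:R^-1]).
  rewrite /itg -restrict_EFin; exact: (proj1 (integrable_mkcond _ _) I2).
rewrite (_ : cut p n f = fun x => (f \_ `[p + n.+1%:R^-1, p + n.+2%:R]) x +
  (f \_ `[p - n.+2%:R, p - n.+1%:R^-1]) x); last by apply/funext => x; rewrite cutE.
split; first exact: itgD.
by rewrite intD// -!Rintegral_mkcond E1 E2.
Qed.

Let cut_cvg p f x : x != p -> (cut p n f x)%:E @[n --> \oo] --> (f x)%:E.
Proof.
move=> xp; apply: cvg_near_cst; near=> n.
have nx : 0 < `|x - p| by rewrite normr_gt0 subr_eq0.
rewrite /cut ifT//; apply/andP; split.
  rewrite -[leRHS]invrK lef_pV2 ?posrE ?invr_gt0//.
  rewrite (@le_trans _ _ n%:R)//; last by rewrite ler_nat leqnSn.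
  by near: n; exact: nbhs_infty_ger.
rewrite (@le_trans _ _ n%:R)//; last by rewrite ler_nat -addn2 leq_addr.
by near: n; exact: nbhs_infty_ger.
Unshelve. all: end_near. Qed.

Let cut_meas p n f : measurable_fun setT f -> measurable_fun setT (cut p n f).
Proof.
move=> mf; rewrite (_ : cut p n f = fun x => (f \_ `[p + n.+1%:R^-1, p + n.+2%:R]) x +
  (f \_ `[p - n.+2%:R, p - n.+1%:R^-1]) x); last by apply/funext => x; rewrite cutE.
by apply: mfD; apply/(measurable_restrictT _ _).1 => //; exact: measurable_funS mf.
Qed.

Let cut_cvg' p f x :
  (cut p n f x)%:E @[n --> \oo] --> (if x == p then 0 else f x)%:E.
Proof.
case: eqP => [->|/eqP xp]; last exact: cut_cvg.
rewrite (_ : (fun n => _) = cst 0%:E); first exact: cvg_cst.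
apply/funext => n.
by rewrite /cut subrr normr0 leNgt invr_gt0 ltr0Sn.
Qed.

(** The integrand may be singular at [p]: the boundary terms of the two segments
next to [p] cancel in the limit because [F] is continuous there, and the
truncation is removed by dominated convergence. *)
Lemma ftc_line (p l1 l2 : R) f F : itg f ->
  (forall x, x != p -> {for x, continuous f}) ->
  (forall x, x != p -> isd F x (f x)) ->
  {for p, continuous F} ->
  F x @[x --> -oo] --> l1 -> F x @[x --> +oo] --> l2 ->
  \int[mu]_x f x = l2 - l1.
Proof.
move=> If cf dF cF F1 F2; have mf := itg_meas If.
pose f' x := if x == p then 0 else f x.
have mf' : measurable_fun setT f' by exact: meas_off_pt.
have -> : \int[mu]_x f x = \int[mu]_x f' x.
  by apply: (@eq_int_pt _ p) => // x; rewrite /f' => /negbTE ->.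
have M1 n : measurable_fun setT (fun x => (cut p n f x)%:E).
  by apply/measurable_EFinP; exact: cut_meas.
have M2 : measurable_fun setT (fun x => (f' x)%:E) by exact/measurable_EFinP.
have B n x : (`|(cut p n f x)%:E| <= `|f x|%:E)%E.
  by rewrite lee_fin /cut; case: ifP => // _; rewrite normr0.
have [If' _ C] : [/\ mu.-integrable setT (fun x => (f' x)%:E),
    [sequence \int[mu]_x (`|(cut p n f x)%:E - (f' x)%:E|)]_n @ \oo --> 0 &
    [sequence \int[mu]_x (cut p n f x)%:E]_n @ \oo -->
      \int[mu]_x (f' x)%:E]%E.
  apply: (@dominated_convergence _ _ _ mu setT measurableT _ _
    (fun x => `|f x|%:E)) => //.
  - by apply: aeW => x _; exact: cut_cvg'.
  - exact: itg_norm.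
  - by apply: aeW => x n _; exact: B.
have {}C : \int[mu]_x cut p n f x @[n --> \oo] --> \int[mu]_x f' x.
  apply: fine_cvg; rewrite fineK//.
  exact: (integrable_fin_num measurableT If').
apply: (cvg_unique _ C) => //.
rewrite (_ : (fun n => _) = fun n => F (p + n.+2%:R) - F (p + n.+1%:R^-1) +
    (F (p - n.+1%:R^-1) - F (p - n.+2%:R))); last first.
  by apply/funext => n; have [_ ->] := @cut_int p n f F cf dF.
have -> : l2 - l1 = l2 - F p + (F p - l1) by rewrite addrA subrK.
have H1 : F (p + n.+2%:R) @[n --> \oo] --> l2.
  apply: (cvg_comp (fun n => p + n.+2%:R) F) F2.
  apply/cvgryPge => A; near=> n.
  rewrite -lerBlDl (@le_trans _ _ n%:R)//; last by rewrite ler_nat -addn2 leq_addr.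
  by near: n; exact: nbhs_infty_ger.
have H2 : F (p - n.+2%:R) @[n --> \oo] --> l1.
  apply: (cvg_comp (fun n => p - n.+2%:R) F) F1.
  apply/cvgrNyPle => A; near=> n.
  rewrite lerBlDl -lerBlDr (@le_trans _ _ n%:R)//; last by rewrite ler_nat -addn2 leq_addr.
  by near: n; exact: nbhs_infty_ger.
have H3 : n.+1%:R^-1 @[n --> \oo] --> (0:R) by exact: cvg_harmonic.
have H4 : F (p + n.+1%:R^-1) @[n --> \oo] --> F p.
  apply: (cvg_comp (fun n => p + n.+1%:R^-1) F) cF.
  have -> : nbhs p = nbhs (p + 0) by rewrite addr0.
  by apply: cvgD => //; exact: cvg_cst.
have H5 : F (p - n.+1%:R^-1) @[n --> \oo] --> F p.
  apply: (cvg_comp (fun n => p - n.+1%:R^-1) F) cF.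
  have -> : nbhs p = nbhs (p - 0) by rewrite subr0.
  by apply: cvgB => //; exact: cvg_cst.
by apply: cvgD; apply: cvgB.
Unshelve. all: end_near. Qed.

(** By Fatou's lemma: the truncated integrals are differences of values of [F],
at most [4 * M]. *)
Lemma itg_ge0_antiderivative (p M : R) f F : measurable_fun setT f ->
  (forall x, 0 <= f x) ->
  (forall x, x != p -> {for x, continuous f}) ->
  (forall x, x != p -> isd F x (f x)) ->
  (forall x, `|F x| <= M) -> itg f.
Proof.
move=> mf f0 cf dF FM.
pose f' x := if x == p then 0 else f x.
have mf' : measurable_fun setT f' by exact: meas_off_pt.
suff : itg f' by move=> /(@eq_itg_pt _ p f' f); apply => // x; rewrite /f' => /negbTE ->.
apply/integrableP; split; first exact/measurable_EFinP.
rewrite (@le_lt_trans _ _ (4 * M)%:E)//; last exact: ltry.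
have M1 n : measurable_fun setT (fun x => (cut p n f x)%:E).
  by apply/measurable_EFinP; exact: cut_meas.
have := @fatou _ _ _ mu setT measurableT (fun n x => (cut p n f x)%:E) M1 _.
have c0 n (x : R) : 0 <= cut p n f x by rewrite /cut; case: ifP.
move=> /(_ (fun n x _ => c0 n x)) H.
have LE (x : R) : limn_einf (fun n => (cut p n f x)%:E) = (`|f' x|)%:E.
  rewrite (cvg_limn_einf_sup (@cut_cvg' p f x)).1 ger0_norm//.
  by rewrite /f'; case: ifP.
move: H; under eq_integral do rewrite LE.
move=> H; apply: le_trans H _.
have E n : (\int[mu]_x (cut p n f x)%:E <= (4 * M)%:E)%E.
  have [I E] := @cut_int p n f F cf dF.
  have -> : (\int[mu]_x (cut p n f x)%:E = (\int[mu]_x cut p n f x)%:E)%E.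
    by rewrite /Rintegral fineK//; exact: (integrable_fin_num measurableT I).
  rewrite lee_fin E.
  have := FM (p + n.+2%:R); have := FM (p + n.+1%:R^-1).
  have := FM (p - n.+2%:R); have := FM (p - n.+1%:R^-1).
  by rewrite !ler_norml; move: (F _) (F _) (F _) (F _) => a b c d; lra.
rewrite limn_einf_lim.
apply: lime_le; first exact: is_cvg_einfs.
apply: nearW => n; apply: ge_ereal_inf.
by exists (\int[mu]_x (cut p n f x)%:E)%E => //; exists n => /=.
Qed.

End FTC.

(** * Derivatives, limits and the density of the bubble *)

Section DerivativeFacts.
Context {R : realType}.
Implicit Types (f g : R -> R) (x a b : R).

Lemma d_id x : isd (id : R -> R) x (1:R).
Proof. exact: is_derive_id. Qed.
Lemma d_cst x c : isd (cst c : R -> R) x (0:R).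
Proof. exact: is_derive_cst. Qed.
Lemma dD f g x a b : isd f x a -> isd g x b ->
  isd (fun t => f t + g t) x (a + b).
Proof. by rewrite /isd => ? ?; exact: is_deriveD. Qed.
Lemma dN f x a : isd f x a ->
  isd (fun t => - f t) x (- a).
Proof. by rewrite /isd => ?; exact: is_deriveN. Qed.
Lemma dB f g x a b : isd f x a -> isd g x b ->
  isd (fun t => f t - g t) x (a - b).
Proof. by rewrite /isd => ? ?; exact: is_deriveB. Qed.
Lemma dM f g x a b : isd f x a -> isd g x b ->
  isd (fun t => f t * g t) x (a * g x + f x * b).
Proof.
rewrite /isd => ? ?; apply: (is_derive_eq (is_deriveM _ _)) => //.
by rewrite addrC /GRing.scale /= (mulrC a).
Qed.
Lemma dX f n x a : isd f x a ->
  isd (fun t => f t ^+ n.+1) x (n.+1%:R * f x ^+ n * a).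
Proof.
rewrite /isd => ?; rewrite (_ : (fun t => _) = f ^+ n.+1); last first.
  by rewrite exprfctE.
exact: (is_derive_eq (is_deriveX n.+1 _)).
Qed.
Lemma isd_comp f g x a b : isd g (f x) b -> isd f x a ->
  isd (fun t => g (f t)) x (b * a).
Proof. by move=> dg df; exact: (@is_derive1_comp _ g f x b a dg df). Qed.
Lemma dV f x a : f x != 0 -> isd f x a ->
  isd (fun t => (f t)^-1) x (- (f x) ^- 2 * a).
Proof. by rewrite /isd => ? ?; exact: is_deriveV. Qed.
Lemma dln f x a : 0 < f x -> isd f x a ->
  isd (fun t => ln (f t)) x ((f x)^-1 * a).
Proof. by move=> f0 ?; apply: isd_comp => //; exact: is_derive1_ln. Qed.
Lemma dexp f x a : isd f x a ->
  isd (fun t => expR (f t)) x (expR (f x) * a).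
Proof. by move=> ?; apply: isd_comp => //; exact: is_derive_expR. Qed.
Lemma datan f x a : isd f x a ->
  isd (fun t => atan (f t)) x ((1 + (f x) ^+ 2)^-1 * a).
Proof. by move=> ?; apply: isd_comp => //; exact: is_derive1_atan. Qed.

Lemma d_cont f x a : isd f x a -> {for x, continuous f}.
Proof.
by move=> [df _]; apply/differentiable_continuous; rewrite -derivable1_diffP.
Qed.
Lemma deq f x a b : a = b -> isd f x a -> isd f x b.
Proof. by move=> <-. Qed.
End DerivativeFacts.

(** Differentiates an explicit expression in one variable; the positivity and
nonvanishing conditions are left as subgoals. *)
Ltac dsolve := cbv beta;
  repeat first [ assumption | exact: d_cst |
  lazymatch goal with
  | |- isd (fun x => x) _ _ => exact: d_id
  | |- isd (fun x => @?f x - @?g x) _ _ => notypeclasses refine (@dB _ f g _ _ _ _ _)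
  | |- isd (fun x => @?f x + @?g x) _ _ => notypeclasses refine (@dD _ f g _ _ _ _ _)
  | |- isd (fun x => @?f x * @?g x) _ _ => notypeclasses refine (@dM _ f g _ _ _ _ _)
  | |- isd (fun x => - @?f x) _ _ => notypeclasses refine (@dN _ f _ _ _)
  | |- isd (fun x => @?f x ^+ (S ?n)) _ _ => notypeclasses refine (@dX _ f n _ _ _)
  | |- isd (fun x => (@?f x) ^-1) _ _ => notypeclasses refine (@dV _ f _ _ _ _)
  | |- isd (fun x => ln (@?f x)) _ _ => notypeclasses refine (@dln _ f _ _ _ _)
  | |- isd (fun x => expR (@?f x)) _ _ => notypeclasses refine (@dexp _ f _ _ _)
  | |- isd (fun x => atan (@?f x)) _ _ => notypeclasses refine (@datan _ f _ _ _)
  | H : isd ?h ?x _ |- isd (fun y => ?h y) ?x _ => exact: H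
  end ].

Section Limits.
Context {R : realType}.
Implicit Types (f g : R -> R).

Lemma cvgy_inv (C l : R) g : (forall x, 1 <= x -> `|g x - l| <= C * x^-1) ->
  g x @[x --> +oo] --> l.
Proof.
move=> H; apply/cvgrPdist_le => e e0; near=> x.
have x1 : 1 <= x by near: x; exact: nbhs_pinfty_ge.
rewrite distrC (le_trans (H _ x1))// ler_pdivrMr ?(lt_le_trans ltr01)//.
rewrite -ler_pdivrMl//; near: x; exact: nbhs_pinfty_ge.
Unshelve. all: end_near. Qed.

Lemma cvgNy_inv (C l : R) g : (forall x, x <= -1 -> `|g x - l| <= C * `|x|^-1) ->
  g x @[x --> -oo] --> l.
Proof.
move=> H; apply/cvgNy_compNP; apply: (@cvgy_inv C) => x x1.
have := H (- x); rewrite lerN2 => /(_ x1).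
by rewrite normrN (ger0_norm (le_trans ler01 x1)).
Qed.

Lemma cvgNy_atan : (@atan R) x @[x --> -oo] --> - (pi / 2).
Proof.
apply/cvgNy_compNP; rewrite (_ : _ \o _ = fun x => - atan x); last first.
  by apply/funext => x /=; rewrite atanN.
by apply: cvgN; exact: cvgy_atan.
Qed.
End Limits.

Section Model.
Context {R : realType}.
Notation mu := (@lebesgue_measure R).

Definition om (x : R) := 2 / (1 + x ^+ 2).

Lemma sq1_gt0 (x : R) : 0 < 1 + x ^+ 2.
Proof. by rewrite ltr_wpDr ?sqr_ge0. Qed.
Lemma sq1_neq0 (x : R) : 1 + x ^+ 2 != 0.
Proof. by rewrite gt_eqF ?sq1_gt0. Qed.
Lemma om_gt0 x : 0 < om x.
Proof. by rewrite divr_gt0 ?sq1_gt0. Qed.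
Lemma om_le2 x : om x <= 2.
Proof. by rewrite ler_pdivrMr ?sq1_gt0// ler_peMr// lerDl sqr_ge0. Qed.
Lemma om_meas : measurable_fun setT om.
Proof. by rewrite /om; msolve. Qed.
Lemma om_derive x : isd om x (- (x * om x ^+ 2)).
Proof.
rewrite /om; apply: deq; last by dsolve; exact: sq1_neq0.
by cbv beta; field; exact: sq1_neq0.
Qed.

Lemma om_atan x : isd (fun t => 2 * atan t) x (om x).
Proof.
rewrite /om; apply: deq; last by dsolve.
by cbv beta; rewrite mul0r mulr1 add0r.
Qed.

Lemma itg_om : itg om.
Proof.
apply: (@itg_ge0_antiderivative _ 0 (2 * pi) _ (fun t => 2 * atan t)).
- exact: om_meas.
- by move=> x; exact: ltW (om_gt0 x).
- by move=> x _; exact: d_cont (om_derive x).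
- by move=> x _; exact: om_atan.
move=> x; rewrite normrM ger0_norm// ler_pM2l//.
have := atan_gtNpi2 x; have := atan_ltpi2 x; have := pi_gt0 R.
by move: (atan x) pi => u v; rewrite ler_norml; lra.
Qed.

Lemma int_om : \int[mu]_x om x = 2 * pi.
Proof.
rewrite (@ftc_line _ 0 (2 * - (pi / 2)) (2 * (pi / 2)) _ (fun t => 2 * atan t)).
- by field.
- exact: itg_om.
- by move=> x _; exact: d_cont (om_derive x).
- by move=> x _; exact: om_atan.
- exact: d_cont (om_atan 0).
- by apply: cvgMr; exact: cvgNy_atan.
- by apply: cvgMr; exact: cvgy_atan.
Qed.

End Model.

(** * Power majorants *)

Section Powers.
Context {R : realType}.
Notation mu := (@lebesgue_measure R).

(** [md a t] is [|t|^(a-1) / (1 + |t|^a)^2], comparable to [pw a] below; unlike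
[pw a] it has an elementary antiderivative, [t / |t|] times
[1 - (1 + |t|^a)^-1] up to the factor [a^-1]. *)
Let md (a t : R) := expR (- (1/2) * ln (t ^+ 2)) * expR (a / 2 * ln (t ^+ 2)) *
  ((1 + expR (a / 2 * ln (t ^+ 2))) ^+ 2)^-1.
Let mdF (a t : R) := a^-1 * (t * expR (- (1/2) * ln (t ^+ 2)) *
  (1 - (1 + expR (a / 2 * ln (t ^+ 2)))^-1)).

Let sqr_pos (t : R) : t != 0 -> 0 < t ^+ 2.
Proof. by move=> t0; rewrite exprn_even_gt0. Qed.

Let onee_gt0 (x : R) : 0 < 1 + expR x.
Proof. by rewrite ltr_wpDr ?expR_ge0. Qed.

Let onee_neq0 (x : R) : 1 + expR x != 0.
Proof. by rewrite gt_eqF ?onee_gt0. Qed.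

Let md_derive (a t : R) : 0 < a -> t != 0 -> isd (mdF a) t (md a t).
Proof.
move=> a0 t0; rewrite /mdF /md; apply: deq; last first.
  by dsolve; first [exact: sqr_pos | exact: onee_neq0].
cbv beta; move: (onee_neq0 (a / 2 * ln (t ^+ 2))).
move: (expR _) (expR _) => u v v0; field.
by rewrite t0 v0 gt_eqF.
Qed.

Lemma powR_ln (t b : R) : t != 0 -> `|t| `^ b = expR (b / 2 * ln (t ^+ 2)).
Proof.
move=> t0; rewrite /powR normr_eq0 (negbTE t0) -(real_normK (num_real t)).
by rewrite lnXn ?normr_gt0// -mulr_natl; congr expR; field.
Qed.

Let mdF_bound (a t : R) : 0 < a -> `|mdF a t| <= a^-1.
Proof.
move=> a0; rewrite /mdF normrM gtr0_norm ?invr_gt0// ler_piMr ?invr_ge0 ?(ltW a0)//.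
have [->|t0] := eqVneq t 0; first by rewrite !mul0r normr0.
rewrite normrM normrM (gtr0_norm (expR_gt0 _)).
have -> : `|t| * expR (- (1 / 2) * ln (t ^+ 2)) = 1.
  have -> : - (1 / 2) * ln (t ^+ 2) = (-1) / 2 * ln (t ^+ 2) by field.
  rewrite -powR_ln// powR_inv1// divff//.
  by rewrite normr_eq0.
rewrite mul1r; move: (expR_gt0 (a / 2 * ln (t ^+ 2))); move: (expR _) => v v0.
have -> : 1 - (1 + v)^-1 = v / (1 + v) by field; rewrite gt_eqF// ltr_wpDr// ltW.
rewrite ger0_norm; last by rewrite divr_ge0// ltW// addr_gt0.
by rewrite ler_pdivrMr ?addr_gt0// mul1r lerDr.
Qed.

Let md_ge0 (a t : R) : 0 <= md a t.
Proof.
by rewrite /md mulr_ge0 ?mulr_ge0 ?expR_ge0// invr_ge0 exprn_ge0// ltW// onee_gt0.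
Qed.

Let itg_md (a : R) : 0 < a -> itg (md a).
Proof.
move=> a0; apply: (@itg_ge0_antiderivative _ 0 a^-1 _ (mdF a)).
- by rewrite /md; msolve.
- by move=> x; exact: md_ge0.
- move=> x x0; apply: d_cont; rewrite /md.
  by dsolve; first [exact: sqr_pos | exact: (expf_neq0 2 (onee_neq0 _))].
- by move=> x x0; exact: md_derive.
by move=> x; exact: mdF_bound.
Qed.

(** The standard majorant of this file: it absorbs integrable powers both at the
origin and at infinity, see [pw_near] and [pw_far]. *)
Definition pw (a t : R) := Num.min (`|t| `^ (a - 1)) (`|t| `^ (- a - 1)).

Lemma pw_ge0 a t : 0 <= pw a t.
Proof. by rewrite le_min !powR_ge0. Qed.

Lemma pw_meas a : measurable_fun setT (pw a).
Proof. by rewrite /pw; apply: measurable_minr; msolve. Qed.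

Let pw_le_md a t : 0 < a -> t != 0 -> pw a t <= 4 * md a t.
Proof.
move=> a0 t0; rewrite /pw /md.
have -> : - (1 / 2) * ln (t ^+ 2) = (-1) / 2 * ln (t ^+ 2) by field.
have tI b : b ==> (`|t| != 0) by apply/implyP => _; rewrite normr_eq0.
rewrite -!powR_ln// !powRD//.
rewrite powRN; have : 0 < `|t| `^ a by rewrite powR_gt0// normr_gt0.
have : 0 <= `|t| `^ (-1) by exact: powR_ge0.
move: (`|t| `^ (-1)) (`|t| `^ a) => q v q0 v0; rewrite ge_min.
have v10 : 0 < (1 + v) ^+ 2 by rewrite exprn_gt0// addr_gt0.
have [v1|v1] := leP v 1.
  apply/orP; left; rewrite mulrC -[leLHS]mulr1 -mulrA.
  rewrite [leRHS](_ : _ = q * v * (4 / (1 + v) ^+ 2)); last by field; rewrite gt_eqF// addr_gt0.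
  rewrite mulrA ler_wpM2l ?mulr_ge0// ?(ltW v0)//.
  rewrite ler_pdivlMr// mul1r; nra.
apply/orP; right.
rewrite [leRHS](_ : _ = v^-1 * q * (4 * v ^+ 2 / (1 + v) ^+ 2)); last first.
  by field; rewrite !gt_eqF// addr_gt0.
rewrite -[leLHS]mulr1 ler_wpM2l ?mulr_ge0 ?invr_ge0// ?(ltW v0)//.
rewrite ler_pdivlMr// mul1r; nra.
Qed.

Lemma itg_pw a : 0 < a -> itg (pw a).
Proof.
move=> a0; apply: (@itg_dom1 _ 0 _ (fun t => 4 * md a t) (pw_meas a)).
- by apply: itgZ; exact: itg_md.
- by move=> t; rewrite mulr_ge0.
- by move=> t t0; rewrite ger0_norm ?pw_ge0//; exact: pw_le_md.
Qed.

Lemma powR_le_exp (r b c : R) : 0 < r -> r <= 1 -> c <= b -> r `^ b <= r `^ c.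
Proof. by move=> r0 r1; apply: ger_powR; rewrite r0. Qed.

Lemma pw_near (a b t : R) : b < 1 -> a <= b -> 0 < a -> `|t| <= 1 ->
  `|t| `^ (b - 1) <= pw a t.
Proof.
move=> b1 ab a0 t1; have [->|t0] := eqVneq t 0.
  by rewrite normr0 powR0 ?pw_ge0// lt_eqF// subr_lt0.
have tp : 0 < `|t| by rewrite normr_gt0.
by rewrite /pw le_min !powR_le_exp//; move: ab a0; lra.
Qed.

Lemma pw_far (a b t : R) : a <= b -> 0 < a -> 1 <= `|t| ->
  `|t| `^ (- b - 1) <= pw a t.
Proof.
move=> ab a0 t1.
by rewrite /pw le_min !ler_powR//; move: ab a0; lra.
Qed.

End Powers.

(** * Logarithmic majorants *)

(** Proves nonnegativity by following the syntax of a real expression. *)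
Ltac nneg := repeat first [ assumption | done | exact: powR_ge0 | exact: pw_ge0
  | exact: normr_ge0 | exact: sqr_ge0 | exact: expR_ge0 | exact: ltW (om_gt0 _)
  | exact: pi_ge0 | apply: addr_ge0 | apply: mulr_ge0 | rewrite invr_ge0
  | apply: exprn_ge0 ].

Section SmallPowers.
Context {R : realType}.

Lemma powR_small (b c e : R) : 0 < b -> 0 <= c -> 0 < e ->
  exists d, [/\ 0 < d, d <= 1 & forall r, 0 <= r -> r <= d -> c * r `^ b <= e].
Proof.
move=> b0 c0 e0; have c1 : 0 < c + 1 by rewrite ltr_wpDl.
pose r0 := e / (c + 1); have rp : 0 < r0 by rewrite divr_gt0.
exists (Num.min 1 (r0 `^ b^-1)); split.
- by rewrite lt_min ltr01 powR_gt0.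
- by rewrite ge_min lexx.
move=> r rr; rewrite le_min => /andP[_ rd].
have h : r `^ b <= r0.
  rewrite -[leRHS](_ : (r0 `^ b^-1) `^ b = r0).
    by apply: ge0_ler_powR; rewrite ?nnegrE ?powR_ge0 ?(ltW b0).
  by rewrite -powRrM mulVf ?gt_eqF// powRr1// ltW.
apply: le_trans (ler_wpM2l c0 h) _.
by rewrite mulrCA ler_piMr ?(ltW e0)// ler_pdivrMr// mul1r lerDl.
Qed.

Lemma le0_powR_lim (X c b : R) : 0 <= c -> 0 < b ->
  (forall s, 0 < s -> s <= 1 -> X <= c * s `^ b) -> X <= 0.
Proof.
move=> c0 b0 H; apply/ler_addgt0Pr => e e0; rewrite add0r.
have [d [d0 d1 dP]] := powR_small b0 c0 e0.
exact: le_trans (H d d0 d1) (dP d (ltW d0) (lexx _)).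
Qed.

End SmallPowers.

Section LogBounds.
Context {R : realType}.
Notation mu := (@lebesgue_measure R).
Implicit Types (t v w x y z : R).

Lemma lnN_le_powR t : 0 < t -> - ln t <= 2 * t `^ (- 2^-1).
Proof.
move=> t0; have -> : - ln t = 2 * ln (t `^ (- 2^-1)) by rewrite ln_powR; field.
by rewrite ler_pM2l// ltW// ln_sublinear// powR_gt0.
Qed.

Lemma ln1_sqr_le w : 0 <= w -> ln (1 + w ^+ 2) <= 2 * w.
Proof.
move=> w0; rewrite (@le_trans _ _ (ln ((1 + w) ^+ 2)))//.
  rewrite ler_ln ?posrE ?exprn_gt0 ?sq1_gt0//; last by rewrite ltr_wpDr.
  by nra.
rewrite lnXn; last by rewrite ltr_wpDr.
by rewrite -[_ *+ 2]mulr_natl ler_pM2l// le_ln1Dx// (lt_le_trans _ w0).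
Qed.

Lemma ln1_le_powR w : 0 <= w -> ln (1 + w) <= 2 * w `^ 2^-1.
Proof.
move=> w0; rewrite (_ : 1 + w = 1 + (w `^ 2^-1) ^+ 2).
  by apply: ln1_sqr_le; exact: powR_ge0.
by rewrite -powR_mulrn ?powR_ge0// -powRrM mulVf// powRr1.
Qed.

Lemma powR_half_sqr w : 0 <= w -> w `^ 2^-1 * w `^ 2^-1 = w.
Proof.
by move=> w0; rewrite -expr2 -powR_mulrn ?powR_ge0// -powRrM mulVf// powRr1.
Qed.

Lemma le_geom_mean v w x : 0 <= x -> x <= v -> x <= w ->
  x <= v `^ 2^-1 * w `^ 2^-1.
Proof.
move=> x0 xv xw; rewrite -[leLHS](powR_half_sqr x0).
by apply: ler_pM; rewrite ?powR_ge0// ge0_ler_powR// ?nnegrE// (le_trans x0).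
Qed.

Lemma powR_om_le y : `|y| `^ 2^-1 * om y <= om y + 2 * pw 2^-1 y.
Proof.
have o0 := om_gt0 y; have p0 := pw_ge0 2^-1 y.
have [y1|/ltW y1] := leP `|y| 1.
  rewrite (@le_trans _ _ (1 * om y))//.
    rewrite ler_pM2r// (@le_trans _ _ (1 `^ 2^-1))//; last by rewrite powR1.
    by rewrite ge0_ler_powR ?nnegrE// invr_ge0.
  by rewrite mul1r lerDl mulr_ge0.
rewrite (@le_trans _ _ (2 * pw 2^-1 y))//; last by rewrite lerDr ltW.
have y0 : 0 < `|y| by rewrite (lt_le_trans ltr01).
have := @pw_far _ 2^-1 2^-1 y (lexx _) _ y1; rewrite invr_gt0 => /(_ (ltr0Sn _ _)) H.
rewrite (le_trans _ (ler_wpM2l _ H))//.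
have -> : `|y| `^ (- 2^-1 - 1) = `|y| `^ 2^-1 / `|y| ^+ 2.
  have -> : - 2^-1 - 1 = 2^-1 - 2%:R :> R by field.
  rewrite powRB; last by apply/implyP => _; rewrite gt_eqF.
  by rewrite powR_mulrn.
rewrite /om -(real_normK (num_real y)) mulrCA ler_pM2l//.
by rewrite ler_wpM2l ?powR_ge0// lef_pV2 ?posrE ?exprn_gt0// ?lerDr// ltr_wpDr// exprn_ge0.
Qed.

Lemma itg_powR_om : itg (fun y : R => `|y| `^ 2^-1 * om y).
Proof.
apply: (itg_dom (g := fun y => om y + 2 * pw 2^-1 y)).
- by have := @om_meas R; move=> ?; msolve.
- by apply: itgD; [exact: itg_om|apply: itgZ; apply: itg_pw; rewrite invr_gt0].
move=> y; rewrite ger0_norm ?powR_om_le//.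
by rewrite mulr_ge0 ?powR_ge0// ltW ?om_gt0.
Qed.

(** Near the diagonal the logarithm is below a power of [|x - y|]; away from it,
[|x - y|] is at most [(1 + |x|) (1 + |y|)], which separates the variables. *)
Definition logmaj (x y : R) := 4 * pw 2^-1 (x - y) +
  (2 * `|x| `^ 2^-1 * om y + 2 * (`|y| `^ 2^-1 * om y)).

Lemma log_om_le x y : `|ln `|x - y| | * om y <= logmaj x y.
Proof.
rewrite /logmaj; have o0 := om_gt0 y; have o1 := ltW o0; have p0 := pw_ge0 2^-1 (x - y).
have q0 : 0 <= `|x| `^ 2^-1 by exact: powR_ge0.
have r0 : 0 <= `|y| `^ 2^-1 by exact: powR_ge0.
have [->|xy] := eqVneq (x - y) 0.
  by rewrite normr0 ln0// normr0 mul0r; nneg.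
have n0 : 0 < `|x - y| by rewrite normr_gt0.
have [y1|y1] := leP `|x - y| 1.
  rewrite ler_wpDr//; first by nneg.
  rewrite ler0_norm; last by rewrite ln_le0.
  rewrite (@le_trans _ _ (2 * pw 2^-1 (x - y) * 2))//; last by nra.
  apply: ler_pM; [by rewrite oppr_ge0 ln_le0|exact: o1| |exact: om_le2].
  rewrite (le_trans (lnN_le_powR n0))// ler_pM2l//.
  have -> : - 2^-1 = 2^-1 - 1 :> R by field.
  by apply: pw_near => //; lra.
rewrite ler_wpDl ?mulr_ge0//.
rewrite (@le_trans _ _ ((2 * `|x| `^ 2^-1 + 2 * `|y| `^ 2^-1) * om y))//; last first.
  by rewrite mulrDl !mulrA.
rewrite ler_pM2r// ger0_norm; last by rewrite ln_ge0// ltW.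
rewrite (@le_trans _ _ (ln ((1 + `|x|) * (1 + `|y|))))//.
  rewrite ler_ln ?posrE ?mulr_gt0 ?ltr_wpDr//.
  rewrite (le_trans (ler_normB _ _))//.
  by have := normr_ge0 x; have := normr_ge0 y; nra.
rewrite lnM ?posrE ?ltr_wpDr// lerD// ln1_le_powR//.
Qed.

Lemma itg_pw_refl a x : 0 < a -> itg (fun y => pw a (x - y)).
Proof. by move=> a0; exact: (itg_refl x (itg_pw a0)). Qed.

Lemma int_pw_refl a x : 0 < a ->
  \int[mu]_y pw a (x - y) = \int[mu]_y pw a y.
Proof. by move=> a0; rewrite -(int_refl x (itg_pw a0)). Qed.

Lemma inv2_gt0 : 0 < 2^-1 :> R. Proof. by rewrite invr_gt0. Qed.

Lemma itg_logmaj x : itg (logmaj x).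
Proof.
apply: itgD; first by apply: itgZ; apply: itg_pw_refl; exact: inv2_gt0.
apply: itgD; first by apply: itgZ; exact: itg_om.
by apply: itgZ; exact: itg_powR_om.
Qed.

Lemma int_logmaj : exists c1 c2 : R, [/\ 0 <= c1, 0 <= c2 &
  forall x, \int[mu]_y logmaj x y = c1 + c2 * `|x| `^ 2^-1].
Proof.
exists (4 * (\int[mu]_y pw 2^-1 y) + 2 * (\int[mu]_y (`|y| `^ 2^-1 * om y))), (2 * (2 * pi)).
split.
- by apply: addr_ge0; apply: mulr_ge0 => //; apply: int_ge0 => y; nneg.
- by nneg.
move=> x; rewrite /logmaj intD; last 2 first.
- by apply: itgZ; apply: itg_pw_refl; exact: inv2_gt0.
- apply: itgD; first by apply: itgZ; exact: itg_om.
  by apply: itgZ; exact: itg_powR_om.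
rewrite intZ; last by apply: itg_pw_refl; exact: inv2_gt0.
rewrite int_pw_refl ?inv2_gt0// intD; last 2 first.
- by apply: itgZ; exact: itg_om.
- by apply: itgZ; exact: itg_powR_om.
rewrite intZ ?itg_om// intZ ?itg_powR_om// int_om; ring.
Qed.

(** The factor on the right has an integrable singularity, so that logarithmic
potentials inherit the exponent 1/2. *)
Lemma ln_holder v w : 0 < v -> 0 < w ->
  `|ln v - ln w| <= 2 * `|v - w| `^ 2^-1 * (v `^ (- 2^-1) + w `^ (- 2^-1)).
Proof.
wlog vw : v w / v <= w => [H v0 w0|v0 w0].
  case: (leP v w) => [vw|/ltW wv]; first exact: H.
  by rewrite distrC (distrC v) (addrC (v `^ _)); exact: H.
rewrite distrC ger0_norm; last by rewrite subr_ge0 ler_ln.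
rewrite -ln_div//; have -> : w / v = 1 + (w - v) / v by field; rewrite gt_eqF.
rewrite distrC (@ger0_norm _ (w - v)) ?subr_ge0//.
have q0 : 0 <= (w - v) / v by rewrite divr_ge0 ?subr_ge0// ltW.
rewrite (le_trans (ln1_le_powR q0))// powRM ?subr_ge0 ?invr_ge0 ?(ltW v0)//.
rewrite mulrA ler_wpM2l ?mulr_ge0 ?powR_ge0//.
rewrite -powR_inv1 ?(ltW v0)// -powRrM mulN1r lerDl powR_ge0//.
Qed.

End LogBounds.

(** * Logarithmic potentials *)

Section MoreTools.
Context {R : realType}.
Notation mu := (@lebesgue_measure R).

Lemma isd_int (f df : R -> R -> R) (G : R -> R) (a e : R) : 0 < e ->
  (forall x, `|x - a| < e -> itg (f x)) ->
  (forall x y, `|x - a| < e -> isd (f ^~ y) x (df x y)) ->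
  (forall x y, `|x - a| < e -> `|df x y| <= G y) -> itg G ->
  isd (fun x => \int[mu]_y f x y) a (\int[mu]_y df a y).
Proof.
move=> e0 If dfE dfG IG.
have I x : x \in `]a - e, a + e[ -> `|x - a| < e.
  by rewrite in_itv/= ltr_distl.
have Ia : `]a - e, a + e[%classic a.
  by rewrite /= in_itv/= ltrBlDr ltrDl e0.
have E x y : `|x - a| < e -> partial1of2 f x y = df x y.
  by move=> xa; rewrite /partial1of2 derive1E; case: (dfE x y xa).
have H1 : forall x, `]a - e, a + e[%classic x -> mu.-integrable setT (EFin \o f x).
  by move=> x xe; apply: If; apply: I.
have H2 : forall x y, `]a - e, a + e[%classic x -> setT y -> derivable (f ^~ y) x 1.
  by move=> x y xe _; case: (dfE x y (I _ xe)).
have G0 y : 0 <= G y.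
  by apply: le_trans (dfG a y _); rewrite ?subrr ?normr0.
have H3 : forall x y, `]a - e, a + e[%classic x -> setT y ->
    `|partial1of2 f x y| <= G y.
  by move=> x y xe _; rewrite E ?dfG//; exact: I.
split.
  by have := @derivable_under_integral R _ _ mu f setT measurableT a _ _ Ia H1 H2 G G0 IG H3.
rewrite -derive1E (@differentiation_under_integral R _ _ mu f setT measurableT a _ _ Ia H1 H2 G G0 IG H3).
by apply: eq_int => y; rewrite E// subrr normr0.
Qed.

(** The point [c] is located by distances, so that the order of [a] and [b] does
not matter. *)
Lemma mvt (f df : R -> R) (a b : R) : (forall x, isd f x (df x)) ->
  exists2 c, `|c - a| <= `|b - a| & f b - f a = df c * (b - a).
Proof.
move=> fdf; have cf : continuous f by move=> x; exact: d_cont (fdf x).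
have [ab|ba|->] := ltgtP a b; last first.
- by exists b; rewrite ?subrr ?mulr0.
- have [||c cI E] := @MVT _ f df b a ba.
  + by move=> x _; exact: fdf.
  + exact: continuous_subspaceT.
  exists c; last by rewrite -[LHS]opprB E -mulrN opprB.
  move: cI; rewrite in_itv/= => /andP[bc ca].
  by rewrite !ltr0_norm ?subr_lt0// lerN2 lerD2r ltW.
- have [||c cI E] := @MVT _ f df a b ab.
  + by move=> x _; exact: fdf.
  + exact: continuous_subspaceT.
  exists c => //; move: cI; rewrite in_itv/= => /andP[ac cb].
  by rewrite !gtr0_norm ?subr_gt0// lerD2r ltW.
Qed.

(** Majorises [|x - y|^(-1/2) om y] by a function whose integral does not depend
on [x]; this makes the estimates on potentials uniform. *)
Definition sing (x y : R) := 2 * pw 2^-1 (x - y) + om y.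

Lemma sing_le x y : `|x - y| `^ (- 2^-1) * om y <= sing x y.
Proof.
rewrite /sing; have [t1|/ltW t1] := leP `|x - y| 1.
  rewrite ler_wpDr ?(ltW (om_gt0 _))// (mulrC 2).
  apply: ler_pM; [exact: powR_ge0|exact: ltW (om_gt0 _)| |exact: om_le2].
  have -> : - 2^-1 = 2^-1 - 1 :> R by field.
  by apply: pw_near => //; lra.
apply: ler_wpDl; first by nneg.
rewrite ler_piMl ?(ltW (om_gt0 _))// powRN invf_le1.
  by have := ler_powR t1 (ltW (@inv2_gt0 R)); rewrite powRr0.
by rewrite powR_gt0// (lt_le_trans ltr01).
Qed.

Lemma itg_sing x : itg (sing x).
Proof.
by apply: itgD; [apply: itgZ; apply: itg_pw_refl; exact: inv2_gt0|exact: itg_om].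
Qed.

Definition sing_int : R := 2 * (\int[mu]_y pw 2^-1 y) + 2 * pi.

Lemma int_sing x : \int[mu]_y sing x y = sing_int.
Proof.
rewrite /sing intD; last 2 first.
- by apply: itgZ; apply: itg_pw_refl; exact: inv2_gt0.
- exact: itg_om.
rewrite intZ; last by apply: itg_pw_refl; exact: inv2_gt0.
by rewrite int_pw_refl ?inv2_gt0// int_om.
Qed.

Lemma sing_int_ge0 : 0 <= sing_int.
Proof. by rewrite -(int_sing 0); apply: int_ge0 => y; rewrite /sing; nneg. Qed.

End MoreTools.

Section Potential.
Context {R : realType}.
Notation mu := (@lebesgue_measure R).
Context (F : R -> R) (C H : R).
Context (C0 : 0 <= C) (H0 : 0 <= H).
Context (mF : measurable_fun setT F) (FC : forall y, `|F y| <= C * om y).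
Context (FH : forall y z, `|F y - F z| <= H * `|y - z| `^ 2^-1).

Definition logpot (x : R) := \int[mu]_y (ln `|x - y| * F y).

Let itgF : itg F.
Proof. by apply: (itg_dom mF _ FC); apply: itgZ; exact: itg_om. Qed.

Lemma itg_logpot x : itg (fun y => ln `|x - y| * F y).
Proof.
apply: (itg_dom (g := fun y => C * logmaj x y)).
- by msolve.
- by apply: itgZ; exact: itg_logmaj.
move=> y; rewrite normrM (le_trans (ler_wpM2l (normr_ge0 _) (FC y)))//.
by rewrite mulrCA ler_wpM2l// log_om_le.
Qed.

Lemma logpot_holder : exists2 K, 0 <= K &
  forall x x', `|logpot x - logpot x'| <= K * `|x - x'| `^ 2^-1.
Proof.
have S0 := @sing_int_ge0 R.
exists (2 * C * (@sing_int R + @sing_int R)); first by nneg.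
move=> x x'; rewrite /logpot -intB; [|exact: itg_logpot|exact: itg_logpot].
rewrite (_ : _ * `|x - x'| `^ 2^-1 =
  \int[mu]_y (2 * C * `|x - x'| `^ 2^-1 * (sing x y + sing x' y))); last first.
  rewrite intZ; last by apply: itgD; exact: itg_sing.
  by rewrite intD ?int_sing; [ring|exact: itg_sing|exact: itg_sing].
apply: (int_dom2 (p := x) (q := x')).
- by msolve.
- by apply: itgZ; apply: itgD; exact: itg_sing.
- by move=> y; rewrite /sing; nneg.
move=> y yx yx'; rewrite -mulrBl normrM.
have n1 : 0 < `|x - y| by rewrite normr_gt0 subr_eq0 eq_sym.
have n2 : 0 < `|x' - y| by rewrite normr_gt0 subr_eq0 eq_sym.
have L := ln_holder n1 n2.
have T : `| `|x - y| - `|x' - y| | `^ 2^-1 <= `|x - x'| `^ 2^-1.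
  apply: ge0_ler_powR; rewrite ?nnegrE// ?invr_ge0//.
  by rewrite (le_trans (ler_dist_dist _ _))// opprB addrA subrK.
rewrite (le_trans (ler_pM _ _ L (FC y)))//.
set A := `|x - y| `^ (- 2^-1); set B := `|x' - y| `^ (- 2^-1).
have A0 : 0 <= A by nneg. have B0 : 0 <= B by nneg.
rewrite (@le_trans _ _ (2 * `|x - x'| `^ 2^-1 * (A + B) * (C * om y)))//.
  rewrite ler_wpM2r//; first by nneg.
  by rewrite ler_wpM2r//; [nneg|rewrite ler_pM2l].
have -> : 2 * `|x - x'| `^ 2^-1 * (A + B) * (C * om y) =
  2 * C * `|x - x'| `^ 2^-1 * (A * om y + B * om y) by ring.
rewrite ler_wpM2l//; first by nneg.
by rewrite lerD//; exact: sing_le.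
Qed.

End Potential.

(** * Regularity of logarithmic potentials *)

Section Regularity.
Context {R : realType}.
Notation mu := (@lebesgue_measure R).

Lemma ln1_quarter (w : R) : 0 <= w -> ln (1 + w ^+ 2) <= 4 * w `^ 2^-1 :> R.
Proof.
move=> w0; rewrite (@le_trans _ _ (2 * ln (1 + w)))//.
  have w1 : 0 < 1 + w by rewrite ltr_wpDr.
  have -> : 2 * ln (1 + w) = ln ((1 + w) ^+ 2).
    by rewrite lnXn// mulr_natl.
  by rewrite ler_ln ?posrE ?exprn_gt0 ?sq1_gt0//; nra.
by have := ln1_le_powR w0; lra.
Qed.

Lemma cutoff_le_powR (s t b : R) : 0 < s -> 0 <= b -> b <= 1 -> t != 0 ->
  s ^+ 2 / (t ^+ 2 + s ^+ 2) <= s `^ b * `|t| `^ (- b).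
Proof.
move=> s0 b0 b1 t0; have n0 : 0 < `|t| by rewrite normr_gt0.
have p0 : 0 < t ^+ 2 + s ^+ 2 by rewrite ltr_wpDl ?sqr_ge0// exprn_gt0.
have -> : `|t| `^ (- b) = `|t|^-1 `^ b by rewrite -powR_inv1// -powRrM mulN1r.
rewrite -powRM ?invr_ge0 ?(ltW s0)//.
have [st|ts] := leP s `|t|.
  have q0 : 0 < s / `|t| by rewrite divr_gt0.
  have q1 : s / `|t| <= 1 by rewrite ler_pdivrMr// mul1r.
  rewrite (@le_trans _ _ (s / `|t|))//; last first.
    by apply: ger1_powR => //; rewrite q0.
  rewrite ler_pdivrMr// -(real_normK (num_real t)) mulrAC ler_pdivlMr//.
  have d0 : 0 <= `|t| - s by rewrite subr_ge0.
  have := mulr_ge0 (ltW s0) (mulr_ge0 (ltW n0) d0).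
  have := exprn_ge0 3 (ltW s0); move: (`|t|) => u; nra.
rewrite (@le_trans _ _ 1)//.
  by rewrite ler_pdivrMr// mul1r lerDr sqr_ge0.
have q1 : 1 <= s / `|t| by rewrite ler_pdivlMr// mul1r ltW.
by have := ler_powR q1 b0; rewrite powRr0.
Qed.

Context (F : R -> R) (C H : R).
Context (C0 : 0 <= C) (H0 : 0 <= H).
Context (mF : measurable_fun setT F) (FC : forall y, `|F y| <= C * om y).
Context (FH : forall y z, `|F y - F z| <= H * `|y - z| `^ 2^-1).

Let itgF : itg F.
Proof. by apply: (itg_dom mF _ FC); apply: itgZ; exact: itg_om. Qed.

Let IL := itg_logpot C0 mF FC.

(** The regularised kernel [ln sqrt ((x - y)^2 + s^2)] has a bounded derivative,
and is the Poisson extension of the logarithm to height [s]. *)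
Definition rlogpot (s x : R) :=
  \int[mu]_y (2^-1 * ln ((x - y) ^+ 2 + s ^+ 2) * F y).

Let kdiff (s x y : R) :=
  2^-1 * ln ((x - y) ^+ 2 + s ^+ 2) * F y - ln `|x - y| * F y.

Let kdiff_le (s x y : R) : 0 < s -> y != x ->
  `|kdiff s x y| <= 2 * C * s `^ 2^-1 * sing x y.
Proof.
move=> s0 yx; rewrite /kdiff -mulrBl normrM.
have n1 : 0 < `|x - y| by rewrite normr_gt0 subr_eq0 eq_sym.
have p1 : 0 < (x - y) ^+ 2 by rewrite exprn_even_gt0//= -normr_gt0.
have -> : ln `|x - y| = 2^-1 * ln ((x - y) ^+ 2).
  by rewrite -[in RHS](real_normK (num_real _)) lnXn// -[_ *+ 2]mulr_natl; field.
have p2 : 0 < (x - y) ^+ 2 + s ^+ 2 by apply: (addr_gt0 p1); rewrite exprn_gt0.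
rewrite -mulrBr -ln_div ?posrE//.
have -> : ((x - y) ^+ 2 + s ^+ 2) / (x - y) ^+ 2 = 1 + (s / `|x - y|) ^+ 2.
  by rewrite expr_div_n (real_normK (num_real _)); field; rewrite -normr_gt0.
have q0 : 0 <= s / `|x - y| by rewrite divr_ge0// ltW.
have l0 : 0 <= ln (1 + (s / `|x - y|) ^+ 2) by rewrite ln_ge0// lerDl sqr_ge0.
rewrite normrM (ger0_norm l0) ger0_norm; last by nneg.
rewrite (@le_trans _ _ (2^-1 * (4 * (s / `|x - y|) `^ 2^-1) * (C * om y)))//.
  apply: ler_pM => //; first by nneg.
  by rewrite ler_pM2l ?invr_gt0// ln1_quarter.
rewrite powRM ?invr_ge0 ?(ltW s0)// -(powR_inv1 (ltW n1)) -powRrM mulN1r.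
rewrite [leLHS](_ : _ = 2 * C * s `^ 2^-1 * (`|x - y| `^ (- 2^-1) * om y)); last by field.
by apply: ler_wpM2l; [nneg|exact: sing_le].
Qed.

Let kdiff_meas (s x : R) : measurable_fun setT (kdiff s x).
Proof. by rewrite /kdiff; msolve. Qed.

Let itg_kdiff (s x : R) : 0 < s -> itg (kdiff s x).
Proof.
move=> s0; apply: (itg_dom1 (p := x) (kdiff_meas s x)
  (itgZ (2 * C * s `^ 2^-1) (itg_sing x))).
- by move=> y; rewrite /sing; nneg.
- by move=> y yx; exact: kdiff_le.
Qed.

Lemma itg_rlogpot (s x : R) : 0 < s ->
  itg (fun y => 2^-1 * ln ((x - y) ^+ 2 + s ^+ 2) * F y).
Proof.
move=> s0; apply: (eq_itg _ (itgD (itg_kdiff x s0) (IL x))) => y.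
by rewrite /kdiff subrK.
Qed.

Lemma rlogpot_cvg (s x : R) : 0 < s ->
  `|rlogpot s x - logpot F x| <= 2 * C * s `^ 2^-1 * @sing_int R.
Proof.
move=> s0; rewrite /rlogpot /logpot -intB; [|exact: itg_rlogpot|exact: IL].
rewrite -(int_sing x) -intZ; last exact: itg_sing.
apply: (int_dom2 (p := x) (q := x)).
- exact: kdiff_meas.
- by apply: itgZ; exact: itg_sing.
- by move=> y; rewrite /sing; nneg.
by move=> y yx _; exact: kdiff_le.
Qed.

Definition odiff (x t : R) := F (x - t) - F (x + t).

Let odiff_meas (x : R) : measurable_fun setT (odiff x).
Proof. by rewrite /odiff; msolve. Qed.

Let odiff_near (x t : R) : `|odiff x t| <= 2 * H * `|t| `^ 2^-1.
Proof.
rewrite /odiff (le_trans (FH _ _))// (mulrC 2) -mulrA ler_wpM2l//.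
have -> : x - t - (x + t) = - (2 * t) by ring.
rewrite normrN normrM powRM// ger0_norm// ler_wpM2r ?powR_ge0//.
by apply: ler1_powR; rewrite ?ler1n//; lra.
Qed.

Let odiff_far (x t : R) : `|odiff x t| <= C * (om (x - t) + om (x + t)).
Proof. by rewrite /odiff (le_trans (ler_normB _ _))// mulrDr lerD. Qed.

Let dmaj (x t : R) := 2 * H * pw 4^-1 t + C * (om (x - t) + om (x + t)).

Let itg_om2 (x : R) : itg (fun t => om (x - t) + om (x + t)).
Proof. by apply: itgD; [apply: itg_refl|apply: itg_shift]; exact: itg_om. Qed.

Let int_om2 (x : R) : \int[mu]_t (om (x - t) + om (x + t)) = 4 * pi.
Proof.
rewrite intD; [|by apply: itg_refl; exact: itg_om|by apply: itg_shift; exact: itg_om].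
rewrite -(int_refl x (@itg_om R)) -(int_shift x (@itg_om R)) int_om; ring.
Qed.

Let inv4_gt0 : 0 < 4^-1 :> R. Proof. by rewrite invr_gt0. Qed.

Let itg_dmaj (x : R) : itg (dmaj x).
Proof. by apply: itgD; apply: itgZ; [apply: itg_pw|exact: itg_om2]. Qed.

Let dint := 2 * H * (\int[mu]_t pw 4^-1 t) + C * (4 * pi).

Let int_dmaj (x : R) : \int[mu]_t dmaj x t = dint.
Proof.
rewrite /dmaj intD; [|by apply: itgZ; apply: itg_pw|by apply: itgZ; exact: itg_om2].
by rewrite (intZ _ (itg_pw inv4_gt0)) (intZ _ (itg_om2 x)) int_om2.
Qed.

Let odiff_maj (e x t : R) : 0 <= e -> e <= 5 / 4 ->
  `|t| `^ (- e) * `|odiff x t| <= dmaj x t.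
Proof.
move=> e0 e1; rewrite /dmaj.
have [->|t0] := eqVneq t 0.
  by rewrite /odiff subr0 addr0 subrr normr0 mulr0; nneg.
have n0 : 0 < `|t| by rewrite normr_gt0.
have [t1|/ltW t1] := leP `|t| 1.
  apply: ler_wpDr; first by nneg.
  rewrite (le_trans (ler_wpM2l (powR_ge0 _ _) (odiff_near x t)))//.
  rewrite mulrCA ler_wpM2l//; first by nneg.
  rewrite -powRD; last by apply/implyP => _; rewrite gt_eqF.
  apply: le_trans (pw_near (b := 4^-1) _ (lexx _) inv4_gt0 t1); last by lra.
  by apply: powR_le_exp => //; lra.
apply: ler_wpDl; first by nneg.
apply: le_trans (odiff_far x t); rewrite ler_piMl// powRN invf_le1 ?powR_gt0//.
by have := ler_powR t1 e0; rewrite powRr0.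
Qed.

(** The derivative of the potential is a principal value, written as the
absolutely convergent integral of the odd difference. *)
Definition dlogpot (x : R) := 2^-1 * \int[mu]_t (t^-1 * odiff x t).

Let itg_dlogpot (x : R) : itg (fun t => t^-1 * odiff x t).
Proof.
apply: (itg_dom (g := dmaj x)); [by have := odiff_meas x => ?; msolve|exact: itg_dmaj|].
move=> t; rewrite normrM normfV -powR_inv1//; apply: odiff_maj => //; lra.
Qed.

Let rk (s t : R) := t / (t ^+ 2 + s ^+ 2).

Let rk_den (s t : R) : 0 < s -> 0 < t ^+ 2 + s ^+ 2.
Proof. by move=> s0; rewrite ltr_wpDl ?sqr_ge0// exprn_gt0. Qed.

Let rk_le (s t : R) : 0 < s -> `|rk s t| <= s^-1.
Proof.
move=> s0; have p := rk_den t s0.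
rewrite /rk normrM normfV (gtr0_norm p) ler_pdivrMr// mulrC ler_pdivlMr//.
by rewrite -(real_normK (num_real t)); nra.
Qed.

Let rlogpot_derive (s x : R) : 0 < s ->
  isd (rlogpot s) x (\int[mu]_y (rk s (x - y) * F y)).
Proof.
move=> s0; apply: (@isd_int _ _ (fun x y => rk s (x - y) * F y)
  (fun y => s^-1 * (C * om y)) x 1) => //.
- by move=> z _; exact: itg_rlogpot.
- move=> z y _; apply: deq; last by dsolve; exact: rk_den.
  by cbv beta; rewrite /rk; field; rewrite gt_eqF// rk_den.
- move=> z y _; rewrite normrM; apply: ler_pM => //; exact: rk_le.
- by apply: itgZ; apply: itgZ; exact: itg_om.
Qed.

Let rk_odd (s x : R) : 0 < s -> \int[mu]_y (rk s (x - y) * F y) =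
  2^-1 * \int[mu]_t (rk s t * odiff x t).
Proof.
move=> s0.
have I1 : itg (fun y => rk s (x - y) * F y).
  apply: (itg_dom (g := fun y => s^-1 * (C * om y))).
  - by rewrite /rk; msolve.
  - by apply: itgZ; apply: itgZ; exact: itg_om.
  - by move=> y; rewrite normrM; apply: ler_pM => //; exact: rk_le.
have I2 : itg (fun t => rk s t * F (x - t)).
  apply: eq_itg (itg_refl x I1) => t; by rewrite subKr.
have I3 : itg (fun t => rk s t * F (x + t)).
  apply: eq_itg (itgN (itg_shift x I1)) => t.
  rewrite opprD addrA subrr add0r /rk sqrrN; ring.
have E2 : \int[mu]_y (rk s (x - y) * F y) = \int[mu]_t (rk s t * F (x - t)).
  by rewrite (int_refl x I1); apply: eq_int => t; rewrite subKr.
have E3 : \int[mu]_y (rk s (x - y) * F y) = - \int[mu]_t (rk s t * F (x + t)).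
  rewrite (int_shift x I1) -intN//; apply: eq_int => t.
  rewrite opprD addrA subrr add0r /rk sqrrN; ring.
rewrite /odiff; under [in RHS]eq_Rintegral do rewrite mulrBr.
by rewrite intB// -E2 -[X in _ - X]opprK -E3; field.
Qed.

Let rlogpot_derive_cvg (s x : R) : 0 < s ->
  `|\int[mu]_y (rk s (x - y) * F y) - dlogpot x| <= 2^-1 * (s `^ 4^-1 * dint).
Proof.
move=> s0; rewrite rk_odd// /dlogpot -mulrBr normrM ger0_norm//.
rewrite ler_wpM2l//.
have Ir : itg (fun t => rk s t * odiff x t).
  apply: (itg_dom (g := fun t => s^-1 * (C * (om (x - t) + om (x + t))))).
  - by rewrite /rk; have := odiff_meas x => ?; msolve.
  - by apply: itgZ; apply: itgZ; exact: itg_om2.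
  - by move=> t; rewrite normrM; apply: ler_pM => //; exact: rk_le.
rewrite -intB// -(int_dmaj x) -intZ ?itg_dmaj//.
apply: int_dom.
- by rewrite /rk; have := odiff_meas x => ?; msolve.
- by apply: itgZ; exact: itg_dmaj.
move=> t; rewrite -mulrBl normrM.
have [->|t0] := eqVneq t 0.
  rewrite /odiff subr0 addr0 subrr normr0 mulr0 /dmaj; nneg.
have -> : rk s t - t^-1 = - (t^-1 * (s ^+ 2 / (t ^+ 2 + s ^+ 2))).
  by rewrite /rk; field; rewrite t0 gt_eqF// rk_den.
have p := rk_den t s0.
rewrite normrN normrM normfV (@ger0_norm _ (_ / _)); last by rewrite divr_ge0 ?sqr_ge0// ltW.
have cl : s ^+ 2 / (t ^+ 2 + s ^+ 2) <= s `^ 4^-1 * `|t| `^ (- 4^-1).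
  by apply: cutoff_le_powR => //; lra.
rewrite (@le_trans _ _ (`|t|^-1 * (s `^ 4^-1 * `|t| `^ (- 4^-1)) * `|odiff x t|))//.
  by rewrite ler_wpM2r// ler_wpM2l// invr_ge0.
rewrite [leLHS](_ : _ = s `^ 4^-1 * (`|t| `^ (- (5/4)) * `|odiff x t|)); last first.
  rewrite (_ : - (5 / 4) = -1 + - 4^-1); last by field.
  rewrite powRD ?powR_inv1//; last by apply/implyP => _; rewrite normr_eq0.
  by ring.
by rewrite ler_wpM2l ?powR_ge0//; apply: odiff_maj; lra.
Qed.

(* The geometric mean of the two bounds [odiff_near] and [FH] keeps half of the
decay in [t] and half of the Hoelder exponent in [x - x']. *)
Let hmaj (x x' t : R) := ((4 * H) `^ 2^-1 + 1) * pw 4^-1 t +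
  C * ((om (x - t) + om (x + t)) + (om (x' - t) + om (x' + t))).

Let hint := ((4 * H) `^ 2^-1 + 1) * (\int[mu]_t pw 4^-1 t) + C * (8 * pi).

Let itg_hmaj x x' : itg (hmaj x x').
Proof.
apply: itgD; first by apply: itgZ; apply: itg_pw.
by apply: itgZ; apply: itgD; exact: itg_om2.
Qed.

Let int_hmaj x x' : \int[mu]_t hmaj x x' t = hint.
Proof.
have I1 := itg_pw inv4_gt0; have I2 := itgD (itg_om2 x) (itg_om2 x').
rewrite /hmaj intD ?intZ//; [|exact: itgZ|exact: itgZ].
rewrite (intD (itg_om2 x) (itg_om2 x')) !int_om2 /hint; ring.
Qed.

Let odiff2_maj (x x' t : R) :
  `|t|^-1 * (`|odiff x t| + `|odiff x' t|) `^ 2^-1 <= hmaj x x' t.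
Proof.
have A0 : 0 <= `|odiff x t| + `|odiff x' t| by nneg.
rewrite /hmaj; have [->|t0] := eqVneq t 0.
  by rewrite normr0 invr0 mul0r; nneg.
have n0 : 0 < `|t| by rewrite normr_gt0.
rewrite -(powR_inv1 (normr_ge0 t)).
have [t1|/ltW t1] := leP `|t| 1.
  apply: ler_wpDr; first by nneg.
  have An : `|odiff x t| + `|odiff x' t| <= 4 * H * `|t| `^ 2^-1.
    by have := odiff_near x t; have := odiff_near x' t; lra.
  have Ah : (`|odiff x t| + `|odiff x' t|) `^ 2^-1 <= (4 * H) `^ 2^-1 * `|t| `^ 4^-1.
    rewrite (@le_trans _ _ ((4 * H * `|t| `^ 2^-1) `^ 2^-1))//.
      by apply: ge0_ler_powR; rewrite ?nnegrE ?invr_ge0//; nneg.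
    rewrite powRM; [|by nneg|by nneg].
    by rewrite -powRrM (_ : 2^-1 * 2^-1 = 4^-1 :> R)//; field.
  rewrite (le_trans (ler_wpM2l (powR_ge0 _ _) Ah))// mulrCA -powRD; last first.
    by apply/implyP => _; rewrite gt_eqF.
  apply: ler_pM; rewrite ?powR_ge0//; first by rewrite lerDl.
  have -> : -1 + 4^-1 = 4^-1 - 1 :> R by rewrite addrC.
  by apply: pw_near => //; lra.
set A := _ + _ in A0 *.
have AC : A <= C * ((om (x - t) + om (x + t)) + (om (x' - t) + om (x' + t))).
  by rewrite mulrDr; apply: lerD; exact: odiff_far.
have P : `|t| `^ (-1) * `|t| `^ (-1) <= pw 4^-1 t.
  rewrite -powRD; last by apply/implyP => _; rewrite gt_eqF.
  by apply: (pw_far (b := 1)) => //; lra.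
have E := powR_half_sqr A0.
have p0 : 0 <= (4 * H) `^ 2^-1 * pw 4^-1 t by nneg.
move: E (powR_ge0 A 2^-1) P p0 (powR_ge0 `|t| (-1)) AC.
move: (A `^ _) (`|t| `^ _) (pw _ _) ((4 * H) `^ _) => a b p q.
move: (C * _) => D E a0 bp pq b0 AD.
have := sqr_ge0 (a - b); rewrite -E in AD; nra.
Qed.

Lemma dlogpot_holder : exists2 K, 0 <= K &
  forall x x', `|dlogpot x - dlogpot x'| <= K * `|x - x'| `^ 4^-1.
Proof.
have h0 : 0 <= hint.
  by rewrite /hint; apply: addr_ge0; [apply: mulr_ge0; [nneg|apply: int_ge0 => t; nneg]|nneg].
exists (2^-1 * ((2 * H) `^ 2^-1 * hint)); first by nneg.
move=> x x'; rewrite /dlogpot -mulrBr normrM ger0_norm// -!mulrA ler_wpM2l//.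
have I1 := itg_dlogpot x; have I2 := itg_dlogpot x'.
rewrite -intB// (_ : _ * _ = \int[mu]_t
   ((2 * H) `^ 2^-1 * `|x - x'| `^ 4^-1 * hmaj x x' t)); last first.
  by rewrite (intZ _ (itg_hmaj x x')) int_hmaj; ring.
apply: int_dom; first exact: itg_meas (itgB I1 I2).
  by apply: itgZ; exact: itg_hmaj.
move=> t; rewrite -mulrBr normrM normfV.
have B : `|odiff x t - odiff x' t| <= 2 * H * `|x - x'| `^ 2^-1.
  rewrite /odiff (_ : _ - _ - _ = F (x - t) - F (x' - t) - (F (x + t) - F (x' + t))); last by ring.
  rewrite (le_trans (ler_normB _ _))//.
  have := FH (x - t) (x' - t); have := FH (x + t) (x' + t).
  have -> : x + t - (x' + t) = x - x' by ring.
  by have -> : x - t - (x' - t) = x - x' by [ring|]; lra.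
have A := ler_normB (odiff x t) (odiff x' t).
have G := le_geom_mean (normr_ge0 _) A B.
rewrite (le_trans (ler_wpM2l _ G)) ?invr_ge0//.
rewrite mulrA powRM; [|by nneg|by nneg].
rewrite -powRrM (_ : 2^-1 * 2^-1 = 4^-1 :> R); last by field.
rewrite mulrC; apply: ler_wpM2l; first by nneg.
exact: odiff2_maj.
Qed.

(** Pass to the limit [s --> 0] in the mean value theorem for [rlogpot s], whose
derivative converges to [dlogpot] uniformly. *)
Lemma logpot_taylor : exists2 K, 0 <= K &
  forall x h, `|logpot F (x + h) - logpot F x - h * dlogpot x| <= K * `|h| `^ (5 / 4).
Proof.
have [K K0 HK] := dlogpot_holder; exists K => // x h.
have d0 : 0 <= dint by rewrite -(int_dmaj x); apply: int_ge0 => t; rewrite /dmaj; nneg.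
have S0 := @sing_int_ge0 R.
pose c := 4 * C * @sing_int R + `|h| * (2^-1 * dint).
have c0 : 0 <= c by rewrite /c; nneg.
have E s : 0 < s -> s <= 1 ->
   `|logpot F (x + h) - logpot F x - h * dlogpot x| <= K * `|h| `^ (5 / 4) + c * s `^ 4^-1.
  move=> s0 s1.
  have [z zx] := mvt x (x + h) (fun z => rlogpot_derive z s0).
  have -> : x + h - x = h by ring.
  move=> M; have R1 := rlogpot_cvg x s0; have R2 := rlogpot_cvg (x + h) s0.
  have R3 := rlogpot_derive_cvg z s0; have R4 := HK z x.
  have zh : `|z - x| `^ 4^-1 <= `|h| `^ 4^-1.
    apply: ge0_ler_powR; rewrite ?nnegrE ?invr_ge0//.
    by have -> : h = x + h - x by ring.
  have {}R4 : `|dlogpot z - dlogpot x| <= K * `|h| `^ 4^-1.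
    by rewrite (le_trans R4)// ler_wpM2l.
  have sq : s `^ 2^-1 <= s `^ 4^-1 by apply: powR_le_exp => //; lra.
  have h54 : `|h| `^ (5 / 4) = `|h| * `|h| `^ 4^-1.
    have [->|h1] := eqVneq h 0; first by rewrite normr0 mul0r powR0//; lra.
    rewrite (_ : 5 / 4 = 1 + 4^-1 :> R); last by field.
    by rewrite powRD ?powRr1//; apply/implyP => _; rewrite normr_eq0.
  set D := \int[mu]_y _ in M R3.
  have -> : logpot F (x + h) - logpot F x - h * dlogpot x =
    (logpot F (x + h) - rlogpot s (x + h)) - (logpot F x - rlogpot s x) +
    h * ((D - dlogpot z) + (dlogpot z - dlogpot x)).
    move: M; move: (rlogpot s (x + h)) (rlogpot s x) => a b M.
    by rewrite (_ : a = b + D * h); [ring|rewrite -M; ring].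
  rewrite (le_trans (ler_normD _ _))// h54 normrM.
  have B1 : `|logpot F (x + h) - rlogpot s (x + h) - (logpot F x - rlogpot s x)| <=
      4 * C * @sing_int R * s `^ 4^-1.
    rewrite (le_trans (ler_normB _ _))// distrC (distrC (logpot F x)).
    rewrite (le_trans (lerD R2 R1))//.
    have : C * @sing_int R * s `^ 2^-1 <= C * @sing_int R * s `^ 4^-1.
      by apply: ler_wpM2l => //; nneg.
    by nra.
  have B2 : `|h| * `|D - dlogpot z + (dlogpot z - dlogpot x)| <=
      `|h| * (2^-1 * (s `^ 4^-1 * dint) + K * `|h| `^ 4^-1).
    by apply: ler_wpM2l => //; rewrite (le_trans (ler_normD _ _))// lerD.
  rewrite (le_trans (lerD B1 B2))// /c; lra.
rewrite -subr_le0; apply: (@le0_powR_lim _ _ c 4^-1) => // s s0 s1.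
by rewrite lerBlDl; exact: E.
Qed.

End Regularity.

Section TaylorDerivative.
Context {R : realType}.

(** A remainder of order 5/4 is enough for differentiability. *)
Lemma isd_taylor (f : R -> R) (x a K : R) : 0 <= K ->
  (forall h, `|f (x + h) - f x - h * a| <= K * `|h| `^ (5 / 4)) -> isd f x a.
Proof.
move=> K0 H.
suff L : h^-1 *: ((f \o shift x) (h *: (1:R)) - f x) @[h --> 0^'] --> a.
  split; first by apply/cvg_ex; exists a.
  exact: (cvg_lim _ L).
apply/cvgrPdist_le => e e0.
have i4 : 0 < 4^-1 :> R by rewrite invr_gt0.
have [d [d0 _ dP]] := powR_small i4 K0 e0.
near=> h.
have h0 : h != 0 by near: h; exact: nbhs_dnbhs_neq.
have n0 : 0 < `|h| by rewrite normr_gt0.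
rewrite /= /shift /= /GRing.scale /= mulr1 (addrC h x).
have -> : a - h^-1 * (f (x + h) - f x) = - (h^-1 * (f (x + h) - f x - h * a)).
  by field.
rewrite normrN normrM normfV.
rewrite (le_trans (ler_wpM2l _ (H h))) ?invr_ge0//.
rewrite (_ : 5 / 4 = 1 + 4^-1 :> R); last by field.
rewrite powRD ?powRr1//; last by apply/implyP => _; rewrite gt_eqF.
rewrite mulrCA mulKf ?gt_eqF//; apply: dP => //.
by near: h; exact: dnbhs0_le.
Unshelve. all: end_near. Qed.

End TaylorDerivative.

(** * The potential of the bubble density *)

Section PoissonIntegrals.
Context {R : realType}.
Notation mu := (@lebesgue_measure R).

Lemma cvgNy_lin (g : R -> R) (l : R) (a b : R) : 0 < b ->
  g x @[x --> -oo] --> l -> g ((x - a) / b) @[x --> -oo] --> l.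
Proof.
move=> b0; apply: cvg_comp; apply/cvgrNyPle => A; near=> x.
rewrite ler_pdivrMr// lerBlDr; by near: x; apply: nbhs_ninfty_le; rewrite num_real.
Unshelve. all: end_near. Qed.

Lemma cvgy_lin (g : R -> R) (l : R) (a b : R) : 0 < b ->
  g x @[x --> +oo] --> l -> g ((x - a) / b) @[x --> +oo] --> l.
Proof.
move=> b0; apply: cvg_comp; apply/cvgryPge => A; near=> x.
rewrite ler_pdivlMr// lerBrDr; by near: x; apply: nbhs_pinfty_ge; rewrite num_real.
Unshelve. all: end_near. Qed.

Let den (x S t : R) := (t - x) ^+ 2 + S ^+ 2.

Let den_gt0 x S t : 0 < S -> 0 < den x S t.
Proof. by move=> S0; rewrite /den ltr_wpDl ?sqr_ge0// exprn_gt0. Qed.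

Let ratio_le x S t : 0 < S -> 1 <= `|t| ->
  `|(1 + t ^+ 2) / den x S t - 1| <=
  (2 * `|x| + `|x ^+ 2 + S ^+ 2 - 1|) * ((x ^+ 2 + S ^+ 2) / S ^+ 2) * `|t|^-1.
Proof.
move=> S0 t1; have p := den_gt0 x t S0.
have t0 : 0 < `|t| by rewrite (lt_le_trans ltr01).
have -> : (1 + t ^+ 2) / den x S t - 1 =
  (2 * x * t - (x ^+ 2 + S ^+ 2 - 1)) / den x S t.
  by rewrite /den; field; rewrite gt_eqF.
rewrite normrM normfV (gtr0_norm p) ler_pdivrMr//.
have N : `|2 * x * t - (x ^+ 2 + S ^+ 2 - 1)| <=
    (2 * `|x| + `|x ^+ 2 + S ^+ 2 - 1|) * `|t|.
  rewrite (le_trans (ler_normB _ _))// [leRHS]mulrDl normrM normrM (@ger0_norm _ 2)//.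
  by rewrite lerD2l ler_peMr.
rewrite (le_trans N)// -!mulrA; apply: ler_wpM2l; first by nneg.
have Q : t ^+ 2 * S ^+ 2 <= den x S t * (x ^+ 2 + S ^+ 2).
  have := sqr_ge0 (x * t - (x ^+ 2 + S ^+ 2)); rewrite /den; nra.
have S2 : 0 < S ^+ 2 by rewrite exprn_gt0.
rewrite [leRHS](_ : _ = den x S t * (x ^+ 2 + S ^+ 2) / (S ^+ 2 * `|t|)); last first.
  by field; rewrite !gt_eqF.
rewrite ler_pdivlMr ?mulr_gt0// -(real_normK (num_real t)) in Q *.
by rewrite (le_trans _ Q)// expr2; nra.
Qed.

Let ln_ratio_cvg (x S : R) (G : set_system R) : Filter G -> 0 < S ->
  ((1 + t ^+ 2) / den x S t @[t --> G] --> (1:R)) ->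
  ln ((1 + t ^+ 2) / den x S t) @[t --> G] --> (0:R).
Proof.
move=> FG S0 H; have := continuous_ln (@ltr01 R).
rewrite /prop_for /continuous_at ln1 => L.
exact: (cvg_comp _ _ H L).
Qed.

(** The semigroup property of Poisson kernels at heights 1 and [S], by partial
fractions. *)
Lemma poisson_om (x S : R) : 0 < S ->
  \int[mu]_t (S / ((x - t) ^+ 2 + S ^+ 2) * om t) =
  2 * pi * (1 + S) / ((1 + S) ^+ 2 + x ^+ 2).
Proof.
move=> S0; have S1 : S != 0 by rewrite gt_eqF.
have dE t : (x - t) ^+ 2 + S ^+ 2 = den x S t by rewrite /den; ring.
under eq_Rintegral do rewrite dE.
have cx t : {for t, continuous (fun t => S / den x S t * om t)}.
  apply: d_cont; rewrite /den /om; dsolve.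
  - by rewrite gt_eqF// den_gt0.
  - exact: sq1_neq0.
have I : itg (fun t => S / den x S t * om t).
  apply: (itg_dom (g := fun t => S^-1 * om t)).
  - by rewrite /den /om; msolve.
  - by apply: itgZ; exact: itg_om.
  move=> t; have p := den_gt0 x t S0; have o := om_gt0 t.
  rewrite ger0_norm; last by apply: mulr_ge0; [apply: divr_ge0|]; exact: ltW.
  rewrite ler_pM2r// ler_pdivrMr// mulrC ler_pdivlMr//.
  by rewrite /den lerDr sqr_ge0.
have p1 : 0 < (1 + S) ^+ 2 + x ^+ 2.
  by rewrite ltr_wpDr ?sqr_ge0// exprn_gt0// addr_gt0.
pose m := x ^+ 2 + S ^+ 2 - 1.
pose D := m ^+ 2 + 4 * x ^+ 2.
have DE : D = ((1 + S) ^+ 2 + x ^+ 2) * ((S - 1) ^+ 2 + x ^+ 2) by rewrite /D /m; ring.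
have Ay := @cvgy_atan R; have An := @cvgNy_atan R.
(* [D] vanishes exactly when both kernels have the same poles, where the partial
fraction decomposition degenerates. *)
have [D0|D0] := eqVneq D 0; last first.
  pose b := 2 * S * m / D; pose c := (4 * x ^+ 2 - 2 * m) / D.
  pose a := 2 * S * x / D.
  pose Ft t := 2 * (a * ln ((1 + t ^+ 2) / den x S t) + b * atan t +
    c * atan ((t - x) / S)) / 2.
  have dF t : isd Ft t (S / den x S t * om t).
    have q := den_gt0 x t S0.
    rewrite /Ft /den in q *; apply: deq; last first.
      dsolve; [by rewrite divr_gt0// sq1_gt0|by rewrite gt_eqF].
    cbv beta; rewrite /om /a /b /c /D /m; rewrite /D /m in D0.
    have q1 := sq1_neq0 t; field.
    by rewrite q1 S1 D0 (gt_eqF q).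
  rewrite (@ftc_line _ 0
    (2 * (a * 0 + b * - (pi / 2) + c * - (pi / 2)) / 2)
    (2 * (a * 0 + b * (pi / 2) + c * (pi / 2)) / 2) _ Ft I) => //.
  - rewrite /a /b /c DE /m; field.
    have : (S - 1) ^+ 2 + x ^+ 2 != 0.
      by apply: contra_neq D0 => E; rewrite DE E mulr0.
    by move=> ->; rewrite gt_eqF.
  - exact: d_cont (dF 0).
  - apply: cvgMl; apply: cvgMr; apply: cvgD; first apply: cvgD.
    + apply: cvgMr; apply: ln_ratio_cvg => //.
      by apply: cvgNy_inv => t t1; apply: ratio_le => //; rewrite ler_normr; lra.
    + exact: cvgMr.
    + by apply: cvgMr; exact: cvgNy_lin.
  - apply: cvgMl; apply: cvgMr; apply: cvgD; first apply: cvgD.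
    + apply: cvgMr; apply: ln_ratio_cvg => //.
      apply: cvgy_inv => t t1; have := @ratio_le x S t S0.
      by rewrite (ger0_norm (le_trans ler01 t1)); apply.
    + exact: cvgMr.
    + by apply: cvgMr; exact: cvgy_lin.
have [x0 SE] : x = 0 /\ S = 1.
  move/eqP: D0; rewrite DE mulf_eq0 (gt_eqF p1)/= paddr_eq0 ?sqr_ge0//.
  by rewrite !sqrf_eq0 subr_eq0 => /andP[/eqP -> /eqP ->].
subst x S.
pose Ft (t : R) := t * (1 + t ^+ 2)^-1 + atan t.
have dF t : isd Ft t (1 / den 0 1 t * om t).
  rewrite /Ft /den /om; apply: deq; last by dsolve; exact: sq1_neq0.
  by cbv beta; rewrite subr0 expr1n (addrC (t ^+ 2) 1); field; exact: sq1_neq0.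
have bnd (t : R) : 1 <= `|t| -> `|t * (1 + t ^+ 2)^-1 - 0| <= 1 * `|t|^-1.
  move=> t1; have t0 : 0 < `|t| by rewrite (lt_le_trans ltr01).
  rewrite subr0 normrM normfV (gtr0_norm (sq1_gt0 t)) ler_pdivrMr ?sq1_gt0//.
  rewrite mul1r mulrC ler_pdivlMr// -(real_normK (num_real t)); nra.
rewrite (@ftc_line _ 0 (0 + - (pi / 2)) (0 + pi / 2) _ Ft I) => //.
- by field.
- exact: d_cont (dF 0).
- apply: cvgD => //; apply: cvgNy_inv => t t1; apply: bnd.
  by rewrite ler_normr; lra.
- apply: cvgD => //; apply: (@cvgy_inv _ 1) => t t1.
  by have := bnd t; rewrite (ger0_norm (le_trans ler01 t1)); apply.
Qed.

End PoissonIntegrals.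

Section LogPoisson.
Context {R : realType}.
Notation mu := (@lebesgue_measure R).

Lemma powR_half_add (a b : R) : 0 <= a -> 0 <= b ->
  (a + b) `^ 2^-1 <= a `^ 2^-1 + b `^ 2^-1.
Proof.
move=> a0 b0; rewrite -(@ler_pXn2r _ 2)// ?nnegrE; [|by nneg|by nneg].
have := powR_half_sqr a0; have := powR_half_sqr b0.
have := powR_half_sqr (addr_ge0 a0 b0).
have := powR_ge0 a 2^-1; have := powR_ge0 b 2^-1.
by move: (_ `^ _) (a `^ _) (b `^ _) => u v w; rewrite !expr2; nra.
Qed.

Let om1 (y : R) : `|om y| <= 1 * om y.
Proof. by rewrite mul1r ger0_norm// ltW ?om_gt0. Qed.

(** [E] and its closed form [P] have the same derivative in [S], by the semigroup
property, and both are [2 * pi * ln S] up to a vanishing term as [S] tends to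
infinity. *)
Let E (x S : R) := rlogpot om S x.
Let IE (x S : R) : 0 < S -> itg (fun y : R => 2^-1 * ln ((x - y) ^+ 2 + S ^+ 2) * om y).
Proof. by move=> S0; exact: (itg_rlogpot (@ler01 R) (@om_meas R) om1). Qed.

Let E_derive (x S : R) : 0 < S ->
  isd (E x) S (2 * pi * (1 + S) / ((1 + S) ^+ 2 + x ^+ 2)).
Proof.
move=> S0; rewrite -poisson_om//.
have S2 : 0 < S / 2 by rewrite divr_gt0.
have pos s : `|s - S| < S / 2 -> S / 2 < s by rewrite ltr_distl => /andP[+ _]; lra.
have pos' s : `|s - S| < S / 2 -> 0 < s by move=> /pos; apply: lt_trans.
apply: (@isd_int _ _ (fun s t => s / ((x - t) ^+ 2 + s ^+ 2) * om t)
  (fun t => (S / 2)^-1 * om t) S (S / 2)) => //.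
- by move=> s sS; apply: IE; exact: pos' sS.
- move=> s y sS; have s0 := pos' s sS.
  have p : 0 < (x - y) ^+ 2 + s ^+ 2 by rewrite ltr_wpDl ?sqr_ge0// exprn_gt0.
  apply: deq; last by dsolve.
  by cbv beta; field; rewrite gt_eqF.
- move=> s y sS; have s0 := pos' s sS; have o := om_gt0 y.
  have p : 0 < (x - y) ^+ 2 + s ^+ 2 by rewrite ltr_wpDl ?sqr_ge0// exprn_gt0.
  rewrite normrM (gtr0_norm o) ler_pM2r// ger0_norm; last by rewrite divr_ge0// ltW.
  rewrite (@le_trans _ _ s^-1)//.
    rewrite ler_pdivrMr// mulrC ler_pdivlMr// -expr2 lerDr sqr_ge0//.
  by rewrite lef_pV2 ?posrE// ltW// pos.
- by apply: itgZ; exact: itg_om.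
Qed.

Let P (x S : R) := pi * ln ((1 + S) ^+ 2 + x ^+ 2).

Let Pden (x S : R) : 0 < S -> 0 < (1 + S) ^+ 2 + x ^+ 2.
Proof. by move=> S0; rewrite ltr_wpDr ?sqr_ge0// exprn_gt0// addr_gt0. Qed.

Let P_derive (x S : R) : 0 < S ->
  isd (P x) S (2 * pi * (1 + S) / ((1 + S) ^+ 2 + x ^+ 2)).
Proof.
move=> S0; have p := Pden x S0.
rewrite /P; apply: deq; last by dsolve.
by cbv beta; field; rewrite gt_eqF.
Qed.

Let EP_const (x S S' : R) : 0 < S -> 0 < S' -> E x S - P x S = E x S' - P x S'.
Proof.
move=> S0 S0'.
pose f v := E x (expR v) - P x (expR v).
have df v : isd f v 0.
  have e := expR_gt0 v.
  have d1 : isd expR v (expR v) by exact: is_derive_expR.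
  have := dB (@isd_comp R expR (E x) v _ _ (E_derive x e) d1)
    (@isd_comp R expR (P x) v _ _ (P_derive x e) d1).
  by rewrite subrr.
have [c _] := mvt (ln S) (ln S') df.
rewrite mul0r /f !lnK ?posrE// => /eqP; rewrite subr_eq0 => /eqP H.
by rewrite H.
Qed.

Let E_infty (x S : R) : 0 < S -> `|E x S - 2 * pi * ln S| <=
  2 * (`|x| `^ 2^-1 * (2 * pi) + \int[mu]_t (`|t| `^ 2^-1 * om t)) * S `^ (- 2^-1).
Proof.
move=> S0.
have -> : 2 * pi * ln S = \int[mu]_t (ln S * om t).
  by rewrite (intZ _ (@itg_om R)) int_om mulrC.
have I1 := IE x S0; have I2 := itgZ (ln S) (@itg_om R).
have I3 := itgD (itgZ (`|x| `^ 2^-1) (@itg_om R)) (@itg_powR_om R).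
rewrite /E /rlogpot -intB// (_ : _ * S `^ _ = \int[mu]_t (2 * S `^ (- 2^-1) *
  (`|x| `^ 2^-1 * om t + `|t| `^ 2^-1 * om t))); last first.
  rewrite (intZ _ I3) (intD (itgZ _ (@itg_om R)) (@itg_powR_om R)).
  by rewrite (intZ _ (@itg_om R)) int_om; ring.
apply: int_dom; [exact: itg_meas (itgB I1 I2)|by apply: itgZ|].
move=> t; rewrite -mulrBl normrM (ger0_norm (ltW (om_gt0 t))) -mulrDl mulrA.
rewrite ler_pM2r ?om_gt0//.
have p : 0 < (x - t) ^+ 2 + S ^+ 2 by rewrite ltr_wpDl ?sqr_ge0// exprn_gt0.
have S2 : 0 < S ^+ 2 by rewrite exprn_gt0.
have -> : ln S = 2^-1 * ln (S ^+ 2) by rewrite lnXn// -[_ *+ 2]mulr_natl; field.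
rewrite -mulrBr -ln_div//.
have -> : ((x - t) ^+ 2 + S ^+ 2) / S ^+ 2 = 1 + (`|x - t| / S) ^+ 2.
  by rewrite expr_div_n (real_normK (num_real _)); field; rewrite gt_eqF.
rewrite ger0_norm; last first.
  by apply: mulr_ge0 => //; rewrite ln_ge0// lerDl sqr_ge0.
have q0 : 0 <= `|x - t| / S by rewrite divr_ge0// ltW.
have L := ln1_quarter q0.
rewrite (@le_trans _ _ (2 * (`|x - t| / S) `^ 2^-1))//; first by move: L; lra.
rewrite powRM ?invr_ge0 ?(ltW S0)//.
have -> : S^-1 `^ 2^-1 = S `^ (- 2^-1).
  by rewrite -(powR_inv1 (ltW S0)) -powRrM mulN1r.
rewrite -mulrA ler_pM2l// (mulrC _ (_ + _)) ler_wpM2r ?powR_ge0//.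
rewrite (le_trans _ (powR_half_add _ _))//.
by apply: ge0_ler_powR; rewrite ?nnegrE ?addr_ge0// ler_normB.
Qed.

Let P_infty (x S : R) : 1 <= S -> `|P x S - 2 * pi * ln S| <= pi * (3 + x ^+ 2) * S^-1.
Proof.
move=> S1; have S0 : 0 < S by rewrite (lt_le_trans ltr01).
have S2 : 0 < S ^+ 2 by rewrite exprn_gt0.
have p := Pden x S0.
have -> : P x S - 2 * pi * ln S = pi * ln (((1 + S) ^+ 2 + x ^+ 2) / S ^+ 2).
  rewrite /P ln_div ?posrE// lnXn// -[_ *+ 2]mulr_natl; ring.
have -> : ((1 + S) ^+ 2 + x ^+ 2) / S ^+ 2 = 1 + (1 + 2 * S + x ^+ 2) / S ^+ 2.
  by field; rewrite gt_eqF.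
have q0 : 0 <= (1 + 2 * S + x ^+ 2) / S ^+ 2.
  by rewrite divr_ge0 ?(ltW S2)// addr_ge0 ?sqr_ge0//; lra.
rewrite ger0_norm; last first.
  by apply: mulr_ge0; [exact: pi_ge0|rewrite ln_ge0// lerDl].
rewrite -mulrA ler_wpM2l ?pi_ge0// (le_trans (le_ln1Dx _))//.
  by rewrite (lt_le_trans _ q0).
rewrite ler_pdivrMr// mulrAC ler_pdivlMr//.
have d0 : 0 <= S * (S - 1) by rewrite mulr_ge0 ?(ltW S0)// subr_ge0.
have := mulr_ge0 (sqr_ge0 x) d0; move: (x ^+ 2) => X; lra.
Qed.

Lemma rlogpot_om (x S : R) : 0 < S -> rlogpot om S x = pi * ln ((1 + S) ^+ 2 + x ^+ 2).
Proof.
move=> S0; apply/eqP; rewrite -subr_eq0 -normr_le0 -/(E x S) -/(P x S).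
set A := 2 * (`|x| `^ 2^-1 * (2 * pi) + \int[mu]_t (`|t| `^ 2^-1 * om t)).
have A0 : 0 <= A.
  apply: mulr_ge0 => //; apply: addr_ge0; first by nneg.
  by apply: int_ge0 => t; nneg.
have B0 : 0 <= pi * (3 + x ^+ 2) by nneg.
apply: (@le0_powR_lim _ _ (A + pi * (3 + x ^+ 2)) 2^-1); [by nneg|exact: inv2_gt0|].
move=> s s0 s1.
have T1 : 1 <= s^-1 by rewrite invf_ge1.
have T0 : 0 < s^-1 by rewrite invr_gt0.
rewrite (EP_const x S0 T0).
have e1 := E_infty x T0; have e2 := P_infty x T1.
have e3 : s^-1 `^ (- 2^-1) = s `^ 2^-1.
  by rewrite -(powR_inv1 (ltW s0)) -powRrM mulrN mulN1r opprK.
have e4 : s <= s `^ 2^-1 by apply: ger1_powR; rewrite ?s0//; lra.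
rewrite e3 -/A in e1; rewrite invrK in e2.
have e5 := ler_wpM2l B0 e4.
have := ler_normB (E x s^-1 - 2 * pi * ln s^-1) (P x s^-1 - 2 * pi * ln s^-1).
rewrite opprB addrA subrK => e6.
apply: (le_trans e6); rewrite [leRHS]mulrDl; apply: lerD => //.
exact: le_trans e2 e5.
Qed.

(** The limit [S --> 0] of the previous formula. *)
Lemma logpot_om (x : R) : logpot om x = pi * ln (1 + x ^+ 2) :> R.
Proof.
have := @sing_int_ge0 R; set c := @sing_int R => c0.
apply/eqP; rewrite -subr_eq0 -normr_le0.
apply: (@le0_powR_lim _ _ (2 * 1 * c + pi * 3) 2^-1); [by nneg|exact: inv2_gt0|].
move=> s s0 s1.
have e1 := rlogpot_cvg (@ler01 R) (@om_meas R) om1 x s0.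
rewrite rlogpot_om// -/c in e1.
have p := Pden x s0; have q := sq1_gt0 x.
have e4 : s <= s `^ 2^-1 by apply: ger1_powR; rewrite ?s0//; lra.
have e2 : `|pi * ln ((1 + s) ^+ 2 + x ^+ 2) - pi * ln (1 + x ^+ 2)| <= pi * 3 * s.
  rewrite -mulrBr -ln_div//.
  have -> : ((1 + s) ^+ 2 + x ^+ 2) / (1 + x ^+ 2) = 1 + (2 * s + s ^+ 2) / (1 + x ^+ 2).
    by field; rewrite gt_eqF.
  have q0 : 0 <= (2 * s + s ^+ 2) / (1 + x ^+ 2).
    by rewrite divr_ge0 ?(ltW q)// addr_ge0 ?sqr_ge0//; lra.
  rewrite ger0_norm; last first.
    by apply: mulr_ge0; [exact: pi_ge0|rewrite ln_ge0// lerDl].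
  rewrite -mulrA ler_wpM2l ?pi_ge0// (le_trans (le_ln1Dx _))//.
    by rewrite (lt_le_trans _ q0).
  rewrite ler_pdivrMr//; have := sqr_ge0 x; move: (x ^+ 2) => X X0; nra.
have p3 : 0 <= pi * 3 :> R by nneg.
have e5 := ler_wpM2l p3 e4.
have := ler_normB (pi * ln ((1 + s) ^+ 2 + x ^+ 2) - pi * ln (1 + x ^+ 2))
  (pi * ln ((1 + s) ^+ 2 + x ^+ 2) - logpot om x).
rewrite (_ : _ - _ - (_ - _) = logpot om x - pi * ln (1 + x ^+ 2)); last by ring.
move=> e6; apply: (le_trans e6); rewrite [leRHS]mulrDl addrC; apply: lerD.
  by rewrite (le_trans e1)// mulrAC.
exact: le_trans e2 e5.
Qed.

(** The Poisson kernel of height [s], without its factor [pi^-1]. *)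
Definition pk (s t : R) := s / (t ^+ 2 + s ^+ 2).

(** By scaling from [logpot_om]: the harmonic extension of [ln `|z - t|] to height
[s] is the logarithm of the distance to the pole. *)
Lemma log_poisson (s z : R) : 0 < s ->
  itg (fun t => ln `|z - t| * pk s t) /\
  \int[mu]_t (ln `|z - t| * pk s t) = 2^-1 * pi * ln (z ^+ 2 + s ^+ 2).
Proof.
move=> s0; have s1 : s != 0 by rewrite gt_eqF.
have I0 := itg_logpot (@ler01 R) (@om_meas R) om1 (z / s).
pose g u := ln `|z / s - u| * om u + ln s * om u.
have Ig : itg g by apply: itgD => //; apply: itgZ; exact: itg_om.
have Eg : \int[mu]_u g u = pi * ln (1 + (z / s) ^+ 2) + ln s * (2 * pi).
  rewrite /g (intD I0 (itgZ _ (@itg_om R))) (intZ _ (@itg_om R)) int_om.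
  by rewrite -logpot_om.
have si : 0 < s^-1 by rewrite invr_gt0.
have Ig' := itgZ (2 * s)^-1 (itg_affine 0 si Ig).
have mf : measurable_fun setT (fun t : R => ln `|z - t| * pk s t).
  by rewrite /pk; msolve.
have fg t : t != z -> (2 * s)^-1 * g (0 + s^-1 * t) = ln `|z - t| * pk s t.
  move=> tz; have zt : 0 < `|z - t| by rewrite normr_gt0 subr_eq0 eq_sym.
  rewrite add0r /g (_ : z / s - s^-1 * t = (z - t) / s); last by field.
  rewrite normrM normfV (gtr0_norm s0) ln_div ?posrE// -mulrDl subrK.
  rewrite /om /pk; have := sq1_neq0 (s^-1 * t).
  have p : t ^+ 2 + s ^+ 2 != 0 by rewrite gt_eqF// ltr_wpDl ?sqr_ge0// exprn_gt0.
  have -> : 1 + (s^-1 * t) ^+ 2 = (t ^+ 2 + s ^+ 2) / s ^+ 2 by field.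
  by move=> _; field; rewrite p s1.
split; first exact: (eq_itg_pt (p := z) mf Ig').
rewrite -(eq_int_pt (p := z) (itg_meas Ig') mf)//.
rewrite (intZ _ (itg_affine 0 si Ig)).
have EE := int_affine 0 si Ig; rewrite Eg in EE.
have -> : \int[mu]_x g (0 + s^-1 * x) =
    s * (pi * ln (1 + (z / s) ^+ 2) + ln s * (2 * pi)).
  by rewrite EE mulrA divff// mul1r.
have p : 0 < z ^+ 2 + s ^+ 2 by rewrite ltr_wpDl ?sqr_ge0// exprn_gt0.
have -> : ln (z ^+ 2 + s ^+ 2) = ln (1 + (z / s) ^+ 2) + 2 * ln s.
  have -> : 2 * ln s = ln (s ^+ 2) by rewrite lnXn// mulr_natl.
  rewrite -lnM ?posrE ?sq1_gt0 ?exprn_gt0//.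
  by congr ln; field.
by field.
Qed.

End LogPoisson.

(** * The half-Laplacian of a logarithmic potential *)

Section LogProfile.
Context {R : realType}.
Notation mu := (@lebesgue_measure R).

(** The profile [ln sqrt (1 + (s/t)^2)] by which the regularised logarithmic
kernel differs from the logarithmic kernel. *)
Definition lg (s t : R) := 2^-1 * ln (1 + s ^+ 2 / t ^+ 2).

Let lgE (s t : R) : 0 < s -> lg s t = 2^-1 * ln (1 + (s / `|t|) ^+ 2).
Proof. by move=> s0; rewrite /lg expr_div_n (real_normK (num_real t)). Qed.

Lemma lg_ge0 (s t : R) : 0 <= lg s t.
Proof.
apply: mulr_ge0; first by rewrite invr_ge0.
by rewrite ln_ge0// lerDl divr_ge0 ?sqr_ge0.
Qed.

Lemma lg_meas (s : R) : measurable_fun setT (lg s).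
Proof. by rewrite /lg; msolve. Qed.

(** An antiderivative of [lg s] off the origin, continuous at the origin. *)
Let Ft (s t : R) := 2^-1 * (t * ln (1 + s ^+ 2 / t ^+ 2)) + s * atan (t / s).

Let dFt (s t : R) : 0 < s -> t != 0 -> isd (Ft s) t (lg s t).
Proof.
move=> s0 t0; have s1 : s != 0 by rewrite gt_eqF.
have t2 : 0 < t ^+ 2 by rewrite exprn_even_gt0.
have p : 0 < 1 + s ^+ 2 / t ^+ 2 by rewrite ltr_wpDr// divr_ge0 ?sqr_ge0.
rewrite /Ft /lg; apply: deq; last by dsolve; rewrite ?expf_neq0.
cbv beta; move: (ln _) => L; field.
have q : 0 < t ^+ 2 + s ^+ 2 by rewrite addr_gt0// exprn_gt0.
by rewrite s1 t0 addrC (gt_eqF q).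
Qed.

Let Ft1_le (s t : R) : 0 < s ->
  `|2^-1 * (t * ln (1 + s ^+ 2 / t ^+ 2))| <= 2 * s `^ 2^-1 * `|t| `^ 2^-1.
Proof.
move=> s0; have [->|t0] := eqVneq t 0.
  by rewrite mul0r mulr0 normr0; nneg.
have n0 : 0 < `|t| by rewrite normr_gt0.
rewrite mulrCA -/(lg s t) normrM (ger0_norm (lg_ge0 s t)) lgE//.
have q0 : 0 <= s / `|t| by rewrite divr_ge0// ltW.
have L := ln1_quarter q0.
rewrite powRM ?invr_ge0 ?(ltW s0)// in L.
have E : `|t| * `|t|^-1 `^ 2^-1 = `|t| `^ 2^-1.
  rewrite -{1}(powRr1 (ltW n0)) -(powR_inv1 (ltW n0)) -powRrM -powRD; last first.
    by apply/implyP => _; rewrite gt_eqF.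
  by congr (_ `^ _); field.
rewrite -E; move: L; move: (ln _) (s `^ _) (_^-1 `^ _) => l a b L.
by rewrite (_ : 2 * a * (`|t| * b) = `|t| * (2 * (a * b))); [rewrite ler_pM2l//; lra|ring].
Qed.

Lemma itg_lg (s : R) : 0 < s -> itg (lg s).
Proof.
move=> s0; apply: (@itg_ge0_antiderivative _ 0 (s + s * pi) _ (Ft s)).
- exact: lg_meas.
- exact: lg_ge0.
- move=> t t0; apply: d_cont; rewrite /lg; dsolve.
    by rewrite ltr_wpDr// divr_ge0 ?sqr_ge0.
  by rewrite expf_neq0.
- by move=> t t0; exact: dFt.
move=> t; rewrite /Ft (le_trans (ler_normD _ _))// lerD//.
  have [->|t0] := eqVneq t 0; first by rewrite mul0r mulr0 normr0 ltW.
  have n0 : 0 < `|t| by rewrite normr_gt0.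
  rewrite mulrCA -/(lg s t) normrM (ger0_norm (lg_ge0 s t)) lgE//.
  have q0 : 0 <= s / `|t| by rewrite divr_ge0// ltW.
  rewrite mulrC -ler_pdivlMr//; have := ln1_sqr_le q0; lra.
rewrite normrM gtr0_norm// ler_pM2l//.
have := atan_gtNpi2 (t / s); have := atan_ltpi2 (t / s); have := pi_gt0 R.
by move: (atan _) pi => u v; rewrite ler_norml; lra.
Qed.

Lemma int_lg (s : R) : 0 < s -> \int[mu]_t lg s t = pi * s.
Proof.
move=> s0.
have bnd (t : R) : 1 <= `|t| ->
    `|2^-1 * (t * ln (1 + s ^+ 2 / t ^+ 2)) - 0| <= s ^+ 2 * `|t|^-1.
  move=> t1; have n0 : 0 < `|t| by rewrite (lt_le_trans ltr01).
  rewrite subr0 mulrCA -/(lg s t) normrM (ger0_norm (lg_ge0 s t)).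
  rewrite ler_pdivlMr// mulrAC -expr2 (real_normK (num_real t)) mulrC.
  rewrite -ler_pdivlMr ?exprn_even_gt0 -?normr_gt0//= /lg.
  have q : 0 <= s ^+ 2 / t ^+ 2 by rewrite divr_ge0 ?sqr_ge0.
  have := le_ln1Dx (lt_le_trans (ltrN10 R) q).
  by move: (s ^+ 2 / t ^+ 2) q => v q; move: (ln (1 + v)) => l; lra.
rewrite (@ftc_line _ 0 (0 + s * - (pi / 2)) (0 + s * (pi / 2)) _ (Ft s) (itg_lg s0)).
- by field.
- move=> t t0; apply: d_cont; rewrite /lg; dsolve.
    by rewrite ltr_wpDr// divr_ge0 ?sqr_ge0.
  by rewrite expf_neq0.
- by move=> t t0; exact: dFt.
- have F0 : Ft s 0 = 0 + s * atan (0 / s) by rewrite /Ft mul0r mulr0.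
  rewrite /prop_for /continuous_at F0; apply: cvgD; last first.
    apply: cvgMr; have := @continuous_atan R (0 / s); apply: cvg_comp.
    by apply: cvgMl.
  apply/cvgrPdist_le => e e0; have c0 : 0 <= 2 * s `^ 2^-1 by nneg.
  have [d [d0 _ dP]] := powR_small (@inv2_gt0 R) c0 e0.
  have NR : \forall t \near (0 : R), `|t| <= d by exact: (@nbhs0_le _ R^o).
  near=> t; rewrite distrC subr0 (le_trans (Ft1_le t s0))//.
  have td : `|t| <= d by near: t; exact: NR.
  exact: dP.
- apply: cvgD.
    by apply: cvgNy_inv => t t1; apply: bnd; rewrite ler_normr; lra.
  apply: cvgMr; rewrite (_ : (fun t => _) = fun t => atan ((t - 0) / s)).
    by apply: cvgNy_lin => //; exact: cvgNy_atan.
  by apply/funext => t; rewrite subr0.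
- apply: cvgD.
    apply: cvgy_inv => t t1; have := bnd t.
    by rewrite (ger0_norm (le_trans ler01 t1)); apply.
  apply: cvgMr; rewrite (_ : (fun t => _) = fun t => atan ((t - 0) / s)).
    by apply: cvgy_lin => //; exact: cvgy_atan.
  by apply/funext => t; rewrite subr0.
Unshelve. all: end_near. Qed.

Lemma lg_le (s t : R) : 0 < s -> t != 0 ->
  lg s t <= s `^ (5 / 4) * `|t| `^ (- (5 / 4)).
Proof.
move=> s0 t0; have n0 : 0 < `|t| by rewrite normr_gt0.
have q0 : 0 < s / `|t| by rewrite divr_gt0.
rewrite lgE//; set w := s / `|t| in q0 *.
have -> : s `^ (5 / 4) * `|t| `^ (- (5 / 4)) = w `^ (5 / 4).
  rewrite /w powRM ?invr_ge0 ?(ltW s0)//; congr (_ * _).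
  by rewrite -(powR_inv1 (ltW n0)) -powRrM mulN1r.
have l0 : 0 <= ln (1 + w ^+ 2) by rewrite ln_ge0// lerDl sqr_ge0.
have A : ln (1 + w ^+ 2) <= w ^+ 2.
  by apply: le_ln1Dx; rewrite (lt_le_trans (ltrN10 R))// sqr_ge0.
have B := ln1_quarter (ltW q0).
have := le_geom_mean l0 A B.
rewrite powRM ?powR_ge0// -powRrM -(powR_mulrn _ (ltW q0)) -powRrM.
have -> : 4 `^ 2^-1 = 2 :> R.
  rewrite (_ : 4 = 2 `^ 2%:R :> R); first by rewrite -powRrM divff ?powRr1.
  by rewrite powR_mulrn// expr2 -natrM.
rewrite divff// mulrCA -powRD; last by apply/implyP => _; rewrite gt_eqF.
rewrite (_ : 1 + 2^-1 * 2^-1 = 5 / 4 :> R); last by field.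
by move: (ln _) (w `^ (5 / 4)) => a b; lra.
Qed.

Lemma pk_gt0 (s t : R) : 0 < s -> 0 < pk s t.
Proof.
by move=> s0; rewrite divr_gt0// ltr_wpDl ?sqr_ge0// exprn_gt0.
Qed.

Lemma pk_le (s t : R) : 0 < s -> pk s t <= (s + s^-1) / 2 * om t.
Proof.
move=> s0; have p : 0 < t ^+ 2 + s ^+ 2 by rewrite ltr_wpDl ?sqr_ge0// exprn_gt0.
have q := sq1_gt0 t.
rewrite /pk /om ler_pdivrMr// [leRHS](_ : _ = ((s + s^-1) * (t ^+ 2 + s ^+ 2)) / (1 + t ^+ 2)); last first.
  by field; rewrite (gt_eqF s0) (gt_eqF q).
rewrite ler_pdivlMr//.
have -> : (s + s^-1) * (t ^+ 2 + s ^+ 2) = s * (1 + t ^+ 2) + (s ^+ 3 + s^-1 * t ^+ 2).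
  by field; rewrite gt_eqF.
rewrite lerDl addr_ge0 ?exprn_ge0 ?(ltW s0)// mulr_ge0 ?sqr_ge0// invr_ge0 ltW//.
Qed.

Lemma pk_meas (s : R) : measurable_fun setT (pk s).
Proof. by rewrite /pk; msolve. Qed.

Lemma itg_pk (s : R) : 0 < s -> itg (pk s).
Proof.
move=> s0; apply: (itg_dom (pk_meas s) (itgZ ((s + s^-1) / 2) (@itg_om R))).
by move=> t; rewrite gtr0_norm ?pk_gt0// pk_le.
Qed.

Lemma int_pk (s : R) : 0 < s -> \int[mu]_t pk s t = pi.
Proof.
move=> s0; have s1 : s != 0 by rewrite gt_eqF.
rewrite (int_affine 0 s0 (itg_pk s0)).
rewrite (_ : (fun x => _) = fun x => (2 * s)^-1 * om x).
  by rewrite (intZ _ (@itg_om R)) int_om; field.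
apply/funext => x; rewrite /pk /om; have q := sq1_neq0 x.
have -> : (0 + s * x) ^+ 2 + s ^+ 2 = s ^+ 2 * (1 + x ^+ 2) by ring.
by field; rewrite s1 q.
Qed.

End LogProfile.

Section HalfLaplacianOfPotential.
Context {R : realType}.
Notation mu := (@lebesgue_measure R).
Context (F : R -> R) (C H : R).
Context (C0 : 0 <= C) (H0 : 0 <= H).
Context (mF : measurable_fun setT F) (FC : forall y, `|F y| <= C * om y).
Context (FH : forall y z, `|F y - F z| <= H * `|y - z| `^ 2^-1).

Local Notation Phi := (logpot F).
Let IL := itg_logpot C0 mF FC.

Let isdPhi (x : R) : isd Phi x (dlogpot F x).
Proof.
have [K K0 HK] := logpot_taylor C0 H0 mF FC FH.
by apply: (isd_taylor K0) => h; exact: HK.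
Qed.

Let contPhi : continuous Phi.
Proof. by move=> x; exact: d_cont (isdPhi x). Qed.

Let mPhi : measurable_fun setT Phi.
Proof. exact: mfC contPhi. Qed.

Let inv8_gt0 : 0 < 8^-1 :> R. Proof. by rewrite invr_gt0. Qed.

Let sd (x t : R) := 2 * Phi x - Phi (x - t) - Phi (x + t).

Let msd (x : R) : measurable_fun setT (sd x).
Proof. by rewrite /sd; msolve. Qed.

(* The second difference is [O(|t|^(5/4))] at the origin and [O(|t|^(1/2))] at
infinity, which leaves room for an exponent slightly above 2. *)
Let sd_maj : exists2 M, 0 <= M & forall x e t, 2 <= e -> e <= 17 / 8 ->
  `|t| `^ (- e) * `|sd x t| <= M * pw 8^-1 t.
Proof.
have [K K0 HK] := logpot_taylor C0 H0 mF FC FH.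
have [L L0 HL] := logpot_holder C0 mF FC.
exists (2 * K + 2 * L); first by nneg.
move=> x e t e2 e17.
have [->|t0] := eqVneq t 0.
  rewrite /sd subr0 addr0 (_ : 2 * Phi x - Phi x - Phi x = 0); last by ring.
  by rewrite normr0 mulr0; nneg.
have n0 : 0 < `|t| by rewrite normr_gt0.
have tI b : b ==> (`|t| != 0) by apply/implyP => _; rewrite normr_eq0.
have p0 := pw_ge0 8^-1 t.
have [t1|/ltW t1] := leP `|t| 1.
  have E : `|sd x t| <= 2 * K * `|t| `^ (5 / 4).
    have -> : sd x t = - ((Phi (x + t) - Phi x - t * dlogpot F x) +
       (Phi (x + - t) - Phi x - (- t) * dlogpot F x)) by rewrite /sd; ring.
    rewrite normrN (le_trans (ler_normD _ _))//.
    by have := HK x t; have := HK x (- t); rewrite normrN; lra.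
  rewrite (le_trans (ler_wpM2l (powR_ge0 _ _) E))// mulrCA -powRD//.
  apply: ler_pM; [by nneg|exact: powR_ge0|by rewrite lerDl; nneg|].
  apply: le_trans (pw_near (b := 8^-1) _ (lexx _) inv8_gt0 t1); last by lra.
  by apply: powR_le_exp => //; lra.
have E : `|sd x t| <= 2 * L * `|t| `^ 2^-1.
  have -> : sd x t = (Phi x - Phi (x - t)) + (Phi x - Phi (x + t)) by rewrite /sd; ring.
  rewrite (le_trans (ler_normD _ _))//.
  have := HL x (x - t); have := HL x (x + t).
  have -> : x - (x + t) = - t by ring.
  by have -> : x - (x - t) = t by [ring|]; rewrite normrN; lra.
rewrite (le_trans (ler_wpM2l (powR_ge0 _ _) E))// mulrCA -powRD//.
apply: ler_pM; [by nneg|exact: powR_ge0|by rewrite lerDr; nneg|].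
apply: le_trans (pw_far (b := e - 3 / 2) _ inv8_gt0 t1); last by lra.
by apply: ler_powR => //; lra.
Qed.

Let powRN2 (t : R) : `|t| `^ (- 2%:R) = (t ^+ 2)^-1.
Proof. by rewrite powR_invn// (real_normK (num_real t)). Qed.

Let itg_sd (x : R) : itg (fun t => (t ^+ 2)^-1 * sd x t).
Proof.
have [M M0 HM] := sd_maj.
apply: (itg_dom (g := fun t => M * pw 8^-1 t)).
- by have := msd x => ?; msolve.
- by apply: itgZ; exact: itg_pw.
move=> t; rewrite normrM -powRN2 (ger0_norm (powR_ge0 _ _)).
by apply: HM => //; lra.
Qed.

Let J (x : R) := \int[mu]_t ((t ^+ 2)^-1 * sd x t).

(** The harmonic extension of the logarithmic kernel is the regularised kernel;
Fubini's theorem integrates this against [F]. *)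
Let poisson_pot (x s : R) : 0 < s ->
  itg (fun t => Phi (x - t) * pk s t) /\
  \int[mu]_t (Phi (x - t) * pk s t) = pi * rlogpot F s x.
Proof.
move=> s0; pose f (t y : R) := ln `|x - t - y| * F y * pk s t.
have [c1 [c2 [c10 c20 cE]]] := @int_logmaj R.
pose k := (s + s^-1) / 2.
have k0 : 0 <= k by rewrite /k divr_ge0// addr_ge0 ?invr_ge0 ?(ltW s0).
pose g (t : R) := k * C * ((c1 + c2 * `|x| `^ 2^-1) * om t + c2 * (`|t| `^ 2^-1 * om t)).
have Ig : itg g.
  apply: itgZ; apply: itgD; first by apply: itgZ; exact: itg_om.
  by apply: itgZ; exact: itg_powR_om.
have If1 t : itg (f t) by apply: itgZr; exact: IL.
have If2 y : itg (f ^~ y).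
  have [I _] := log_poisson (x - y) s0.
  apply: eq_itg (itgZ (F y) I) => t; rewrite /f.
  by rewrite (_ : x - t - y = x - y - t); ring.
have mf : measurable_fun setT (fun z : R * R => f z.1 z.2).
  by rewrite /f /pk; msolve.
have fg t : \int[mu]_y `|f t y| <= g t.
  have p := pk_gt0 t s0; have o := om_gt0 t.
  apply: (@le_trans _ _ (\int[mu]_y (pk s t * C * logmaj (x - t) y))).
    apply: le_int; [exact: itg_norm|by apply: itgZ; exact: itg_logmaj|].
    move=> y; rewrite /f normrM (gtr0_norm p) mulrC -mulrA ler_pM2l//.
    rewrite normrM (le_trans (ler_wpM2l (normr_ge0 _) (FC y)))//.
    by rewrite mulrCA ler_wpM2l// log_om_le.
  rewrite (intZ _ (itg_logmaj _)) cE /g.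
  have A : c1 + c2 * `|x - t| `^ 2^-1 <= c1 + c2 * `|x| `^ 2^-1 + c2 * `|t| `^ 2^-1.
    rewrite -addrA lerD2l -mulrDr ler_wpM2l// (le_trans _ (powR_half_add _ _))//.
    by apply: ge0_ler_powR; rewrite ?nnegrE ?addr_ge0 ?invr_ge0// ler_normB.
  have A0 : 0 <= c1 + c2 * `|x - t| `^ 2^-1 by nneg.
  rewrite (@le_trans _ _ (k * om t * C * (c1 + c2 * `|x - t| `^ 2^-1)))//.
    by apply: ler_wpM2r => //; apply: ler_wpM2r => //; exact: pk_le.
  rewrite [leRHS](_ : _ = k * om t * C * (c1 + c2 * `|x| `^ 2^-1 + c2 * `|t| `^ 2^-1)).
    by apply: ler_wpM2l => //; apply: mulr_ge0 => //; apply: mulr_ge0 => //; exact: ltW.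
  by ring.
have [I E] := fubini_dom mf If1 If2 Ig fg.
have EI t : \int[mu]_y f t y = Phi (x - t) * pk s t.
  by rewrite /f (intZr _ (IL (x - t))).
split; first by apply: eq_itg I => t; exact: EI.
rewrite -(eq_int EI) E /rlogpot -(intZ _ (itg_rlogpot C0 mF FC x s0)).
apply: eq_int => y; have [I' E'] := log_poisson (x - y) s0.
rewrite (_ : (fun t => f t y) = fun t => F y * (ln `|x - y - t| * pk s t)).
  by rewrite (intZ _ I') E'; ring.
by apply/funext => t; rewrite /f (_ : x - t - y = x - y - t); ring.
Qed.

Let pkN (s t : R) : pk s (- t) = pk s t.
Proof. by rewrite /pk sqrrN. Qed.

Let poisson_sd (x s : R) : 0 < s ->
  itg (fun t => sd x t * pk s t) /\
  \int[mu]_t (sd x t * pk s t) = - (2 * pi * (rlogpot F s x - Phi x)).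
Proof.
move=> s0; have [I1 E1] := poisson_pot x s0.
have I2 : itg (fun t => Phi (x + t) * pk s t).
  by apply: eq_itg (itg_opp I1) => t; rewrite opprK pkN.
have E2 : \int[mu]_t (Phi (x + t) * pk s t) = pi * rlogpot F s x.
  rewrite -E1 (int_opp (itg_meas I1)); apply: eq_int => t.
  by rewrite opprK pkN.
have I3 := itgZ (2 * Phi x) (itg_pk s0).
rewrite (_ : (fun t => sd x t * pk s t) = fun t => 2 * Phi x * pk s t -
    Phi (x - t) * pk s t - Phi (x + t) * pk s t); last first.
  by apply/funext => t; rewrite /sd; ring.
split; first by apply: itgB => //; exact: itgB.
rewrite (intB (itgB I3 I1) I2) (intB I3 I1) (intZ _ (itg_pk s0)) int_pk// E1 E2.
by ring.
Qed.

Let rlogpot_expand (x s : R) : 0 < s ->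
  rlogpot F s x - Phi x = \int[mu]_t (lg s t * F (x - t)).
Proof.
move=> s0; have I1 := itg_rlogpot C0 mF FC x s0.
have I := itg_refl x (itgB I1 (IL x)).
rewrite /rlogpot /logpot -(intB I1 (IL x)) (int_refl x (itgB I1 (IL x))).
apply: (eq_int_pt (p := 0)); first exact: itg_meas I.
  by have := @lg_meas R s => ?; msolve.
move=> t t0; rewrite subKr -mulrBl; congr (_ * _).
have t2 : 0 < t ^+ 2 by rewrite exprn_even_gt0.
have -> : ln `|t| = 2^-1 * ln (t ^+ 2).
  by rewrite -[in RHS](real_normK (num_real _)) lnXn ?normr_gt0// -[_ *+ 2]mulr_natl; field.
have p2 : 0 < t ^+ 2 + s ^+ 2 by apply: (addr_gt0 t2); rewrite exprn_gt0.
rewrite -mulrBr -ln_div ?posrE//.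
rewrite /lg; congr (_ * ln _); field.
exact: t0.
Qed.

(** The profile [lg s] has mass [pi * s] and concentrates at the origin. *)
Let rlogpot_first_order : exists2 K, 0 <= K & forall x s, 0 < s ->
  `|rlogpot F s x - Phi x - pi * s * F x| <= K * s `^ (5 / 4).
Proof.
have i4 : 0 < 4^-1 :> R by rewrite invr_gt0.
exists ((H + 4 * C) * (\int[mu]_t pw 4^-1 t)).
  by apply: mulr_ge0; [nneg|apply: int_ge0 => t; nneg].
move=> x s s0.
have Il := itg_lg s0.
have I1 : itg (fun t => lg s t * F (x - t)).
  apply: (itg_dom (g := fun t => C * 2 * lg s t)).
  - by have := @lg_meas R s => ?; msolve.
  - exact: itgZ.
  move=> t; rewrite normrM (ger0_norm (lg_ge0 s t)) mulrC ler_wpM2r ?lg_ge0//.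
  by rewrite (le_trans (FC _))// ler_wpM2l// om_le2.
have -> : pi * s * F x = \int[mu]_t (F x * lg s t).
  by rewrite (intZ _ Il) int_lg// mulrC.
rewrite rlogpot_expand// -(intB I1 (itgZ (F x) Il)).
rewrite mulrAC -(intZ _ (itg_pw i4)).
apply: (int_dom2 (p := 0) (q := 0)).
- exact: itg_meas (itgB I1 (itgZ (F x) Il)).
- by apply: itgZ; exact: itg_pw.
- by move=> t; nneg.
move=> t t0 _; have n0 : 0 < `|t| by rewrite normr_gt0.
rewrite (mulrC (F x)) -mulrBr normrM (ger0_norm (lg_ge0 s t)).
rewrite (le_trans (ler_wpM2r (normr_ge0 _) (lg_le s0 t0)))//.
rewrite [leRHS](_ : _ = s `^ (5 / 4) * ((H + 4 * C) * pw 4^-1 t)); last by ring.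
rewrite -mulrA ler_wpM2l ?powR_ge0//.
have [t1|/ltW t1] := leP `|t| 1.
  have L := FH (x - t) x.
  have {}L : `|F (x - t) - F x| <= H * `|t| `^ 2^-1.
    by rewrite (le_trans L)// (_ : x - t - x = - t) ?normrN//; ring.
  rewrite (le_trans (ler_wpM2l (powR_ge0 _ _) L))// mulrCA.
  rewrite -powRD; last by apply/implyP => _; rewrite gt_eqF.
  apply: ler_pM; [by []|exact: powR_ge0|by rewrite lerDl; nneg|].
  apply: le_trans (pw_near (b := 4^-1) _ (lexx _) i4 t1); last by lra.
  by apply: powR_le_exp => //; lra.
have L : `|F (x - t) - F x| <= 4 * C.
  rewrite (le_trans (ler_normB _ _))//.
  have := FC (x - t); have := FC x.
  have := ler_wpM2l C0 (om_le2 (x - t)); have := ler_wpM2l C0 (om_le2 x); lra.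
rewrite (le_trans (ler_wpM2l (powR_ge0 _ _) L))// mulrC.
apply: ler_pM; [by nneg|exact: powR_ge0|by rewrite lerDr|].
apply: le_trans (pw_far (b := 4^-1) (lexx _) i4 t1).
by apply: ler_powR => //; lra.
Qed.

Let J_cutoff : exists2 K, 0 <= K & forall x s, 0 < s ->
  `|J x - s^-1 * \int[mu]_t (sd x t * pk s t)| <= K * s `^ 8^-1.
Proof.
have [M M0 HM] := sd_maj.
exists (M * \int[mu]_t pw 8^-1 t).
  by apply: mulr_ge0 => //; apply: int_ge0 => t; nneg.
move=> x s s0; have [I1 E1] := poisson_sd x s0.
rewrite /J -(intZ _ I1) -(intB (itg_sd x) (itgZ _ I1)).
rewrite mulrAC -(intZ _ (itg_pw inv8_gt0)).
apply: int_dom.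
- exact: itg_meas (itgB (itg_sd x) (itgZ _ I1)).
- by apply: itgZ; exact: itg_pw.
move=> t; have [->|t0] := eqVneq t 0.
  rewrite /sd subr0 addr0 (_ : 2 * Phi x - Phi x - Phi x = 0); last by ring.
  by rewrite mulr0 mul0r mulr0 subr0 normr0; nneg.
have q : 0 < t ^+ 2 + s ^+ 2 by rewrite ltr_wpDl ?sqr_ge0// exprn_gt0.
have -> : (t ^+ 2)^-1 * sd x t - s^-1 * (sd x t * pk s t) =
    (s ^+ 2 / (t ^+ 2 + s ^+ 2)) * ((t ^+ 2)^-1 * sd x t).
  by rewrite /pk; field; rewrite (gt_eqF q) (gt_eqF s0) t0.
rewrite normrM (@ger0_norm _ (_ / _)); last by rewrite divr_ge0 ?sqr_ge0// ltW.
rewrite normrM -powRN2 (ger0_norm (powR_ge0 _ _)).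
have cl : s ^+ 2 / (t ^+ 2 + s ^+ 2) <= s `^ 8^-1 * `|t| `^ (- 8^-1).
  by apply: cutoff_le_powR => //; lra.
have t2 : 0 <= `|t| `^ (- 2%:R) * `|sd x t| by nneg.
rewrite (le_trans (ler_wpM2r t2 cl))//.
rewrite (_ : _ * _ * (_ * _) = s `^ 8^-1 * (`|t| `^ (- (17/8)) * `|sd x t|)); last first.
  rewrite (_ : - (17 / 8) = - 8^-1 + - 2%:R :> R); last by field.
  rewrite [X in _ = _ * (X * _)]powRD; last by apply/implyP => _; rewrite normr_eq0.
  by ring.
rewrite [leRHS](_ : _ = s `^ 8^-1 * (M * pw 8^-1 t)); last by ring.
by rewrite ler_wpM2l ?powR_ge0//; apply: HM => //; lra.
Qed.

Let JE (x : R) : J x = - (2 * pi ^+ 2 * F x).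
Proof.
have [K1 K10 H1] := J_cutoff; have [K2 K20 H2] := rlogpot_first_order.
apply/eqP; rewrite -subr_eq0 opprK -normr_le0.
have p0 := pi_ge0 R.
apply: (@le0_powR_lim _ _ (K1 + 2 * pi * K2) 8^-1) => //; first by nneg.
move=> s s0 s1; have := H1 x s s0; have := H2 x s s0.
have [_ ->] := poisson_sd x s0.
set D := rlogpot F s x - Phi x => e2 e1.
have -> : J x + 2 * pi ^+ 2 * F x =
  (J x - s^-1 * - (2 * pi * D)) - s^-1 * (2 * pi) * (D - pi * s * F x).
  by field; rewrite gt_eqF.
apply: (le_trans (ler_normB _ _)); rewrite [leRHS]mulrDl; apply: lerD => //.
have si : 0 <= s^-1 * (2 * pi) by rewrite mulr_ge0 ?invr_ge0 ?(ltW s0)//; nneg.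
rewrite normrM (ger0_norm si) (le_trans (ler_wpM2l si e2))//.
have -> : s^-1 * (2 * pi) * (K2 * s `^ (5 / 4)) = 2 * pi * K2 * (s^-1 * s `^ (5 / 4)).
  by ring.
apply: ler_wpM2l; first by nneg.
rewrite -(powR_inv1 (ltW s0)) -powRD; last by apply/implyP => _; rewrite gt_eqF.
by apply: powR_le_exp => //; lra.
Qed.

(** The integrand of the truncated principal value in the variable [t = x - y]. *)
Let tr (r x t : R) := if r < `|t| then (t ^+ 2)^-1 * (Phi x - Phi (x - t)) else 0.

Let mif (r : R) (f : R -> R) : measurable_fun setT f ->
  measurable_fun setT (fun t : R => if r < `|t| then f t else 0).
Proof.
move=> mf; apply: measurable_fun_ifT => //.
by apply: (measurable_fun_ltr (f := cst r) (g := fun t : R => `|t|)) => //; exact: mfnorm.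
Qed.

Let itg_tr (r x : R) : 0 < r -> itg (tr r x).
Proof.
move=> r0; have [L L0 HL] := logpot_holder C0 mF FC.
have i4 : 0 < 4^-1 :> R by rewrite invr_gt0.
apply: (itg_dom (g := fun t => (1 + r `^ (- (3 / 4))) * L * pw 4^-1 t)).
- by apply: mif; msolve.
- by apply: itgZ; exact: itg_pw.
move=> t; rewrite /tr; case: ifPn => [rt|_]; last by rewrite normr0; nneg.
have n0 : 0 < `|t| := lt_trans r0 rt.
have tI b : b ==> (`|t| != 0) by apply/implyP => _; rewrite gt_eqF.
have A : `|(t ^+ 2)^-1 * (Phi x - Phi (x - t))| <= L * `|t| `^ (- (3 / 2)).
  rewrite normrM -powRN2 (ger0_norm (powR_ge0 _ _)).
  have := HL x (x - t); rewrite subKr => B.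
  rewrite (le_trans (ler_wpM2l (powR_ge0 _ _) B))// mulrCA -powRD//.
  by rewrite (_ : - 2 + 2^-1 = - (3 / 2) :> R)//; field.
rewrite (le_trans A)// (mulrC _ L) -mulrA ler_wpM2l//.
have p0 := pw_ge0 4^-1 t; have q0 := powR_ge0 r (- (3 / 4)).
have [t1|/ltW t1] := leP `|t| 1.
  rewrite [leRHS]mulrDl mul1r; apply: ler_wpDl => //.
  rewrite (_ : - (3 / 2) = - (3 / 4) + - (3 / 4) :> R); last by field.
  rewrite powRD//; apply: ler_pM; rewrite ?powR_ge0//.
    rewrite !powRN lef_pV2 ?posrE ?powR_gt0//.
    by apply: ge0_ler_powR; rewrite ?nnegrE ?(ltW n0) ?(ltW r0) ?(ltW rt)//; lra.
  rewrite (_ : - (3 / 4) = 4^-1 - 1 :> R); last by field.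
  by apply: pw_near => //; lra.
rewrite [leRHS]mulrDl mul1r; apply: ler_wpDr; first by nneg.
apply: le_trans (pw_far (b := 4^-1) (lexx _) i4 t1).
by apply: ler_powR => //; lra.
Qed.

Let int_tr : exists2 K, 0 <= K & forall x r, 0 < r ->
  `|\int[mu]_t tr r x t - 2^-1 * J x| <= K * r `^ 8^-1.
Proof.
have [M M0 HM] := sd_maj.
exists (2^-1 * (M * \int[mu]_t pw 8^-1 t)).
  by apply: mulr_ge0 => //; apply: mulr_ge0 => //; apply: int_ge0 => t; nneg.
move=> x r r0; have I1 := itg_tr x r0.
have I2 := itg_opp I1.
have E : \int[mu]_t tr r x t = 2^-1 * \int[mu]_t (tr r x t + tr r x (- t)).
  by rewrite (intD I1 I2) -(int_opp (itg_meas I1)); field.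
rewrite E /J -mulrBr -(intB (itgD I1 I2) (itg_sd x)) normrM ger0_norm//.
rewrite -mulrA ler_wpM2l// mulrAC -(intZ _ (itg_pw inv8_gt0)).
apply: int_dom.
- exact: itg_meas (itgB (itgD I1 I2) (itg_sd x)).
- by apply: itgZ; exact: itg_pw.
move=> t; have [->|t0] := eqVneq t 0.
  rewrite /sd subr0 addr0 (_ : 2 * Phi x - Phi x - Phi x = 0); last by ring.
  rewrite /tr oppr0 normr0 ltNge (ltW r0)/= addr0 mulr0 subr0 normr0; nneg.
have n0 : 0 < `|t| by rewrite normr_gt0.
rewrite /tr normrN; case: ifPn => [_|]; last rewrite -leNgt => tr'.
  rewrite (_ : _ + _ - _ = 0) ?normr0; first by nneg.
  by rewrite /sd sqrrN opprK; ring.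
rewrite addr0 sub0r normrN normrM -powRN2 (ger0_norm (powR_ge0 _ _)).
rewrite [leRHS](_ : _ = r `^ 8^-1 * (M * pw 8^-1 t)); last by ring.
have B : `|t| `^ (- (17/8)) * `|sd x t| <= M * pw 8^-1 t by apply: HM => //; lra.
apply: le_trans (ler_wpM2l (powR_ge0 r 8^-1) B); rewrite mulrA ler_wpM2r//.
rewrite (_ : - 2%:R = 8^-1 + - (17 / 8) :> R); last by field.
rewrite powRD; last by apply/implyP => _; rewrite gt_eqF.
rewrite ler_wpM2r ?powR_ge0//.
by apply: ge0_ler_powR; rewrite ?nnegrE ?(ltW n0) ?(ltW r0)// invr_ge0.
Qed.

Context (c : R).
Let u (x : R) := c - pi^-1 * Phi x.

Let m_outside (x r : R) : measurable (outside_ball x r).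
Proof.
have -> : outside_ball x r = (fun y => `|x - y|) @^-1` `]r, +oo[.
  by apply/seteqP; split => y /=; rewrite /outside_ball/= in_itv/= andbT.
rewrite -[X in measurable X]setTI.
have mf : measurable_fun setT (fun y : R => `|x - y|) by msolve.
exact: mf.
Qed.

Let trunc_fun (x r : R) :
  (pv_integrand u x) \_ (outside_ball x r) =
  (fun y => - pi^-1 * tr r x (x - y)).
Proof.
apply/funext => y; rewrite patchE /tr subKr.
have [yi|yi] := boolP (y \in outside_ball x r).
  have yi' : r < `|x - y| by move: yi; rewrite inE.
  by rewrite yi' /pv_integrand /u; ring.
have yi' : ~~ (r < `|x - y|) by apply: contra yi => ?; rewrite inE.
by rewrite (negbTE yi') mulr0.
Qed.

Let itg_trunc (x r : R) : 0 < r ->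
  mu.-integrable (outside_ball x r) (EFin \o pv_integrand u x).
Proof.
move=> r0.
have I : mu.-integrable setT ((EFin \o pv_integrand u x) \_ (outside_ball x r)).
  rewrite restrict_EFin trunc_fun.
  by apply: itgZ; apply: itg_refl; exact: itg_tr.
have m : measurable (outside_ball x r : set (measurableTypeR R)).
  exact: m_outside.
exact: (proj2 (integrable_mkcond _ m) I).
Qed.

Let truncE (x r : R) : 0 < r ->
  pv_truncation u x r = - pi^-1 * \int[mu]_t tr r x t.
Proof.
move=> r0; rewrite /pv_truncation Rintegral_mkcond trunc_fun.
have I := itg_refl x (itg_tr x r0).
by rewrite (intZ _ I) -(int_refl x (itg_tr x r0)).
Qed.

Let trunc_cvg (x : R) : pv_truncation u x r @[r --> 0^'+] --> pi * F x.
Proof.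
have [K K0 HK] := int_tr; have p0 := pi_gt0 R.
apply/cvgrPdist_le => e e0.
have k0 : 0 <= pi^-1 * K by rewrite mulr_ge0// invr_ge0 ltW.
have [d [d0 _ dP]] := powR_small inv8_gt0 k0 e0.
near=> r.
have r0 : 0 < r by near: r; exact: nbhs_right_gt.
have rd : pi^-1 * K * r `^ 8^-1 <= e.
  by apply: dP; [exact: ltW|near: r; exact: nbhs_right_le].
rewrite truncE//; have := HK x r r0; rewrite JE => L.
have -> : pi * F x - - pi^-1 * \int[mu]_t tr r x t =
  pi^-1 * (\int[mu]_t tr r x t - 2^-1 * - (2 * pi ^+ 2 * F x)).
  have : pi != 0 :> R by rewrite gt_eqF.
  by move: (@pi R) (Rintegral _ _ _) => q I q0; field.
rewrite normrM ger0_norm ?invr_ge0 ?(ltW p0)//.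
by apply: le_trans rd; rewrite -[leRHS]mulrA; apply: ler_wpM2l; rewrite ?invr_ge0 ?(ltW p0).
Unshelve. all: end_near. Qed.

(** The principal value is half of the absolutely convergent integral [J] of the
second differences of the potential, and [J] is evaluated by comparing it with
[s^-1] times their Poisson integral at height [s], which is
[- 2 * pi * (rlogpot F s x - Phi x) / s] and tends to [- 2 * pi ^+ 2 * F x]. *)
Theorem half_laplacian_logpot : is_C1loc (fun x => c - pi^-1 * logpot F x) /\
  forall x, half_laplacian_exists (fun x => c - pi^-1 * logpot F x) x /\
    half_laplacian (fun x => c - pi^-1 * logpot F x) x = F x.
Proof.
have du x : isd u x (- (pi^-1 * dlogpot F x)).
  have := dB (d_cst x c) (dM (d_cst x pi^-1) (isdPhi x)).
  by rewrite mul0r !add0r.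
have du1 : derive1 u = fun x => - (pi^-1 * dlogpot F x).
  by apply/funext => x; rewrite derive1E; case: (du x).
have [K K0 HK] := dlogpot_holder C0 H0 mF FC FH.
have p0 := pi_gt0 R.
have HD x y : `|derive1 u x - derive1 u y| <= pi^-1 * K * `|x - y| `^ 4^-1.
  rewrite du1 opprK addrC -mulrBr normrM ger0_norm ?invr_ge0 ?(ltW p0)//.
  by rewrite -mulrA ler_wpM2l ?invr_ge0 ?(ltW p0)// distrC.
split.
  split; last by exists 4^-1; rewrite ?invr_gt0// => M; exists (pi^-1 * K) => x y _ _.
  split; first by move=> x; case: (du x).
  move=> x; apply/cvgrPdist_le => e e0.
  have k0 : 0 <= pi^-1 * K by rewrite mulr_ge0// invr_ge0 ltW.
  have i4 : 0 < 4^-1 :> R by rewrite invr_gt0.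
  have [d [d0 _ dP]] := powR_small i4 k0 e0.
  near=> y; rewrite (le_trans (HD x y))//.
  have yd : `|x - y| <= d by near: y; exact: (@cvgr_dist_le _ R^o _ _ _ id x).
  exact: dP.
move=> x; have T := @trunc_cvg x; split.
  split; first by move=> r r0; exact: itg_trunc.
  by apply/cvg_ex; exists (pi * F x).
by rewrite /half_laplacian (cvg_lim _ T)// mulKf ?gt_eqF.
Unshelve. all: end_near. Qed.

End HalfLaplacianOfPotential.

(** * Trigonometric modes on the line *)

Section TrigModes.
Context {R : realType}.
Notation mu := (@lebesgue_measure R).

(** With [theta = 2 atan y], which maps the line to the circle and the weight
[om] to arc length, these are [cos theta], [sin theta], [cos (2 theta)] and
[sin (2 theta)]. *)
Definition c1 (y : R) := (1 - y ^+ 2) / (1 + y ^+ 2).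
Definition s1 (y : R) := 2 * y / (1 + y ^+ 2).
Definition c2 (y : R) := c1 y ^+ 2 - s1 y ^+ 2.
Definition s2 (y : R) := 2 * c1 y * s1 y.

Lemma c1s1 (y : R) : c1 y ^+ 2 + s1 y ^+ 2 = 1.
Proof. by rewrite /c1 /s1; field; exact: sq1_neq0. Qed.

Lemma isd_s1 (y : R) : isd s1 y (om y * c1 y).
Proof.
rewrite /s1; apply: deq; last by dsolve; exact: sq1_neq0.
by cbv beta; rewrite /om /c1; field; exact: sq1_neq0.
Qed.

Lemma isd_c1 (y : R) : isd c1 y (- (om y * s1 y)).
Proof.
rewrite /c1; apply: deq; last by dsolve; exact: sq1_neq0.
by cbv beta; rewrite /om /s1; field; exact: sq1_neq0.
Qed.

Lemma isd_s2 (y : R) : isd s2 y (2 * (om y * c2 y)).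
Proof.
have d1 := isd_s1 y; have d2 := isd_c1 y.
rewrite /s2; apply: deq; last by dsolve.
by cbv beta; rewrite /c2; ring.
Qed.

Lemma isd_c2 (y : R) : isd c2 y (- (2 * (om y * s2 y))).
Proof.
have d1 := isd_s1 y; have d2 := isd_c1 y.
rewrite /c2; apply: deq; last by dsolve.
by cbv beta; rewrite /s2; ring.
Qed.

Lemma c1_le1 (y : R) : `|c1 y| <= 1.
Proof.
have E := c1s1 y; have := sqr_ge0 (s1 y); have := sqr_ge0 (c1 y).
rewrite ler_norml; move: (c1 y) (s1 y ^+ 2) E => a b; rewrite expr2; nra.
Qed.
Lemma s1_le1 (y : R) : `|s1 y| <= 1.
Proof.
have E := c1s1 y; have := sqr_ge0 (s1 y); have := sqr_ge0 (c1 y).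
rewrite ler_norml; move: (s1 y) (c1 y ^+ 2) E => a b; rewrite expr2; nra.
Qed.
Lemma c2_le1 (y : R) : `|c2 y| <= 1.
Proof.
rewrite /c2; have E := c1s1 y; have := sqr_ge0 (s1 y); have := sqr_ge0 (c1 y).
by rewrite ler_norml; move: (s1 y ^+ 2) (c1 y ^+ 2) E => a b; lra.
Qed.
Lemma s2_le1 (y : R) : `|s2 y| <= 1.
Proof.
rewrite /s2; have E := c1s1 y; have := sqr_ge0 (c1 y - s1 y).
have := sqr_ge0 (c1 y + s1 y); rewrite ler_norml.
by move: E; move: (c1 y) (s1 y) => a b; rewrite !expr2; nra.
Qed.

Lemma c1_meas : measurable_fun setT c1. Proof. by rewrite /c1; msolve. Qed.
Lemma s1_meas : measurable_fun setT s1. Proof. by rewrite /s1; msolve. Qed.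
Lemma c2_meas : measurable_fun setT c2.
Proof. by have := c1_meas; have := s1_meas => ? ?; rewrite /c2; msolve. Qed.
Lemma s2_meas : measurable_fun setT s2.
Proof. by have := c1_meas; have := s1_meas => ? ?; rewrite /s2; msolve. Qed.

(** The two ends of the line correspond to the angle [pi]. *)
Definition ends (f : R -> R) (l : R) :=
  f x @[x --> -oo] --> l /\ f x @[x --> +oo] --> l.

Lemma ends_bnd (C l : R) f : (forall x, 1 <= `|x| -> `|f x - l| <= C * `|x|^-1) ->
  ends f l.
Proof.
move=> H; split.
  by apply: (@cvgNy_inv _ C) => x x1; apply: H; rewrite ler_normr; lra.
apply: (@cvgy_inv _ C) => x x1; have := H x.
by rewrite (ger0_norm (le_trans ler01 x1)); apply.
Qed.

Lemma ends_s1 : ends s1 0.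
Proof.
apply: (@ends_bnd 2) => x x1; have n0 : 0 < `|x| by rewrite (lt_le_trans ltr01).
rewrite subr0 /s1 normrM normfV (gtr0_norm (sq1_gt0 x)) ler_pdivrMr ?sq1_gt0//.
rewrite normrM (@ger0_norm _ 2)// -mulrA ler_pM2l// mulrC ler_pdivlMr//.
by rewrite -(real_normK (num_real x)) -expr2 lerDr.
Qed.

Lemma ends_c1 : ends c1 (-1).
Proof.
apply: (@ends_bnd 2) => x x1; have n0 : 0 < `|x| by rewrite (lt_le_trans ltr01).
rewrite (_ : c1 x - -1 = 2 / (1 + x ^+ 2)); last by rewrite /c1; field; exact: sq1_neq0.
rewrite ger0_norm; last by rewrite divr_ge0// ltW ?sq1_gt0.
rewrite ler_pM2l// lef_pV2 ?posrE ?sq1_gt0// -(real_normK (num_real x)).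
by nra.
Qed.

Lemma endsD f g a b : ends f a -> ends g b -> ends (fun x => f x + g x) (a + b).
Proof. by move=> [f1 f2] [g1 g2]; split; apply: cvgD. Qed.
Lemma endsM f g a b : ends f a -> ends g b -> ends (fun x => f x * g x) (a * b).
Proof. by move=> [f1 f2] [g1 g2]; split; apply: cvgM. Qed.
Lemma endsN f a : ends f a -> ends (fun x => - f x) (- a).
Proof. by move=> [f1 f2]; split; apply: cvgN. Qed.
Lemma ends_cst a : ends (fun=> a) a.
Proof. by split; apply: cvg_cst. Qed.

(** The antiderivative has the same limit at both ends, that is, it is a function
on the circle. *)
Lemma int_exact (A f : R -> R) (l K : R) :
  (forall y, isd A y (om y * f y)) -> (forall y, exists d, isd f y d) ->
  (forall y, `|f y| <= K) -> ends A l ->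
  itg (fun y => f y * om y) /\ \int[mu]_y (f y * om y) = 0.
Proof.
move=> dA df fK [A1 A2].
have cf y : {for y, continuous (fun y => f y * om y)}.
  have [d fd] := df y; exact: d_cont (dM fd (om_derive y)).
have mf : measurable_fun setT (fun y => f y * om y).
  by apply: mfC => y; exact: cf.
have I : itg (fun y => f y * om y).
  apply: (itg_dom mf (itgZ K (@itg_om R))) => y.
  by rewrite normrM (gtr0_norm (om_gt0 y)) ler_pM2r ?om_gt0.
have dA' (y : R) : y != 0 -> isd A y (f y * om y) by rewrite mulrC => _; exact: dA.
split => //.
by rewrite (@ftc_line _ 0 l l _ A I (fun y _ => cf y) dA' (d_cont (dA 0)) A1 A2) subrr.
Qed.

Lemma int_c1 : \int[mu]_y (c1 y * om y) = 0.
Proof.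
apply: (proj2 (@int_exact s1 c1 0 1 isd_s1 _ c1_le1 ends_s1)) => y.
by exists (- (om y * s1 y)); exact: isd_c1.
Qed.

Lemma int_s1 : \int[mu]_y (s1 y * om y) = 0.
Proof.
apply: (proj2 (@int_exact (fun y => - c1 y) s1 (- -1) 1 _ _ s1_le1 _)).
- by move=> y; rewrite -[X in isd _ _ X]opprK; exact: dN (isd_c1 y).
- by move=> y; exists (om y * c1 y); exact: isd_s1.
- exact: endsN ends_c1.
Qed.

Lemma itg_bnd_om (h : R -> R) (M : R) : measurable_fun setT h ->
  (forall y, `|h y| <= M) -> itg (fun y => h y * om y).
Proof.
move=> mh hM; apply: (itg_dom _ (itgZ M (@itg_om R))).
  by have := @om_meas R => ?; msolve.
by move=> y; rewrite normrM (gtr0_norm (om_gt0 y)) ler_pM2r ?om_gt0.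
Qed.

Lemma int_c2 : \int[mu]_y (c2 y * om y) = 0.
Proof.
have d y : isd (fun y => 2^-1 * s2 y) y (om y * c2 y).
  have := isd_s2 y => ?; apply: deq; last by dsolve.
  by cbv beta; field.
apply: (proj2 (@int_exact _ c2 _ 1 d _ c2_le1 _)).
  by move=> y; exists (- (2 * (om y * s2 y))); exact: isd_c2.
by apply: endsM (ends_cst _) (endsM (endsM (ends_cst _) ends_c1) ends_s1).
Qed.

Lemma int_s2 : \int[mu]_y (s2 y * om y) = 0.
Proof.
have d y : isd (fun y => - (2^-1 * c2 y)) y (om y * s2 y).
  have := isd_c2 y => ?; apply: deq; last by dsolve.
  by cbv beta; field.
apply: (proj2 (@int_exact _ s2 _ 1 d _ s2_le1 _)).
  by move=> y; exists (2 * (om y * c2 y)); exact: isd_s2.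
have E : ends c2 (-1 * -1 + - (0 * 0)).
  exact: endsD (endsM ends_c1 ends_c1) (endsN (endsM ends_s1 ends_s1)).
exact: endsN (endsM (ends_cst _) E).
Qed.

(** Odd powers of a first mode have zero mean on the circle; the antiderivatives
[A] are cubic polynomials in [c1] and [s1]. *)
Lemma int_cubic (a b : R) :
  \int[mu]_y ((a * c1 y + b * s1 y) ^+ 2 * c1 y * om y) = 0 /\
  \int[mu]_y ((a * c1 y + b * s1 y) ^+ 2 * s1 y * om y) = 0.
Proof.
have bd (y : R) : `|(a * c1 y + b * s1 y) ^+ 2| <= (`|a| + `|b|) ^+ 2.
  rewrite normrX ler_pXn2r ?nnegrE ?addr_ge0// (le_trans (ler_normD _ _))//.
  rewrite (normrM a) (normrM b); apply: lerD; rewrite ler_piMr//.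
  - exact: c1_le1.
  - exact: s1_le1.
split.
- pose A y := a ^+ 2 * (s1 y - 3^-1 * s1 y ^+ 3) - a * b * (2 / 3) * c1 y ^+ 3 +
     b ^+ 2 * (3^-1 * s1 y ^+ 3).
  have d y : isd A y (om y * ((a * c1 y + b * s1 y) ^+ 2 * c1 y)).
    have := isd_s1 y; have := isd_c1 y => ? ?; rewrite /A; apply: deq; last by dsolve.
    cbv beta; have E : c1 y ^+ 2 = 1 - s1 y ^+ 2 by rewrite -(c1s1 y) addrK.
    rewrite [RHS](_ : _ = om y * (a ^+ 2 * c1 y * (1 - s1 y ^+ 2) + 2 * a * b * c1 y ^+ 2 * s1 y
      + b ^+ 2 * s1 y ^+ 2 * c1 y)); last by rewrite -E; ring.
    by field.
  apply: (proj2 (@int_exact A _ _ ((`|a| + `|b|) ^+ 2 * 1) d _ _ _)).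
  + move=> y; have := isd_s1 y; have := isd_c1 y => ? ?; eexists; dsolve.
  + by move=> y; rewrite normrM; apply: ler_pM => //; exact: c1_le1.
  + apply: endsD; first apply: endsD.
    * apply: endsM (ends_cst _) (endsD ends_s1 (endsN (endsM (ends_cst _) _))).
      exact: endsM ends_s1 (endsM ends_s1 ends_s1).
    * apply: endsN; apply: endsM (ends_cst _) _.
      exact: endsM ends_c1 (endsM ends_c1 ends_c1).
    * apply: endsM (ends_cst _) (endsM (ends_cst _) _).
      exact: endsM ends_s1 (endsM ends_s1 ends_s1).
pose A y := - (a ^+ 2 * (3^-1 * c1 y ^+ 3)) + a * b * (2 / 3) * s1 y ^+ 3 +
   b ^+ 2 * (3^-1 * c1 y ^+ 3 - c1 y).
have d y : isd A y (om y * ((a * c1 y + b * s1 y) ^+ 2 * s1 y)).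
  have := isd_s1 y; have := isd_c1 y => ? ?; rewrite /A; apply: deq; last by dsolve.
  cbv beta; have E : s1 y ^+ 2 = 1 - c1 y ^+ 2 by rewrite -(c1s1 y) addrC addKr.
  rewrite [RHS](_ : _ = om y * (a ^+ 2 * c1 y ^+ 2 * s1 y + 2 * a * b * s1 y ^+ 2 * c1 y
    + b ^+ 2 * (1 - c1 y ^+ 2) * s1 y)); last by rewrite -E; ring.
  by field.
apply: (proj2 (@int_exact A _ _ ((`|a| + `|b|) ^+ 2 * 1) d _ _ _)).
+ move=> y; have := isd_s1 y; have := isd_c1 y => ? ?; eexists; dsolve.
+ by move=> y; rewrite normrM; apply: ler_pM => //; exact: s1_le1.
+ apply: endsD; first apply: endsD.
  * apply: endsN; apply: endsM (ends_cst _) (endsM (ends_cst _) _).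
    exact: endsM ends_c1 (endsM ends_c1 ends_c1).
  * apply: endsM (ends_cst _) _.
    exact: endsM ends_s1 (endsM ends_s1 ends_s1).
  * apply: endsM (ends_cst _) (endsD (endsM (ends_cst _) _) (endsN ends_c1)).
    exact: endsM ends_c1 (endsM ends_c1 ends_c1).
Qed.

Lemma int_quadratic : [/\ \int[mu]_y (c1 y * c1 y * om y) = pi,
  \int[mu]_y (s1 y * s1 y * om y) = pi & \int[mu]_y (c1 y * s1 y * om y) = 0].
Proof.
have I2 := itg_bnd_om c2_meas c2_le1; have Io := @itg_om R.
have E1 (y : R) : c1 y * c1 y * om y = 2^-1 * om y + 2^-1 * (c2 y * om y).
  have E : s1 y ^+ 2 = 1 - c1 y ^+ 2 by rewrite -(c1s1 y) addrC addKr.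
  by rewrite /c2 E; field.
have E2 (y : R) : s1 y * s1 y * om y = 2^-1 * om y - 2^-1 * (c2 y * om y).
  have E : c1 y ^+ 2 = 1 - s1 y ^+ 2 by rewrite -(c1s1 y) addrK.
  by rewrite /c2 E; field.
have E3 (y : R) : c1 y * s1 y * om y = 2^-1 * (s2 y * om y) by rewrite /s2; field.
split.
- rewrite (eq_int E1) (intD (itgZ _ Io) (itgZ _ I2)) (intZ _ Io) (intZ _ I2).
  by rewrite int_om int_c2 mulr0 addr0 mulKf.
- rewrite (eq_int E2) (intB (itgZ _ Io) (itgZ _ I2)) (intZ _ Io) (intZ _ I2).
  by rewrite int_om int_c2 mulr0 subr0 mulKf.
- rewrite (eq_int E3) (intZ _ (itg_bnd_om s2_meas s2_le1)) int_s2 mulr0//.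
Qed.

End TrigModes.

(** * The logarithmic kernel on the modes *)

Section LogModes.
Context {R : realType}.
Notation mu := (@lebesgue_measure R).

Lemma ends_eq (x l : R) f g : (forall y, y != x -> f y = g y) -> ends f l -> ends g l.
Proof.
move=> fg [f1 f2]; split.
- apply: cvg_trans f1; apply: near_eq_cvg; near=> y; apply: fg.
  by rewrite lt_eqF//; near: y; apply: nbhs_ninfty_lt; exact: num_real.
- apply: cvg_trans f2; apply: near_eq_cvg; near=> y; apply: fg.
  by rewrite gt_eqF//; near: y; apply: nbhs_pinfty_gt; exact: num_real.
Unshelve. all: end_near. Qed.

Lemma ends_comp (l : R) f (g : R -> R) : ends f l -> {for l, continuous g} ->
  ends (fun x => g (f x)) (g l).
Proof.
move=> [f1 f2] cg; split.
- exact: (cvg_comp f g f1 cg).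
- exact: (cvg_comp f g f2 cg).
Qed.

(** Off the diagonal, [lD x y] is the logarithm of
[2 (x - y)^2 / ((1 + x^2) (1 + y^2))]. *)
Definition lD (x y : R) :=
  ln (2 / (1 + x ^+ 2)) + ln ((x - y) ^+ 2) - ln (1 + y ^+ 2).

Lemma sqB_gt0 (x y : R) : y != x -> 0 < (x - y) ^+ 2.
Proof. by move=> yx; rewrite exprn_even_gt0//= subr_eq0 eq_sym. Qed.

Lemma ends_lD (x : R) : ends (lD x) (ln (2 / (1 + x ^+ 2))).
Proof.
pose g y := ln (2 / (1 + x ^+ 2)) + ln ((x - y) ^+ 2 / (1 + y ^+ 2)).
apply: (@ends_eq x _ g).
  move=> y yx; rewrite /g /lD -addrA; congr (_ + _).
  by rewrite ln_div ?posrE ?sq1_gt0// sqB_gt0.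
rewrite -[X in ends _ X]addr0 -(@ln1 R).
apply: endsD; first exact: ends_cst.
apply: (@ends_comp 1 (fun y => (x - y) ^+ 2 / (1 + y ^+ 2)) (@ln R)); last first.
  exact: continuous_ln.
apply: (@ends_bnd _ (`|x ^+ 2 - 1| + 2 * `|x|)) => y y1.
have n0 : 0 < `|y| by rewrite (lt_le_trans ltr01).
rewrite (_ : _ - 1 = (x ^+ 2 - 1 - 2 * x * y) / (1 + y ^+ 2)); last first.
  by field; exact: sq1_neq0.
rewrite normrM normfV (gtr0_norm (sq1_gt0 y)) ler_pdivrMr ?sq1_gt0//.
have yle : `|y| <= `|y|^-1 * (1 + y ^+ 2).
  by rewrite ler_pdivlMl// -(real_normK (num_real y)) -expr2 lerDr.
apply: (@le_trans _ _ ((`|x ^+ 2 - 1| + 2 * `|x|) * `|y|)); last first.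
  by rewrite -mulrA ler_wpM2l// addr_ge0// mulr_ge0.
apply: le_trans (ler_normB _ _) _; rewrite [leRHS]mulrDl; apply: lerD.
  by rewrite ler_peMr.
by rewrite (normrM (2 * x)) (normrM 2 x) (@ger0_norm _ 2).
Qed.

Lemma lD_derive (x y : R) : y != x ->
  isd (lD x) y (2 / (y - x) - 2 * y / (1 + y ^+ 2)).
Proof.
move=> yx; have p := sqB_gt0 yx; have q := sq1_gt0 y.
rewrite /lD; apply: deq; last by dsolve.
cbv beta; rewrite ?expr0 ?expr1; field.
by rewrite sq1_neq0 !subr_eq0 (eq_sym x) yx.
Qed.

Lemma lD_meas2 : measurable_fun setT (fun z : R * R => lD z.1 z.2).
Proof. by rewrite /lD; msolve. Qed.

Lemma lD_meas (x : R) : measurable_fun setT (lD x).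
Proof. by rewrite /lD; msolve. Qed.

Lemma lD_sym (x y : R) : y != x -> lD x y = lD y x.
Proof.
move=> yx; rewrite /lD !ln_div ?posrE ?sq1_gt0//.
by rewrite (_ : (y - x) ^+ 2 = (x - y) ^+ 2); ring.
Qed.

Definition lDmaj (x y : R) := `|ln (2 / (1 + x ^+ 2))| * om y + 2 * logmaj x y +
  4 * (`|y| `^ 2^-1 * om y).

Lemma ln_sqr (z : R) : ln (z ^+ 2) = 2 * ln `|z|.
Proof.
have [->|z0] := eqVneq z 0; first by rewrite normr0 expr0n/= ln0// mulr0.
by rewrite -(real_normK (num_real z)) lnXn ?normr_gt0// mulr_natl.
Qed.

Lemma lD_le (x y : R) : `|lD x y| * om y <= lDmaj x y.
Proof.
have o0 := ltW (om_gt0 y).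
rewrite /lD /lDmaj (le_trans (ler_wpM2r o0 (ler_normB _ _)))// [leLHS]mulrDl; apply: lerD.
  rewrite (le_trans (ler_wpM2r o0 (ler_normD _ _)))// [leLHS]mulrDl lerD2l.
  by rewrite ln_sqr normrM (@ger0_norm _ 2)// -mulrA ler_pM2l// log_om_le.
rewrite mulrA ler_wpM2r// ger0_norm; last by rewrite ln_ge0// lerDl sqr_ge0.
by rewrite -(real_normK (num_real y)) ln1_quarter.
Qed.

Lemma itg_lDmaj (x : R) : itg (lDmaj x).
Proof.
by apply: itgD; [apply: itgD|]; apply: itgZ; [exact: itg_om|exact: itg_logmaj|exact: itg_powR_om].
Qed.

Lemma lD_bnd_le (h : R -> R) (M x y : R) : (forall z, `|h z| <= M) ->
  `|lD x y * (h y * om y)| <= M * lDmaj x y.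
Proof.
move=> hM; have M0 : 0 <= M by exact: le_trans (hM 0).
rewrite mulrCA normrM; apply: ler_pM => //.
by rewrite normrM (gtr0_norm (om_gt0 y)) lD_le.
Qed.

Lemma itg_lD (h : R -> R) (M x : R) : measurable_fun setT h ->
  (forall z, `|h z| <= M) -> itg (fun y => lD x y * (h y * om y)).
Proof.
move=> mh hM; have := lD_meas x => ml; have := @om_meas R => mo.
apply: (itg_dom _ (itgZ M (itg_lDmaj x))); first by msolve.
by move=> y; exact: lD_bnd_le.
Qed.

(* The increment of [S] is Lipschitz and absorbs the logarithm. *)
Let log_mode_cont (T S Q q : R -> R) (x : R) :
  (forall y, isd S y (om y * T y)) -> (forall y, isd Q y (om y * q y)) ->
  (forall y, `|T y| <= 1) ->
  {for x, continuous (fun y => (S y - S x) * lD x y - Q y)}.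
Proof.
move=> dS dQ T1; set L := ln (2 / (1 + x ^+ 2)).
have cR : {for x, continuous (fun y => (S y - S x) * (L - ln (1 + y ^+ 2)) - Q y)}.
  have d1 := dS x; have d2 := dQ x; have q1 := sq1_gt0 x.
  apply: (@d_cont _ _ x); dsolve.
have cB : {for x, continuous (fun y => (S y - S x) * (2 * ln `|x - y|))}.
  apply/cvgrPdist_le => e e0.
  have [d [d0 d1 dP]] := powR_small (@inv2_gt0 R) (ler0n R 8) e0.
  near=> y; cbv beta; rewrite (subrr (S x)) mul0r sub0r normrN.
  have [->|yx] := eqVneq y x; first by rewrite subrr mul0r normr0 ltW.
  have n0 : 0 < `|x - y| by rewrite normr_gt0 subr_eq0 eq_sym.
  have xd : `|x - y| <= d.
    by near: y; apply/nbhs_ballP; exists d => //= z; rewrite /ball/= => /ltW.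
  have n1 : `|x - y| <= 1 by exact: le_trans xd d1.
  have [c _ ->] := mvt x y dS.
  rewrite (normrM _ (2 * _)) (normrM _ (y - x)) (normrM (om c)) (normrM 2).
  rewrite (@ger0_norm _ 2)// (gtr0_norm (om_gt0 c)).
  have l1 : `|ln `|x - y| | <= 2 * `|x - y| `^ (- 2^-1).
    by rewrite ler0_norm ?ln_le0//; exact: lnN_le_powR.
  have h2 : `|x - y| * `|x - y| `^ (- 2^-1) = `|x - y| `^ 2^-1.
    by rewrite -{1}(powR_half_sqr (ltW n0)) powRN mulfK// gt_eqF// powR_gt0.
  apply: (@le_trans _ _ (2 * 1 * `|x - y| * (2 * (2 * `|x - y| `^ (- 2^-1))))).
    apply: ler_pM; [by nneg|by nneg| |exact: ler_wpM2l l1].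
    rewrite (distrC y) ler_pM2r//; apply: ler_pM; [by nneg|by nneg|exact: om_le2|exact: T1].
  rewrite (_ : _ * _ = 8 * (`|x - y| * `|x - y| `^ (- 2^-1))); last by ring.
  by rewrite h2; exact: dP.
rewrite (_ : (fun y => _) = fun y => ((S y - S x) * (L - ln (1 + y ^+ 2)) - Q y) +
  (S y - S x) * (2 * ln `|x - y|)).
  exact: cvgD cR cB.
by apply/funext => y; rewrite /lD ln_sqr -/L; ring.
Unshelve. all: end_near. Qed.

(** The derivative of [(S y - S x) * lD x y - Q y] is the integrand, because [q]
absorbs the term in which the logarithm is differentiated; subtracting [S x]
makes this antiderivative continuous at the singular point [x]. *)
Lemma log_mode (T S Q q : R -> R) (x l r1 r2 : R) :
  (forall y, isd S y (om y * T y)) -> (forall y, isd Q y (om y * q y)) ->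
  (forall y, `|T y| <= 1) -> (forall y, exists d, isd T y d) ->
  (forall y, y != x ->
     (S y - S x) * (2 / (y - x) - 2 * y / (1 + y ^+ 2)) = om y * q y) ->
  ends S l -> Q y @[y --> -oo] --> r1 -> Q y @[y --> +oo] --> r2 ->
  \int[mu]_y (lD x y * (T y * om y)) = r1 - r2.
Proof.
move=> dS dQ T1 dT H eS Q1 Q2.
have mT : measurable_fun setT T by apply: mfC => y; have [d /d_cont] := dT y.
have I := itg_lD x mT T1.
pose A y := (S y - S x) * lD x y - Q y.
have dA y : y != x -> isd A y (lD x y * (T y * om y)).
  move=> yx; have d1 := dS y; have d2 := dQ y; have d3 := lD_derive yx.
  rewrite /A; apply: deq; last by dsolve.
  by cbv beta; rewrite H//; ring.
have cf y : y != x -> {for y, continuous (fun y => lD x y * (T y * om y))}.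
  move=> yx; have d3 := lD_derive yx; have [d d1] := dT y.
  exact: d_cont (dM d3 (dM d1 (om_derive y))).
set L := ln (2 / (1 + x ^+ 2)).
have [A1 A2] : ends (fun y => (S y - S x) * lD x y) ((l - S x) * L).
  by apply: endsM; [apply: endsD => //; exact: ends_cst|exact: ends_lD].
have cA : {for x, continuous A}.
  exact: log_mode_cont.
rewrite (@ftc_line _ x ((l - S x) * L - r1) ((l - S x) * L - r2) _ A I cf dA cA).
- by ring.
- exact: cvgB.
- exact: cvgB.
Qed.

(** The angle [2 atan y] gains [2 pi] along the line, while [P] is periodic; the
mean [a] of [q] is all that remains. The four instances below express that the
modes of the circle are eigenfunctions of its logarithmic kernel. *)
Lemma log_mode_mean (T S P q : R -> R) (x l p a : R) :
  (forall y, isd S y (om y * T y)) -> (forall y, isd P y (om y * (q y - a))) ->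
  (forall y, `|T y| <= 1) -> (forall y, exists d, isd T y d) ->
  (forall y, y != x ->
     (S y - S x) * (2 / (y - x) - 2 * y / (1 + y ^+ 2)) = om y * q y) ->
  ends S l -> ends P p ->
  \int[mu]_y (lD x y * (T y * om y)) = - (2 * pi * a).
Proof.
move=> dS dP T1 dT H eS [P1 P2].
rewrite (@log_mode T S (fun y => P y + a * (2 * atan y)) q x l
  (p + a * (2 * - (pi / 2))) (p + a * (2 * (pi / 2))))//.
- by move: (@pi R) => w; field.
- move=> y; apply: deq; last exact: (dD (dP y) (dM (d_cst y a) (om_atan y))).
  by rewrite /cst; ring.
- apply: cvgD P1 _; apply: cvgM; first exact: cvg_cst.
  by apply: cvgM; [exact: cvg_cst|exact: cvgNy_atan].
- apply: cvgD P2 _; apply: cvgM; first exact: cvg_cst.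
  by apply: cvgM; [exact: cvg_cst|exact: cvgy_atan].
Qed.

Lemma int_lD_c1 x : \int[mu]_y (lD x y * (c1 y * om y)) = - (2 * pi * c1 x).
Proof.
apply: (@log_mode_mean c1 s1 s1 (fun y => c1 y + c1 x) x 0 0).
- exact: isd_s1.
- by move=> y; rewrite addrK; exact: isd_s1.
- exact: c1_le1.
- by move=> y; eexists; exact: isd_c1.
- move=> y yx; rewrite /s1 /om /c1; field.
  by rewrite !sq1_neq0 subr_eq0 yx.
- exact: ends_s1.
- exact: ends_s1.
Qed.

Let isd_Nc1 (y : R) : isd (fun y => - c1 y) y (om y * s1 y).
Proof. by apply: deq; last exact: dN (isd_c1 y); rewrite opprK. Qed.

Lemma int_lD_s1 x : \int[mu]_y (lD x y * (s1 y * om y)) = - (2 * pi * s1 x).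
Proof.
apply: (@log_mode_mean s1 (fun y => - c1 y) (fun y => - c1 y)
  (fun y => s1 y + s1 x) x (- -1) (- -1)).
- exact: isd_Nc1.
- by move=> y; rewrite addrK; exact: isd_Nc1.
- exact: s1_le1.
- by move=> y; eexists; exact: isd_s1.
- move=> y yx; rewrite /s1 /om /c1; field.
  by rewrite !sq1_neq0 subr_eq0 yx.
- exact: endsN ends_c1.
- exact: endsN ends_c1.
Qed.

Let ends_s2 : ends (@s2 R) (2 * -1 * 0).
Proof. exact: endsM (endsM (ends_cst _) ends_c1) ends_s1. Qed.

Let ends_c2 : ends (@c2 R) (-1 * -1 + - (0 * 0)).
Proof. exact: endsD (endsM ends_c1 ends_c1) (endsN (endsM ends_s1 ends_s1)). Qed.

Lemma int_lD_c2 x : \int[mu]_y (lD x y * (c2 y * om y)) = - (pi * c2 x).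
Proof.
rewrite (@log_mode_mean c2 (fun y => 2^-1 * s2 y)
  (fun y => (s1 y * c1 x + c1 y * s1 x) + 4^-1 * s2 y)
  (fun y => (c1 y * c1 x - s1 y * s1 x) + 2^-1 * (c2 y + c2 x)) x
  (2^-1 * (2 * -1 * 0)) (0 * c1 x + -1 * s1 x + 4^-1 * (2 * -1 * 0)) (2^-1 * c2 x)).
- by move: (@pi R) => w; field.
- move=> y; have d1 := isd_s2 y; apply: deq; last by dsolve.
  by cbv beta; field.
- move=> y; have d1 := isd_s2 y; have d2 := isd_s1 y; have d3 := isd_c1 y.
  apply: deq; last by dsolve.
  by cbv beta; field.
- exact: c2_le1.
- by move=> y; eexists; exact: isd_c2.
- move=> y yx; rewrite /s2 /c2 /s1 /om /c1; field.
  by rewrite !sq1_neq0 subr_eq0 yx.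
- exact: endsM (ends_cst _) ends_s2.
- exact: endsD (endsD (endsM ends_s1 (ends_cst _)) (endsM ends_c1 (ends_cst _)))
    (endsM (ends_cst _) ends_s2).
Qed.

Lemma int_lD_s2 x : \int[mu]_y (lD x y * (s2 y * om y)) = - (pi * s2 x).
Proof.
rewrite (@log_mode_mean s2 (fun y => - (2^-1 * c2 y))
  (fun y => (s1 y * s1 x + - (c1 y * c1 x)) + - (4^-1 * c2 y))
  (fun y => (s1 y * c1 x + c1 y * s1 x) + 2^-1 * (s2 y + s2 x)) x
  (- (2^-1 * (-1 * -1 + - (0 * 0))))
  (0 * s1 x + - (-1 * c1 x) + - (4^-1 * (-1 * -1 + - (0 * 0)))) (2^-1 * s2 x)).
- by move: (@pi R) => w; field.
- move=> y; have d1 := isd_c2 y; apply: deq; last by dsolve.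
  by cbv beta; field.
- move=> y; have d1 := isd_c2 y; have d2 := isd_s1 y; have d3 := isd_c1 y.
  apply: deq; last by dsolve.
  by cbv beta; field.
- exact: s2_le1.
- by move=> y; eexists; exact: isd_s2.
- move=> y yx; rewrite /s2 /c2 /s1 /om /c1; field.
  by rewrite !sq1_neq0 subr_eq0 yx.
- exact: endsN (endsM (ends_cst _) ends_c2).
- exact: endsD (endsD (endsM ends_s1 (ends_cst _)) (endsN (endsM ends_c1 (ends_cst _))))
    (endsN (endsM (ends_cst _) ends_c2)).
Qed.

Lemma itg_ln1_om : itg (fun y : R => ln (1 + y ^+ 2) * om y).
Proof.
have := @om_meas R => mo.
apply: (itg_dom (g := fun y => 4 * (`|y| `^ 2^-1 * om y))).
- by msolve.
- by apply: itgZ; exact: itg_powR_om.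
move=> y; rewrite normrM (gtr0_norm (om_gt0 y)) mulrA ler_pM2r ?om_gt0//.
rewrite ger0_norm; last by rewrite ln_ge0// lerDl sqr_ge0.
by rewrite -(real_normK (num_real y)) ln1_quarter.
Qed.

Lemma itg_ln1 (h : R -> R) (M : R) : measurable_fun setT h ->
  (forall y, `|h y| <= M) -> itg (fun y : R => ln (1 + y ^+ 2) * (h y * om y)).
Proof.
move=> mh hM; have := @om_meas R => mo.
apply: (itg_dom (g := fun y => M * (ln (1 + y ^+ 2) * om y))).
- by msolve.
- by apply: itgZ; exact: itg_ln1_om.
have l0 (y : R) : 0 <= ln (1 + y ^+ 2) by rewrite ln_ge0// lerDl sqr_ge0.
move=> y; rewrite mulrCA normrM; apply: ler_pM => //.
by rewrite normrM (gtr0_norm (om_gt0 y)) ger0_norm.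
Qed.

Lemma int_lD (h : R -> R) (M x : R) : measurable_fun setT h ->
  (forall y, `|h y| <= M) ->
  \int[mu]_y (lD x y * (h y * om y)) =
  ln (2 / (1 + x ^+ 2)) * (\int[mu]_y (h y * om y)) +
  2 * logpot (fun y => h y * om y) x -
  \int[mu]_y (ln (1 + y ^+ 2) * (h y * om y)).
Proof.
move=> mh hM; have := @om_meas R => mo.
have M0 : 0 <= M by exact: le_trans (hM 0).
have I1 := itg_bnd_om mh hM.
have mF : measurable_fun setT (fun y => h y * om y) by msolve.
have FM (y : R) : `|h y * om y| <= M * om y.
  by rewrite normrM (gtr0_norm (om_gt0 y)) ler_pM2r ?om_gt0.
have I2 := @itg_logpot _ _ _ M0 mF FM x.
have I3 := itg_ln1 mh hM.
rewrite (eq_int (g := fun y => ln (2 / (1 + x ^+ 2)) * (h y * om y) +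
  2 * (ln `|x - y| * (h y * om y)) - ln (1 + y ^+ 2) * (h y * om y))).
  by rewrite (intB (itgD (itgZ _ I1) (itgZ _ I2)) I3) (intD (itgZ _ I1) (itgZ _ I2)) !intZ.
by move=> y; rewrite /lD ln_sqr; ring.
Qed.

(** On constants, by the potential of the bubble density. *)
Lemma int_lD_1 x : \int[mu]_y (lD x y * (1 * om y)) = - (2 * pi * ln 2) :> R.
Proof.
rewrite (@int_lD (fun=> 1) 1)//; last by rewrite normr1.
have -> : \int[mu]_y (1 * om y) = 2 * pi :> R.
  by rewrite -int_om; apply: eq_int => y; rewrite mul1r.
have -> : logpot (fun y => 1 * om y) x = logpot om x.
  by rewrite /logpot; apply: eq_int => y; rewrite mul1r.
rewrite logpot_om.
have -> : \int[mu]_y (ln (1 + y ^+ 2) * (1 * om y)) = 2 * (pi * ln 4).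
  have := @rlogpot_om R 0 1 ltr01; rewrite /rlogpot expr0n/= addr0.
  rewrite (_ : (1 + 1) ^+ 2 = 4); last by ring.
  move=> <-; rewrite -intZ.
    by apply: eq_int => y; rewrite sub0r sqrrN expr1n addrC; field.
  have := itgZ 2^-1 itg_ln1_om; apply: eq_itg => y.
  by rewrite sub0r sqrrN expr1n addrC mulrA.
rewrite ln_div ?posrE ?sq1_gt0// (_ : 4 = 2 ^+ 2); last by ring.
by rewrite lnXn// -mulr_natl; move: (@pi R) => w; ring.
Qed.

End LogModes.

(** * The integral operator *)

Section InnerProduct.
Context {R : realType}.
Notation mu := (@lebesgue_measure R).
Implicit Types (f g h : R -> R).

(** The bounded measurable functions, the only ones that occur as unknowns. *)
Definition bdm f := measurable_fun setT f /\ exists M, forall y, `|f y| <= M.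

Lemma bdm_le f M : measurable_fun setT f -> (forall y, `|f y| <= M) -> bdm f.
Proof. by move=> mf fM; split => //; exists M. Qed.
Lemma bdm_cst a : bdm (fun=> a).
Proof. by apply: (@bdm_le _ `|a|). Qed.
Lemma bdmD f g : bdm f -> bdm g -> bdm (fun y => f y + g y).
Proof.
move=> [mf [A fA]] [mg [B gB]]; apply: (@bdm_le _ (A + B)); first by msolve.
by move=> y; rewrite (le_trans (ler_normD _ _))// lerD.
Qed.
Lemma bdmM f g : bdm f -> bdm g -> bdm (fun y => f y * g y).
Proof.
move=> [mf [A fA]] [mg [B gB]]; apply: (@bdm_le _ (A * B)); first by msolve.
by move=> y; rewrite normrM ler_pM.
Qed.
Lemma bdmN f : bdm f -> bdm (fun y => - f y).
Proof.
move=> [mf [A fA]]; apply: (@bdm_le _ A); first by msolve.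
by move=> y; rewrite normrN.
Qed.
Lemma bdmX f n : bdm f -> bdm (fun y => f y ^+ n).
Proof.
move=> [mf [A fA]]; apply: (@bdm_le _ (A ^+ n)); first by msolve.
by move=> y; rewrite normrX lerXn2r ?nnegrE// (le_trans _ (fA y)).
Qed.
Lemma bdm_c1 : bdm c1. Proof. exact: bdm_le c1_meas c1_le1. Qed.
Lemma bdm_s1 : bdm s1. Proof. exact: bdm_le s1_meas s1_le1. Qed.
Lemma bdm_c2 : bdm c2. Proof. exact: bdm_le c2_meas c2_le1. Qed.
Lemma bdm_s2 : bdm s2. Proof. exact: bdm_le s2_meas s2_le1. Qed.

Lemma itg_bdm f : bdm f -> itg (fun y => f y * om y).
Proof. by move=> [mf [M fM]]; exact: itg_bnd_om mf fM. Qed.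

End InnerProduct.

(** Proves [bdm] by following the syntax of a real expression. *)
Ltac bsolve := cbv beta;
  repeat first [ assumption | exact: bdm_cst | exact: bdm_c1 | exact: bdm_s1 |
  exact: bdm_c2 | exact: bdm_s2 |
  lazymatch goal with
  | |- bdm (fun x => @?f x + @?g x) => refine (@bdmD _ f g _ _)
  | |- bdm (fun x => @?f x * @?g x) => refine (@bdmM _ f g _ _)
  | |- bdm (fun x => - @?f x) => refine (@bdmN _ f _)
  | |- bdm (fun x => @?f x ^+ ?n) => refine (@bdmX _ f n _)
  end ].

Section InnerProduct2.
Context {R : realType}.
Notation mu := (@lebesgue_measure R).
Implicit Types (f g h : R -> R).

(** The inner product of [L^2] of the circle, normalised so that the first and
second modes have norm one. *)
Definition ip f g := pi^-1 * \int[mu]_y (f y * g y * om y).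

Lemma ipC f g : ip f g = ip g f.
Proof. by rewrite /ip; congr (_ * _); apply: eq_int => y; rewrite (mulrC (f y)). Qed.

Lemma ipM f g h : ip (fun y => f y * g y) h = ip f (fun y => g y * h y).
Proof. by rewrite /ip; congr (_ * _); apply: eq_int => y; rewrite !mulrA. Qed.

Lemma eq_ip f g h : f =1 g -> ip f h = ip g h.
Proof. by move=> /funext ->. Qed.

Lemma ipD f g h : bdm f -> bdm g -> bdm h ->
  ip (fun y => f y + g y) h = ip f h + ip g h.
Proof.
move=> bf bg bh; rewrite /ip -mulrDr -intD; [|by apply: itg_bdm; bsolve|by apply: itg_bdm; bsolve].
by congr (_ * _); apply: eq_int => y; rewrite !mulrDl.
Qed.

Lemma ipZ k f h : bdm f -> bdm h -> ip (fun y => k * f y) h = k * ip f h.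
Proof.
move=> bf bh; rewrite /ip [RHS]mulrCA -(intZ k); last by apply: itg_bdm; bsolve.
by congr (_ * _); apply: eq_int => y; rewrite !mulrA.
Qed.

Lemma ipB f g h : bdm f -> bdm g -> bdm h ->
  ip (fun y => f y - g y) h = ip f h - ip g h.
Proof.
move=> bf bg bh; rewrite /ip -mulrBr -intB; [|by apply: itg_bdm; bsolve|by apply: itg_bdm; bsolve].
by congr (_ * _); apply: eq_int => y; rewrite !mulrBl.
Qed.

Lemma ip_le f g A B : bdm f -> bdm g -> (forall y, `|f y| <= A) ->
  (forall y, `|g y| <= B) -> `|ip f g| <= 2 * A * B.
Proof.
move=> [mf _] [mg _] fA gB.
have mo := @om_meas R.
rewrite /ip normrM ger0_norm ?invr_ge0 ?pi_ge0// ler_pdivrMl ?pi_gt0//.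
rewrite (_ : pi * _ = \int[mu]_y (A * B * om y)); last first.
  by rewrite intZ ?int_om ?itg_om//; ring.
apply: int_dom; [by msolve|by apply: itgZ; exact: itg_om|].
move=> y; rewrite normrM (gtr0_norm (om_gt0 y)) ler_pM2r ?om_gt0//.
by rewrite normrM; apply: ler_pM.
Qed.

Let bdm1 : bdm (fun=> 1 : R). Proof. exact: bdm_cst. Qed.

Lemma ip11 : ip (fun=> 1) (fun=> 1) = 2.
Proof.
rewrite /ip (_ : \int[mu]_y _ = 2 * pi).
  by rewrite mulrC mulfK// gt_eqF ?pi_gt0.
by rewrite -int_om; apply: eq_int => y; rewrite !mul1r.
Qed.
Let ip1 f : ip f (fun=> 1) = pi^-1 * \int[mu]_y (f y * om y).
Proof. by rewrite /ip; congr (_ * _); apply: eq_int => y; rewrite mulr1. Qed.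
Lemma ip_c1_1 : ip c1 (fun=> 1) = 0. Proof. by rewrite ip1 int_c1 mulr0. Qed.
Lemma ip_s1_1 : ip s1 (fun=> 1) = 0. Proof. by rewrite ip1 int_s1 mulr0. Qed.
Lemma ip_c1_c1 : ip c1 c1 = 1.
Proof. by rewrite /ip; have [-> _ _] := @int_quadratic R; rewrite mulVf// gt_eqF ?pi_gt0. Qed.
Lemma ip_s1_s1 : ip s1 s1 = 1.
Proof. by rewrite /ip; have [_ -> _] := @int_quadratic R; rewrite mulVf// gt_eqF ?pi_gt0. Qed.
Lemma ip_c1_s1 : ip c1 s1 = 0.
Proof. by rewrite /ip; have [_ _ ->] := @int_quadratic R; rewrite mulr0. Qed.

Lemma ip_c2_1 : ip c2 (fun=> 1) = 0. Proof. by rewrite ip1 int_c2 mulr0. Qed.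
Lemma ip_s2_1 : ip s2 (fun=> 1) = 0. Proof. by rewrite ip1 int_s2 mulr0. Qed.

End InnerProduct2.

Section LogOperator.
Context {R : realType}.
Notation mu := (@lebesgue_measure R).
Implicit Types (f g h : R -> R).

(** Off the diagonal this is [(D - 1 - ln D) / 2], with [D] the exponential of
[lD x y]; the absolute value only serves to make it nonnegative on the
diagonal as well. *)
Definition kr (x y : R) := `|2^-1 * (- (c1 x * c1 y + s1 x * s1 y) - lD x y)|.

Lemma kr_eq (x y : R) : y != x ->
  kr x y = 2^-1 * (- (c1 x * c1 y + s1 x * s1 y) - lD x y).
Proof.
move=> yx; rewrite /kr ger0_norm// mulr_ge0// subr_ge0.
pose D := 2 / (1 + x ^+ 2) * (x - y) ^+ 2 / (1 + y ^+ 2).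
have p := sqB_gt0 yx; have qx := sq1_gt0 x; have qy := sq1_gt0 y.
have D1 : 0 < 2 / (1 + x ^+ 2) * (x - y) ^+ 2 by rewrite mulr_gt0// divr_gt0.
have D0 : 0 < D by rewrite divr_gt0.
have -> : lD x y = ln D.
  by rewrite /D (ln_div D1 qy) lnM ?posrE// divr_gt0.
have -> : - (c1 x * c1 y + s1 x * s1 y) = D - 1.
  by rewrite /D /c1 /s1; field; rewrite !sq1_neq0.
by rewrite -{1}(subrK 1 D) addrC le_ln1Dx// ltrBrDr addrC subrr.
Qed.

Lemma kr_ge0 (x y : R) : 0 <= kr x y. Proof. exact: normr_ge0. Qed.

Lemma kr_sym (x y : R) : y != x -> kr x y = kr y x.
Proof.
move=> yx; have xy : x != y by rewrite eq_sym.
rewrite (kr_eq yx) (kr_eq xy) (lD_sym yx).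
by rewrite (mulrC (c1 x)) (mulrC (s1 x)).
Qed.

Lemma kr_meas2 : measurable_fun setT (fun z : R * R => kr z.1 z.2).
Proof.
have m1 := @c1_meas R; have m2 := @s1_meas R; have m3 := @lD_meas2 R.
by rewrite /kr; msolve.
Qed.

Lemma kr_meas x : measurable_fun setT (kr x).
Proof.
have m1 := @c1_meas R; have m2 := @s1_meas R; have m3 := @lD_meas R x.
by rewrite /kr; msolve.
Qed.

Lemma itg_kr h x : bdm h -> itg (fun y => kr x y * (h y * om y)).
Proof.
move=> [mh [M hM]]; have m := kr_meas x; have mo := @om_meas R.
have M0 : 0 <= M by exact: le_trans (hM 0).
apply: (itg_dom (g := fun y => M * (2 * om y + lDmaj x y))); first by msolve.
  by apply: itgZ; apply: itgD; [apply: itgZ; exact: itg_om|exact: itg_lDmaj].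
move=> y; rewrite mulrCA normrM; apply: ler_pM => //.
rewrite normrM (gtr0_norm (om_gt0 y)) ger0_norm ?kr_ge0//.
apply: (@le_trans _ _ ((2 + `|lD x y|) * om y)); last first.
  by rewrite mulrDl lerD2l lD_le.
rewrite ler_pM2r ?om_gt0// /kr normrM (@ger0_norm _ 2^-1)//.
have h1 : `|c1 x * c1 y| <= 1 * 1 by rewrite (normrM (c1 x)); apply: ler_pM => //; exact: c1_le1.
have h2 : `|s1 x * s1 y| <= 1 * 1 by rewrite (normrM (s1 x)); apply: ler_pM => //; exact: s1_le1.
have h3 := ler_normB (- (c1 x * c1 y + s1 x * s1 y)) (lD x y).
have h4 := ler_normD (c1 x * c1 y) (s1 x * s1 y).
rewrite normrN in h3.
have h5 : 0 <= `|lD x y| by [].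
by lra.
Qed.

(** The linear operator of the problem: [Lp] inverts the half-Laplacian on the
circle up to its action on constants and first modes. The choice of the kernel,
[D - 1 - ln D] instead of [- ln D], makes it positive with small mass. *)
Definition Lp h x := pi^-1 * \int[mu]_y (kr x y * (h y * om y)).

Lemma Lp_eq h x : bdm h -> Lp h x =
  - (2^-1 * (ip h c1 * c1 x + ip h s1 * s1 x)) -
  (2 * pi)^-1 * \int[mu]_y (lD x y * (h y * om y)).
Proof.
move=> bh; have [mh [M hM]] := bh; have mo := @om_meas R.
have I1 : itg (fun y => h y * c1 y * om y) by apply: itg_bdm; bsolve.
have I2 : itg (fun y => h y * s1 y * om y) by apply: itg_bdm; bsolve.
have I3 := itg_lD x mh hM.
have I4 := itgD (itgZ (- (2^-1 * c1 x)) I1) (itgZ (- (2^-1 * s1 x)) I2).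
have -> : Lp h x = pi^-1 * \int[mu]_y (- (2^-1 * c1 x) * (h y * c1 y * om y) +
    - (2^-1 * s1 x) * (h y * s1 y * om y) - 2^-1 * (lD x y * (h y * om y))).
  rewrite /Lp; congr (_ * _); apply: (@eq_int_pt _ x).
  - exact: itg_meas (itg_kr x bh).
  - exact: itg_meas (itgB I4 (itgZ _ I3)).
  - by move=> y yx; rewrite kr_eq//; ring.
rewrite (intB I4 (itgZ _ I3)) (intD (itgZ _ I1) (itgZ _ I2)) !intZ// /ip.
have := pi_gt0 R; move: (@pi R) => w w0; field; by rewrite gt_eqF.
Qed.

Lemma LpD f g x : bdm f -> bdm g ->
  Lp (fun y => f y + g y) x = Lp f x + Lp g x.
Proof.
move=> bf bg; rewrite /Lp -mulrDr -intD; [|exact: itg_kr|exact: itg_kr].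
by congr (_ * _); apply: eq_int => y; ring.
Qed.
Lemma LpZ k f x : bdm f -> Lp (fun y => k * f y) x = k * Lp f x.
Proof.
move=> bf; rewrite /Lp [RHS]mulrCA -(intZ k); last exact: itg_kr.
by congr (_ * _); apply: eq_int => y; ring.
Qed.

Lemma Lp_1 x : Lp (fun=> 1) x = ln 2.
Proof.
rewrite Lp_eq; last exact: bdm_cst.
rewrite (ipC _ c1) (ipC _ s1) ip_c1_1 ip_s1_1 int_lD_1.
have := pi_gt0 R; move: (@pi R) => w w0; field; by rewrite gt_eqF.
Qed.

Lemma Lp_c1 x : Lp c1 x = 2^-1 * c1 x.
Proof.
rewrite Lp_eq; last exact: bdm_c1.
rewrite ip_c1_c1 ip_c1_s1 int_lD_c1.
have := pi_gt0 R; move: (@pi R) => w w0; field; by rewrite gt_eqF.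
Qed.
Lemma Lp_s1 x : Lp s1 x = 2^-1 * s1 x.
Proof.
rewrite Lp_eq; last exact: bdm_s1.
rewrite ip_s1_s1 ipC ip_c1_s1 int_lD_s1.
have := pi_gt0 R; move: (@pi R) => w w0; field; by rewrite gt_eqF.
Qed.

Lemma ip_cubic f (a b : R) : (forall y, f y = (a * c1 y + b * s1 y) ^+ 2) ->
  ip f c1 = 0 /\ ip f s1 = 0.
Proof.
move=> /funext ->; have [e1 e2] := @int_cubic R a b.
by rewrite /ip e1 e2 mulr0.
Qed.

Lemma ip_c2_first : ip (@c2 R) c1 = 0 /\ ip (@c2 R) s1 = 0.
Proof.
have [e1 e2] := @ip_cubic (fun y => c1 y ^+ 2) 1 0 ltac:(by move=> y; ring).
have [e3 e4] := @ip_cubic (fun y => s1 y ^+ 2) 0 1 ltac:(by move=> y; ring).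
by rewrite /c2 !ipB ?e1 ?e2 ?e3 ?e4 ?subrr//; bsolve.
Qed.
Lemma ip_s2_first : ip (@s2 R) c1 = 0 /\ ip (@s2 R) s1 = 0.
Proof.
have [e1 e2] := @ip_cubic (fun y => c1 y ^+ 2) 1 0 ltac:(by move=> y; ring).
have [e3 e4] := @ip_cubic (fun y => s1 y ^+ 2) 0 1 ltac:(by move=> y; ring).
have [e5 e6] := @ip_cubic (fun y => (c1 y ^+ 2 + s1 y ^+ 2) + s2 y) 1 1
  ltac:(by move=> y; rewrite /s2; ring).
move: e5 e6; rewrite !ipD; try bsolve.
by rewrite e1 e2 e3 e4 !add0r.
Qed.

Lemma Lp_c2 x : Lp c2 x = 2^-1 * c2 x.
Proof.
rewrite Lp_eq; last exact: bdm_c2.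
have [-> ->] := ip_c2_first; rewrite int_lD_c2.
have := pi_gt0 R; move: (@pi R) => w w0; field; by rewrite gt_eqF.
Qed.
Lemma Lp_s2 x : Lp s2 x = 2^-1 * s2 x.
Proof.
rewrite Lp_eq; last exact: bdm_s2.
have [-> ->] := ip_s2_first; rewrite int_lD_s2.
have := pi_gt0 R; move: (@pi R) => w w0; field; by rewrite gt_eqF.
Qed.

Lemma int_kr x : \int[mu]_y (kr x y * om y) = pi * ln 2.
Proof.
rewrite -(Lp_1 x) /Lp mulrA divff ?gt_eqF ?pi_gt0// mul1r.
by apply: eq_int => y; rewrite mul1r.
Qed.

(** The kernel is nonnegative and its total mass is the image [ln 2] of the
constant 1. Since [ln 2 < 1], this makes [Lp] a contraction in the sup norm. *)
Lemma Lp_le h M x : bdm h -> (forall y, `|h y| <= M) -> `|Lp h x| <= ln 2 * M.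
Proof.
move=> bh hM; rewrite /Lp normrM ger0_norm ?invr_ge0 ?pi_ge0// ler_pdivrMl ?pi_gt0//.
rewrite mulrA -(int_kr x) -intZr; last first.
  by have := itg_kr x (bdm_cst 1); apply: eq_itg => y; rewrite mul1r.
apply: int_dom; first exact: itg_meas (itg_kr x bh).
  apply: itgZr; have := itg_kr x (bdm_cst 1); apply: eq_itg => y; by rewrite mul1r.
move=> y; rewrite normrM ger0_norm ?kr_ge0// -mulrA ler_wpM2l ?kr_ge0//.
by rewrite normrM (gtr0_norm (om_gt0 y)) mulrC ler_pM2l ?om_gt0.
Qed.

Lemma bdm_Lp h : bdm h -> bdm (Lp h).
Proof.
move=> bh; have [mh [M hM]] := bh; apply: (@bdm_le _ _ (ln 2 * M)); last first.
  by move=> x; exact: Lp_le.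
apply: mfM; first exact: measurable_cst.
apply: (@meas_int_param R (fun x y => kr x y * (h y * om y))); last by move=> x; exact: itg_kr.
have mo := @om_meas R; have mk := kr_meas2.
apply: mfM; first exact: kr_meas2.
by msolve.
Qed.

(** The kernel is symmetric off the diagonal. *)
Lemma Lp_sym f g : bdm f -> bdm g -> ip (Lp f) g = ip f (Lp g).
Proof.
move=> bf bg; have [mf [A fA]] := bf; have [mg [B gB]] := bg.
have mo := @om_meas R; have mk := kr_meas2.
have A0 : 0 <= A by exact: le_trans (fA 0).
have B0 : 0 <= B by exact: le_trans (gB 0).
pose F x y := g x * om x * (kr x y * (f y * om y)).
have mF : measurable_fun setT (fun z : R * R => F z.1 z.2).
  rewrite /F; apply: mfM; first by msolve.
  by apply: mfM; [exact: kr_meas2|msolve].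
have I1 x : itg (F x) by apply: itgZ; exact: itg_kr.
have E2 y x : x != y -> f y * om y * (kr y x * (g x * om x)) = F x y.
  by move=> xy; rewrite /F (kr_sym xy); ring.
have mFy y : measurable_fun setT (F^~ y).
  have m1 := @c1_meas R; have m2 := @s1_meas R.
  by rewrite /F /kr /lD; msolve.
have I2 y : itg (F^~ y).
  apply: (@eq_itg_pt _ y (fun x => f y * om y * (kr y x * (g x * om x)))) => //.
  - by apply: itgZ; exact: itg_kr.
  - exact: E2.
have kI x : itg (fun y => kr x y * om y).
  by have := itg_kr x (bdm_cst 1); apply: eq_itg => y; rewrite mul1r.
have bound x : \int[mu]_y `|F x y| <= B * (pi * ln 2 * A) * om x.
  rewrite (_ : _ * om x = \int[mu]_y (B * A * om x * (kr x y * om y))); last first.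
    by rewrite intZ// int_kr; ring.
  apply: le_int; [exact: itg_norm|exact: itgZ|] => y.
  rewrite /F (normrM (_ * _)) (normrM (kr x y)) (normrM (f y)) (normrM (g x)).
  rewrite (gtr0_norm (om_gt0 x)) (gtr0_norm (om_gt0 y)) (ger0_norm (kr_ge0 x y)).
  rewrite (_ : B * A * om x * (kr x y * om y) = (B * om x) * (kr x y * (A * om y))); last by ring.
  have k0 := kr_ge0 x y.
  apply: ler_pM; [by nneg|by nneg|by rewrite ler_pM2r ?om_gt0|].
  by rewrite ler_wpM2l// ler_pM2r ?om_gt0.
have [_ E] := @fubini_dom R F (fun x => B * (pi * ln 2 * A) * om x) mF I1 I2
  (itgZ _ (@itg_om R)) bound.
have p0 : pi != 0 :> R by rewrite gt_eqF ?pi_gt0.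
have bLf := bdm_Lp bf; have bLg := bdm_Lp bg.
have X1 x : \int[mu]_y F x y = pi * (Lp f x * g x * om x).
  rewrite /F intZ; last exact: itg_kr.
  by rewrite /Lp; move: (@pi R) p0 => w w0; field.
have X2 y : \int[mu]_x F x y = pi * (f y * Lp g y * om y).
  rewrite (@eq_int_pt _ y _ (fun x => f y * om y * (kr y x * (g x * om x))))//.
  - rewrite intZ; last exact: itg_kr.
    by rewrite /Lp; move: (@pi R) p0 => w w0; field.
  - exact: itg_meas (itgZ _ (itg_kr y bg)).
  - by move=> x xy; rewrite E2.
move: E; rewrite (eq_int X1) (eq_int X2) !intZ; [|by apply: itg_bdm; bsolve|by apply: itg_bdm; bsolve].
by move=> /(mulfI p0) E; rewrite /ip E.
Qed.
End LogOperator.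

(** * The linearised problem *)

Section Contraction.
Context {R : realType}.
Implicit Types (u v : R -> R).

Lemma geom_to0 (q C e : R) : 0 <= q -> q < 1 -> 0 < e ->
  exists n : nat, C * q ^+ n <= e.
Proof.
move=> q0 q1 e0.
have : (fun n => C * q ^+ n) @ \oo --> C * 0.
  by apply: cvgM; [exact: cvg_cst|apply: cvg_expr; rewrite ger0_norm].
rewrite mulr0 => /cvgrPdist_le /(_ e e0) [N _ /(_ N (leqnn N))] /=.
by rewrite sub0r normrN => H; exists N; rewrite (le_trans (ler_norm _)).
Qed.

(** The iterates converge uniformly, hence pointwise, which preserves
measurability and the bound. *)
Lemma contraction_fixpoint (Phi : (R -> R) -> R -> R) (M q : R) :
  0 <= M -> 0 <= q -> q < 1 ->
  (forall u, measurable_fun setT u -> (forall y, `|u y| <= M) ->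
     measurable_fun setT (Phi u) /\ forall y, `|Phi u y| <= M) ->
  (forall u v d, measurable_fun setT u -> (forall y, `|u y| <= M) ->
     measurable_fun setT v -> (forall y, `|v y| <= M) ->
     (forall y, `|u y - v y| <= d) -> forall y, `|Phi u y - Phi v y| <= q * d) ->
  exists u, [/\ measurable_fun setT u, forall y, `|u y| <= M &
    forall y, Phi u y = u y].
Proof.
move=> M0 q0 q1 HP HL.
pose s n := iter n Phi (fun=> 0).
have sP n : measurable_fun setT (s n) /\ forall y, `|s n y| <= M.
  elim: n => [|n [m b]]; last exact: HP.
  by split => [|y]; [exact: measurable_cst|rewrite normr0].
have step n y : `|s n.+1 y - s n y| <= 2 * M * q ^+ n.
  elim: n y => [|n IH] y.
    rewrite expr0 mulr1 /= (le_trans (ler_normB _ _))// normr0 addr0.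
    have [_ b] := sP 1; apply: le_trans (b y) _; lra.
  rewrite exprS mulrCA; have [m1 b1] := sP n.+1; have [m2 b2] := sP n.
  exact: (HL _ _ _ m1 b1 m2 b2 IH).
pose C := 2 * M / (1 - q).
have q10 : 0 < 1 - q by rewrite subr_gt0.
have C0 : 0 <= C by rewrite divr_ge0// ?mulr_ge0// ltW.
have tail n k y : `|s (n + k)%N y - s n y| <= C * (q ^+ n - q ^+ (n + k)%N).
  elim: k => [|k IH]; first by rewrite addn0 !subrr normr0 mulr0.
  rewrite addnS -(subrK (s (n + k)%N y) (s (n + k).+1 y)) -addrA.
  apply: le_trans (ler_normD _ _) _.
  apply: le_trans (lerD (step _ _) IH) _; rewrite exprS.
  by rewrite le_eqVlt; apply/orP; left; apply/eqP; rewrite /C; field; rewrite gt_eqF.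
have tail' n m y : (n <= m)%N -> `|s m y - s n y| <= C * q ^+ n.
  move=> nm; rewrite -(subnKC nm); apply: le_trans (tail _ _ _) _.
  by rewrite ler_wpM2l// gerBl exprn_ge0.
have cs y : cvgn (s ^~ y).
  apply/cauchy_cvgP/cauchy_exP => e e0.
  have [n Hn] := geom_to0 C q0 q1 (divr_gt0 e0 (@ltr0Sn R 1)).
  exists (s n y); exists n => // m /= nm; rewrite /ball/= distrC.
  apply: le_lt_trans (tail' _ _ y nm) _; apply: le_lt_trans Hn _.
  by rewrite ltr_pdivrMr// ltr_pMr// ltr1n.
pose u y := limn (s ^~ y).
have su y : s n y @[n --> \oo] --> u y by exact: cs.
have mu : measurable_fun setT u.
  apply: (measurable_fun_cvg (h := s)) => [n|y _]; [by have [] := sP n|exact: su].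
have lim_le (c : R) y a n0 : (forall m, (n0 <= m)%N -> `|s m y - a| <= c) -> `|u y - a| <= c.
  move=> H; have : `|s n y - a| @[n --> \oo] --> `|u y - a|.
    by apply: cvg_norm; apply: cvgB; [exact: su|exact: cvg_cst].
  by move=> /cvgr_to_le; apply; exists n0 => // m /= mn; exact: H.
have uM y : `|u y| <= M.
  by rewrite -(subr0 (u y)); apply: (lim_le _ _ _ 0%N) => m _; rewrite subr0; have [_] := sP m.
have us n y : `|u y - s n y| <= C * q ^+ n.
  by apply: (lim_le _ _ _ n) => m nm; exact: tail'.
exists u; split => // y; apply/eqP; rewrite -subr_eq0 -normr_eq0 eq_le normr_ge0 andbT.
apply/ler_addgt0Pl => e e0; rewrite addr0.
have [n Hn] := geom_to0 (2 * C) q0 q1 e0.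
have [ms bs] := sP n.
have H1 : `|Phi u y - s n.+1 y| <= q * (C * q ^+ n).
  exact: (HL _ _ _ mu uM ms bs (us n)).
have H2 := us n.+1 y; rewrite exprS in H2.
rewrite -(subrK (s n.+1 y) (Phi u y)) -addrA; apply: le_trans (ler_normD _ _) _.
rewrite (distrC (s n.+1 y)); apply: le_trans (lerD H1 H2) _.
apply: le_trans Hn.
have : 0 <= C * q ^+ n by rewrite mulr_ge0// exprn_ge0.
by move: (q ^+ n) => w; nra.
Qed.
End Contraction.

Section LinearProblem.
Context {R : realType}.
Notation mu := (@lebesgue_measure R).
Implicit Types (f g h u w H : R -> R).

(** Iterating the estimate, the bound [M] disappears in the limit. *)
Lemma sup_selfbound u (q A M : R) : 0 <= q -> q < 1 -> 0 <= A ->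
  (forall y, `|u y| <= M) ->
  (forall M', (forall y, `|u y| <= M') -> forall y, `|u y| <= q * M' + A) ->
  forall y, `|u y| <= A / (1 - q).
Proof.
move=> q0 q1 A0 uM step.
have q10 : 0 < 1 - q by rewrite subr_gt0.
have B n y : `|u y| <= A / (1 - q) + M * q ^+ n.
  elim: n y => [|n IH] y.
    by rewrite expr0 mulr1 ler_wpDl// divr_ge0// ltW.
  apply: le_trans (step _ IH y) _; rewrite exprS le_eqVlt; apply/orP; left; apply/eqP.
  by field; rewrite gt_eqF.
move=> y; apply/ler_addgt0Pr => e e0; have [n Hn] := geom_to0 M q0 q1 e0.
by apply: le_trans (B n y) _; rewrite lerD2l.
Qed.

Lemma ln2_gt0 : 0 < ln 2 :> R. Proof. by rewrite ln_gt0// ltr1n. Qed.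
Lemma ln2_lt1 : ln 2 < 1 :> R.
Proof.
rewrite -ltr_expR lnK ?posrE//; have := @expR_gt1Dx R 1 (oner_neq0 _).
by rewrite (_ : 1 + 1 = 2 :> R).
Qed.

(** The source without its first modes, for which alone the linearised problem
is solvable. *)
Definition src H (y : R) := H y - ip H c1 * c1 y - ip H s1 * s1 y.

Lemma bdm_src H : bdm H -> bdm (src H).
Proof. by move=> bH; rewrite /src; bsolve. Qed.

Let src_le H M y : bdm H -> (forall z, `|H z| <= M) -> `|src H y| <= 5 * M.
Proof.
move=> bH HM; have M0 : 0 <= M by exact: le_trans (HM 0).
have a1 := ip_le bH (@bdm_c1 R) HM (@c1_le1 R).
have a2 := ip_le bH (@bdm_s1 R) HM (@s1_le1 R).
have b1 : `|ip H c1 * c1 y| <= 2 * M * 1 * 1.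
  by rewrite (normrM _ (c1 y)); apply: ler_pM => //; exact: c1_le1.
have b2 : `|ip H s1 * s1 y| <= 2 * M * 1 * 1.
  by rewrite (normrM _ (s1 y)); apply: ler_pM => //; exact: s1_le1.
have b3 := HM y.
have := ler_normB (H y) (ip H c1 * c1 y).
have := ler_normB (H y - ip H c1 * c1 y) (ip H s1 * s1 y).
rewrite -/(src H y); lra.
Qed.

Let mean_le H M : bdm H -> (forall z, `|H z| <= M) -> `|2^-1 * ip H (fun=> 1)| <= M.
Proof.
move=> bH HM; have := @ip_le R H (fun=> 1) M 1 bH (bdm_cst 1) HM.
rewrite normr1 => /(_ (fun=> lexx _)); rewrite (normrM 2^-1) ger0_norm//.
by lra.
Qed.

(** The integral form of the linearised problem. It selects the solution without
first modes, and the last term gives [w + H] zero mean, see [lin_sol_modes]. *)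
Definition lin_sol H w := bdm w /\
  forall y, w y = Lp (fun z => w z + src H z) y - 2^-1 * ip H (fun=> 1).

Definition lin_cst : R := (5 * ln 2 + 1) / (1 - ln 2).

Lemma lin_cst_ge0 : 0 <= lin_cst.
Proof.
have := ln2_gt0; have := ln2_lt1 => a b.
by rewrite divr_ge0// ?subr_ge0 ?(ltW a)// addr_ge0// mulr_ge0// ltW.
Qed.

Lemma lin_sol_le H w M : bdm H -> lin_sol H w -> (forall y, `|H y| <= M) ->
  forall y, `|w y| <= lin_cst * M.
Proof.
move=> bH [bw E] HM y; have [mw [A wA]] := bw.
have M0 : 0 <= M by exact: le_trans (HM 0).
have -> : lin_cst * M = ((5 * ln 2 + 1) * M) / (1 - ln 2) by rewrite /lin_cst mulrAC.
have q0 := ltW ln2_gt0; have q1 := ln2_lt1.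
apply: (sup_selfbound q0 q1 _ wA); first by nneg.
move=> M' wM' z; rewrite E.
have b : bdm (fun z => w z + src H z) by have := bdm_src bH => ?; bsolve.
have h1 : `|Lp (fun z => w z + src H z) z| <= ln 2 * (M' + 5 * M).
  apply: Lp_le => // t; apply: le_trans (ler_normD _ _) _.
  by apply: lerD => //; exact: src_le.
have h2 := mean_le bH HM.
by apply: le_trans (ler_normB _ _) _; lra.
Qed.

Lemma lin_sol_ex H : bdm H -> exists w, lin_sol H w.
Proof.
move=> bH; have [mH [M HM]] := bH.
have q0 := ltW ln2_gt0; have q1 := ln2_lt1; have bs := bdm_src bH.
have M0 : 0 <= M by exact: le_trans (HM 0).
pose Phi w y := Lp (fun z => w z + src H z) y - 2^-1 * ip H (fun=> 1).
have L0 : 0 <= lin_cst * M by rewrite mulr_ge0// lin_cst_ge0.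
have E : ln 2 * (lin_cst * M + 5 * M) + M = lin_cst * M.
  by rewrite /lin_cst; field; rewrite gt_eqF// subr_gt0.
have [||w [mw wM Ew]] := @contraction_fixpoint R Phi (lin_cst * M) (ln 2) L0 q0 q1.
- move=> u mu uM; have bu := bdm_le mu uM.
  have b : bdm (fun z => u z + src H z) by bsolve.
  split.
    have [m _] := bdm_Lp b; rewrite /Phi; apply: mfB => //; exact: measurable_cst.
  move=> y; rewrite /Phi -[leRHS]E; apply: le_trans (ler_normB _ _) _.
  apply: lerD; last exact: mean_le.
  apply: Lp_le => // t; apply: le_trans (ler_normD _ _) _.
  by apply: lerD => //; exact: src_le.
- move=> u v d mu uM mv vM uv y; have bu := bdm_le mu uM; have bv := bdm_le mv vM.
  have b1 : bdm (fun z => u z + src H z) by bsolve.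
  have b2 : bdm (fun z => v z + src H z) by bsolve.
  have b3 : bdm (fun z => u z - v z) by bsolve.
  have -> : Phi u y - Phi v y = Lp (fun z => u z - v z) y.
    have := @LpD R (fun z => u z - v z) (fun z => v z + src H z) y b3 b2.
    rewrite (_ : (fun y0 => _) = fun z => u z + src H z); last by apply/funext => z; ring.
    by rewrite /Phi => ->; ring.
  exact: Lp_le.
- by exists w; split => [|y]; [exact: bdm_le mw wM|rewrite -[LHS]Ew].
Qed.

Lemma lin_solDZ k H w H' w' : bdm H -> bdm H' -> lin_sol H w -> lin_sol H' w' ->
  lin_sol (fun y => H y + k * H' y) (fun y => w y + k * w' y).
Proof.
move=> bH bH' [bw E] [bw' E']; split; first by bsolve.
have bs := bdm_src bH; have bs' := bdm_src bH'.
have bk : bdm (fun y => k * H' y) by bsolve.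
have b1 : bdm (fun z => w z + src H z) by bsolve.
have b2 : bdm (fun z => w' z + src H' z) by bsolve.
have b3 : bdm (fun z => k * (w' z + src H' z)) by bsolve.
have Es z : src (fun y => H y + k * H' y) z = src H z + k * src H' z.
  rewrite /src; have [] := (@bdm_c1 R, @bdm_s1 R) => d1 d2.
  by rewrite !ipD// !ipZ//; ring.
move=> y; rewrite ipD//; last exact: bdm_cst.
rewrite ipZ//; last exact: bdm_cst.
rewrite (_ : (fun z => _) = fun z => (w z + src H z) + k * (w' z + src H' z)); last first.
  by apply/funext => z; rewrite Es; ring.
by rewrite (LpD _ b1 b3) (LpZ _ _ b2) {1}E {1}E'; ring.
Qed.

(** Testing the equation against an eigenfunction of [Lp], by symmetry. *)
Let lin_sol_test H w g (l : R) : bdm H -> lin_sol H w -> bdm g ->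
  (forall y, Lp g y = l * g y) ->
  ip w g = l * (ip w g + (ip H g - ip H c1 * ip c1 g - ip H s1 * ip s1 g)) -
    2^-1 * ip H (fun=> 1) * ip (fun=> 1) g.
Proof.
move=> bH [bw E] bg El.
have [d1 d2] := (@bdm_c1 R, @bdm_s1 R); have bs := bdm_src bH.
have d3 : bdm (fun=> 1 : R) by exact: bdm_cst.
have b1 : bdm (fun z => w z + src H z) by bsolve.
have bL := bdm_Lp b1.
have dc : bdm (fun y => ip H c1 * c1 y) by bsolve.
have ds : bdm (fun y => ip H s1 * s1 y) by bsolve.
have dk : bdm (fun y : R => 2^-1 * ip H (fun=> 1) * (fun=> 1) y) by bsolve.
have dh : bdm (fun y => H y - ip H c1 * c1 y) by bsolve.
have Es : ip (src H) g = ip H g - ip H c1 * ip c1 g - ip H s1 * ip s1 g.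
  by rewrite /src (ipB dh ds bg) (ipB bH dc bg) !ipZ.
have Ew : ip w g = ip (Lp (fun z => w z + src H z)) g - 2^-1 * ip H (fun=> 1) * ip (fun=> 1) g.
  by rewrite -(ipZ _ d3 bg) -ipB//; apply: eq_ip => y; rewrite {1}E mulr1.
rewrite -Es -(ipD bw bs bg) {1}Ew (Lp_sym b1 bg); congr (_ - _).
rewrite (_ : Lp g = fun y => l * g y); last by apply/funext.
by rewrite ipC ipZ// ipC.
Qed.

Lemma lin_sol_modes H w : bdm H -> lin_sol H w ->
  [/\ ip w (fun=> 1) = - ip H (fun=> 1), ip w c1 = 0 & ip w s1 = 0].
Proof.
move=> bH S; have T g l := @lin_sol_test H w g l bH S.
split.
- have := T (fun=> 1) (ln 2) (bdm_cst 1).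
  rewrite ip11 ip_c1_1 ip_s1_1 !mulr0 !subr0 => /(_ ltac:(by move=> y; rewrite Lp_1 mulr1)).
  move: (ip w _) (ip H _) => a b e.
  apply/eqP; rewrite -addr_eq0; apply/eqP; apply: (@mulfI _ (1 - ln 2)).
    by rewrite subr_eq0 gt_eqF ?ln2_lt1.
  by rewrite mulr0; lra.
- have := T c1 2^-1 (@bdm_c1 R) (@Lp_c1 R).
  rewrite ip_c1_c1 (ipC s1) ip_c1_s1 (ipC (fun=> 1) c1) ip_c1_1.
  by move: (ip w _) (ip H _) => a b; lra.
- have := T s1 2^-1 (@bdm_s1 R) (@Lp_s1 R).
  rewrite ip_s1_s1 ip_c1_s1 (ipC (fun=> 1) s1) ip_s1_1.
  by move: (ip w _) (ip H _) => a b; lra.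
Qed.

Lemma lin_sol_second H w : bdm H -> ip H c1 = 0 -> ip H s1 = 0 -> lin_sol H w ->
  ip w c2 = ip H c2 /\ ip w s2 = ip H s2.
Proof.
move=> bH H1 H2 S; have T g l := @lin_sol_test H w g l bH S.
split.
- have := T c2 2^-1 (@bdm_c2 R) (@Lp_c2 R); rewrite H1 H2 (ipC (fun=> 1) c2) ip_c2_1.
  by move: (ip w _) (ip H _) => a b; lra.
- have := T s2 2^-1 (@bdm_s2 R) (@Lp_s2 R); rewrite H1 H2 (ipC (fun=> 1) s2) ip_s2_1.
  by move: (ip w _) (ip H _) => a b; lra.
Qed.

Definition lsol H : R -> R := get (lin_sol H).

Lemma lsolP H : bdm H -> lin_sol H (lsol H).
Proof. by move=> bH; have [w Hw] := lin_sol_ex bH; exact: (@getPex _ (lin_sol H) (ex_intro _ w Hw)). Qed.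

Lemma bdm_lsol H : bdm H -> bdm (lsol H).
Proof. by move=> /lsolP[]. Qed.

Lemma lsol_le H M : bdm H -> (forall y, `|H y| <= M) ->
  forall y, `|lsol H y| <= lin_cst * M.
Proof. by move=> bH; apply: lin_sol_le => //; exact: lsolP. Qed.

Lemma lsol_dist H H' d : bdm H -> bdm H' -> (forall y, `|H y - H' y| <= d) ->
  forall y, `|lsol H y - lsol H' y| <= lin_cst * d.
Proof.
move=> bH bH' Hd y.
have s := lin_solDZ (-1) bH bH' (lsolP bH) (lsolP bH').
have b : bdm (fun y => H y + -1 * H' y) by bsolve.
rewrite -mulN1r; apply: (lin_sol_le b s) => z; by rewrite mulN1r.
Qed.

End LinearProblem.

(** * The nonlinear problem *)

Section ExpRemainders.
Context {R : realType}.

(** The Taylor remainders of [expR (e * p)], divided by the power of [e] that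
makes them of order one. *)
Definition E1 (e p : R) := (expR (e * p) - 1) / e.
Definition E2 (e p : R) := (expR (e * p) - 1 - e * p) / e ^+ 2.
Definition E3 (e p : R) :=
  (expR (e * p) - 1 - e * p - 2^-1 * (e * p) ^+ 2) / e ^+ 3.

Let dE1 e p : e != 0 -> isd (E1 e) p (expR (e * p)).
Proof.
move=> e0; rewrite /E1; apply: deq; last by dsolve.
by cbv beta; rewrite /cst; field.
Qed.
Let dE2 e p : e != 0 -> isd (E2 e) p (E1 e p).
Proof.
move=> e0; rewrite /E2 /E1; apply: deq; last by dsolve.
by cbv beta; rewrite /cst; field.
Qed.
Let dE3 e p : e != 0 -> isd (E3 e) p (E2 e p).
Proof.
move=> e0; rewrite /E3 /E2; apply: deq; last by dsolve.
by cbv beta; rewrite /cst; field.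
Qed.

Lemma E2_0 e : E2 e 0 = 0.
Proof. by rewrite /E2 mulr0 expR0 subrr subr0 mul0r. Qed.
Lemma E3_0 e : E3 e 0 = 0.
Proof. by rewrite /E3 mulr0 expR0 subrr expr0n/= mulr0 !subr0 mul0r. Qed.

Let bound_step (f df : R -> R) (B L : R) : (forall p, isd f p (df p)) -> f 0 = 0 ->
  (forall p, `|p| <= B -> `|df p| <= L) -> forall p, `|p| <= B -> `|f p| <= L * B.
Proof.
move=> d f0 H p pB; have [c] := mvt 0 p d; rewrite f0 !subr0 => cp ->.
rewrite normrM; apply: ler_pM => //; apply: H; exact: le_trans cp pB.
Qed.

Let lip_step (f df : R -> R) (B L : R) : (forall p, isd f p (df p)) ->
  (forall p, `|p| <= 3 * B -> `|df p| <= L) ->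
  forall p p', `|p| <= B -> `|p'| <= B -> `|f p - f p'| <= L * `|p - p'|.
Proof.
move=> d H p p' pB p'B; have [c cp ->] := mvt p' p d.
rewrite normrM ler_wpM2r//; apply: H.
have := ler_normD (c - p') p'; rewrite subrK => h1.
have h2 := ler_normB p p'; lra.
Qed.

Lemma exp_remainders_lip (B : R) : 0 <= B -> exists2 L, 0 <= L &
  forall e, 0 < e -> e <= 1 -> forall p p', `|p| <= B -> `|p'| <= B ->
  `|E2 e p - E2 e p'| <= L * `|p - p'| /\ `|E3 e p - E3 e p'| <= L * `|p - p'|.
Proof.
move=> B0; pose X := expR (3 * B) : R.
have X0 : 0 <= X by exact: expR_ge0.
exists (X * (3 * B) + X * (3 * B) * (3 * B)); first by nneg.
move=> e e0 e1 p p' pB p'B; have en : e != 0 by rewrite gt_eqF.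
have b1 c : `|c| <= 3 * B -> `|E1 e c| <= X * (3 * B).
  apply: (bound_step (fun c => dE1 c en)).
    by rewrite /E1 mulr0 expR0 subrr mul0r.
  move=> c' c'B; rewrite ger0_norm ?expR_ge0// ler_expR.
  apply: le_trans (ler_norm _) _; rewrite normrM (gtr0_norm e0).
  by apply: le_trans c'B; rewrite ler_piMl.
have b2 c : `|c| <= 3 * B -> `|E2 e c| <= X * (3 * B) * (3 * B).
  exact: (bound_step (fun c => dE2 c en) (E2_0 e) b1).
split.
- apply: le_trans (lip_step (fun c => dE2 c en) b1 pB p'B) _.
  by rewrite ler_wpM2r// lerDl; nneg.
- apply: le_trans (lip_step (fun c => dE3 c en) b2 pB p'B) _.
  by rewrite ler_wpM2r// lerDr; nneg.
Qed.

(** The part of order [e ^+ 2] of the nonlinearity, see [gf_exp]; its own part of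
order [e] is [rf]. *)
Definition rf (k e p : R) := k * E2 e p + E3 e p.
Definition gf (k e p : R) := k * p + 2^-1 * p ^+ 2 + e * rf k e p.

Lemma gf_exp (k e p : R) : e != 0 ->
  (1 + e * k) * expR (e * p) = 1 + e * (p + k + e * gf k e p).
Proof. by move=> e0; rewrite /gf /rf /E2 /E3; field. Qed.

Lemma gf_0 k e : gf k e 0 = 0.
Proof. by rewrite /gf /rf E2_0 E3_0; ring. Qed.
Lemma rf_0 k e : rf k e 0 = 0.
Proof. by rewrite /rf E2_0 E3_0 mulr0 addr0. Qed.

Lemma gf_lip (A B : R) : 0 <= A -> 0 <= B -> exists2 L, 0 <= L &
  forall e, 0 < e -> e <= 1 -> forall k p p', `|k| <= A -> `|p| <= B -> `|p'| <= B ->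
  `|gf k e p - gf k e p'| <= L * `|p - p'| /\ `|rf k e p - rf k e p'| <= L * `|p - p'|.
Proof.
move=> A0 B0; have [L L0 HL] := exp_remainders_lip B0.
exists (A + B + (A + 1) * L); first by nneg.
move=> e e0 e1 k p p' kA pB p'B; have [h2 h3] := HL e e0 e1 p p' pB p'B.
have hr : `|rf k e p - rf k e p'| <= (A + 1) * L * `|p - p'|.
  rewrite (_ : _ - _ = k * (E2 e p - E2 e p') + (E3 e p - E3 e p')); last by rewrite /rf; ring.
  apply: le_trans (ler_normD _ _) _; rewrite -mulrA [leRHS]mulrDl mul1r; apply: lerD => //.
  by rewrite normrM; apply: ler_pM.
have d0 : 0 <= `|p - p'| by [].
split; last first.
  apply: le_trans hr _; rewrite ler_wpM2r// lerDr; nneg.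
rewrite (_ : _ - _ = (k + 2^-1 * (p + p')) * (p - p') + e * (rf k e p - rf k e p')); last first.
  by rewrite /gf; field.
apply: le_trans (ler_normD _ _) _; rewrite [leRHS]mulrDl; apply: lerD.
  rewrite normrM ler_wpM2r//; apply: le_trans (ler_normD _ _) _; apply: lerD => //.
  rewrite normrM ger0_norm//; have := ler_normD p p'; lra.
apply: le_trans hr; rewrite normrM (gtr0_norm e0) ler_piMl//.
Qed.

End ExpRemainders.

Section Nonlinear.
Context {R : realType}.
Notation mu := (@lebesgue_measure R).
Implicit Types (f g h : R -> R).
Context (K : R -> R) (bK : bdm K) (Kc : ip K c1 = 0) (Ks : ip K s1 = 0).
Let al := ip K c2.
Let be := ip K s2.
Let De := al ^+ 2 + be ^+ 2.
Context (De0 : De != 0).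

Let sg := lsol K.
Let bsg : bdm sg. Proof. exact: bdm_lsol. Qed.
Let bc1 : bdm (@c1 R). Proof. exact: bdm_c1. Qed.
Let bs1 : bdm (@s1 R). Proof. exact: bdm_s1. Qed.
Let bc2 : bdm (@c2 R). Proof. exact: bdm_c2. Qed.
Let bs2 : bdm (@s2 R). Proof. exact: bdm_s2. Qed.
Let b1 : bdm (fun=> 1 : R). Proof. exact: bdm_cst. Qed.

Let Ksg y := K y + sg y.
Let bKsg : bdm Ksg. Proof. by rewrite /Ksg; bsolve. Qed.

Let Ksg_modes : [/\ ip Ksg (fun=> 1) = 0, ip Ksg c2 = 2 * al & ip Ksg s2 = 2 * be].
Proof.
have [e1 _ _] := lin_sol_modes bK (lsolP bK).
have [e2 e3] := lin_sol_second bK Kc Ks (lsolP bK).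
rewrite /Ksg !ipD// [ip sg _]e1 [ip sg _]e2 [ip sg _]e3 /al /be; split; ring.
Qed.

(** A product of two first modes is a combination of 1, [c2] and [s2], and
[K + sg] has zero mean and twice the second modes of [K]. *)
Let Ksg_first (p q : R) :
  ip (fun y => Ksg y * (p * c1 y + q * s1 y)) c1 = p * al + q * be /\
  ip (fun y => Ksg y * (p * c1 y + q * s1 y)) s1 = p * be - q * al.
Proof.
have [m1 m2 m3] := Ksg_modes.
have ipZr k f g : bdm f -> bdm g -> ip f (fun y => k * g y) = k * ip f g.
  by move=> ? ?; rewrite ipC ipZ// ipC.
have ipDr f g h : bdm f -> bdm g -> bdm h -> ip f (fun y => g y + h y) = ip f g + ip f h.
  by move=> ? ? ?; rewrite ipC ipD// ipC (ipC h).
have bp : bdm (fun y => 2^-1 * p * (fun=> 1) y : R) by bsolve.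
have bq : bdm (fun y => 2^-1 * q * (fun=> 1) y : R) by bsolve.
rewrite !ipM; split.
- rewrite (_ : (fun y => _) = fun y => 2^-1 * p * (fun=> 1) y + (2^-1 * p * c2 y + 2^-1 * q * s2 y)).
    rewrite !ipDr; try bsolve.
    by rewrite !ipZr// m1 m2 m3; field.
  apply/funext => y; transitivity (2^-1 * p * (c1 y ^+ 2 + s1 y ^+ 2) +
    (2^-1 * p * c2 y + 2^-1 * q * s2 y)); last by rewrite c1s1.
  by rewrite /c2 /s2; field.
- rewrite (_ : (fun y => _) = fun y => 2^-1 * q * (fun=> 1) y + (2^-1 * p * s2 y + - (2^-1 * q) * c2 y)).
    rewrite !ipDr; try bsolve.
    by rewrite !ipZr// m1 m2 m3; field.
  apply/funext => y; transitivity (2^-1 * q * (c1 y ^+ 2 + s1 y ^+ 2) +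
    (2^-1 * p * s2 y + - (2^-1 * q) * c2 y)); last by rewrite c1s1.
  by rewrite /c2 /s2; field.
Qed.

Let corr_c f := - ((al * ip f c1 + be * ip f s1) / De).
Let corr_s f := - ((be * ip f c1 - al * ip f s1) / De).
(** The first-mode function whose product with [K + sg] cancels the first modes
of [f]. *)
Let corr f (y : R) : R := corr_c f * c1 y + corr_s f * s1 y.

Let bdm_corr f : bdm (corr f).
Proof. by rewrite /corr; bsolve. Qed.

Let corr_first f : ip (fun y => Ksg y * corr f y) c1 = - ip f c1 /\
  ip (fun y => Ksg y * corr f y) s1 = - ip f s1.
Proof.
have [-> ->] := Ksg_first (corr_c f) (corr_s f).
by rewrite /corr_c /corr_s; split; rewrite /De; field.
Qed.

(* By polarisation from [ip_cubic]. *)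
Let corr_mul f g : ip (fun y => corr f y * corr g y) c1 = 0 /\
  ip (fun y => corr f y * corr g y) s1 = 0.
Proof.
have [e1 e2] := @ip_cubic R (fun y => (corr f y + corr g y) ^+ 2)
  (corr_c f + corr_c g) (corr_s f + corr_s g) ltac:(by move=> y; rewrite /corr; ring).
have [e3 e4] := @ip_cubic R (fun y => (corr f y - corr g y) ^+ 2)
  (corr_c f - corr_c g) (corr_s f - corr_s g) ltac:(by move=> y; rewrite /corr; ring).
have bf := bdm_corr f; have bg := bdm_corr g.
have E : (fun y => corr f y * corr g y) =1
  (fun y => 4^-1 * ((corr f y + corr g y) ^+ 2 - (corr f y - corr g y) ^+ 2)).
  by move=> y; field.
have p1 : bdm (fun y => (corr f y + corr g y) ^+ 2) by bsolve.
have p2 : bdm (fun y => (corr f y - corr g y) ^+ 2) by bsolve.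
have p3 : bdm (fun y => (corr f y + corr g y) ^+ 2 - (corr f y - corr g y) ^+ 2) by bsolve.
by rewrite !(eq_ip _ E) !ipZ// !ipB// e1 e2 e3 e4 subrr mulr0.
Qed.

Let corr_cst : R := 4 * (`|al| + `|be|) / `|De|.
Let corr_cst_ge0 : 0 <= corr_cst. Proof. by rewrite /corr_cst; nneg. Qed.

Let corr_le f (M y : R) : bdm f -> (forall z, `|f z| <= M) -> `|corr f y| <= corr_cst * M.
Proof.
move=> bf fM; have M0 : 0 <= M by exact: le_trans (fM 0).
have a1 := ip_le bf bc1 fM (@c1_le1 R); rewrite mulr1 in a1.
have a2 := ip_le bf bs1 fM (@s1_le1 R); rewrite mulr1 in a2.
have h (u v w z : R) : `|u| <= 2 * M -> `|v| <= 2 * M -> `|w| + `|z| <= `|al| + `|be| ->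
    `| - ((w * u + z * v) / De)| <= 2^-1 * corr_cst * M.
  move=> uM vM wz; rewrite normrN normrM normfV.
  rewrite (_ : 2^-1 * corr_cst * M = (`|al| + `|be|) * (2 * M) / `|De|); last first.
    by rewrite /corr_cst; field; rewrite normr_eq0.
  rewrite ler_wpM2r ?invr_ge0//; apply: le_trans (ler_normD _ _) _.
  rewrite (normrM w) (normrM z); apply: (@le_trans _ _ ((`|w| + `|z|) * (2 * M))); last first.
    by apply: ler_wpM2r wz; nneg.
  by rewrite [leRHS]mulrDl; apply: lerD; apply: ler_wpM2l.
have h1 : `|corr_c f| <= 2^-1 * corr_cst * M by apply: (h (ip f c1) (ip f s1) al be).
have h2 : `|corr_s f| <= 2^-1 * corr_cst * M.
  rewrite /corr_s -(mulNr al); apply: (h (ip f c1) (ip f s1) be (- al)) => //.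
  by rewrite normrN addrC.
rewrite /corr; apply: le_trans (ler_normD _ _) _.
rewrite (normrM _ (c1 y)) (normrM _ (s1 y)).
have := ler_pM (normr_ge0 _) (normr_ge0 _) h1 (c1_le1 y).
have := ler_pM (normr_ge0 _) (normr_ge0 _) h2 (s1_le1 y).
by lra.
Qed.

Let corr_dist f g (d y : R) : bdm f -> bdm g -> (forall z, `|f z - g z| <= d) ->
  `|corr f y - corr g y| <= corr_cst * d.
Proof.
move=> bf bg fg; have b : bdm (fun z => f z - g z) by bsolve.
have -> : corr f y - corr g y = corr (fun z => f z - g z) y.
  by rewrite /corr /corr_c /corr_s !ipB//; field.
exact: corr_le.
Qed.

Let f0 y := K y * sg y + 2^-1 * sg y ^+ 2.
Let bf0 : bdm f0. Proof. by rewrite /f0; bsolve. Qed.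
(** The limit profile of the perturbation as [e] tends to zero; the choice of its
first modes makes [gps_first] hold. *)
Let ps y := sg y + corr f0 y.
Let bps : bdm ps. Proof. by have := bdm_corr f0 => ?; rewrite /ps; bsolve. Qed.

(* The solvability condition at leading order. *)
Let gps_first : ip (fun y => K y * ps y + 2^-1 * ps y ^+ 2) c1 = 0 /\
  ip (fun y => K y * ps y + 2^-1 * ps y ^+ 2) s1 = 0.
Proof.
have bc := bdm_corr f0.
have E : (fun y => K y * ps y + 2^-1 * ps y ^+ 2) =1
    fun y => f0 y + Ksg y * corr f0 y + 2^-1 * (corr f0 y * corr f0 y).
  by move=> y; rewrite /ps /f0 /Ksg; field.
have p1 : bdm (fun y => f0 y + Ksg y * corr f0 y) by bsolve.
have p2 : bdm (fun y => Ksg y * corr f0 y) by bsolve.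
have p3 : bdm (fun y => corr f0 y * corr f0 y) by bsolve.
have p4 : bdm (fun y => 2^-1 * (corr f0 y * corr f0 y)) by bsolve.
have [m1 m2] := corr_mul f0 f0; have [n1 n2] := corr_first f0.
by rewrite !(eq_ip _ E) !(ipD p1 p4)// !(ipD bf0 p2)// !(ipZ _ p3)// m1 m2 n1 n2 !subrr mulr0 addr0.
Qed.

Section FixedEps.
Context (e : R) (e0 : 0 < e).
Let Psi (eta : R -> R) y := ps y + e * eta y.
Let G eta y := gf (K y) e (Psi eta y).
Let rm eta y := rf (K y) e (Psi eta y) + 2^-1 * (e * eta y ^+ 2).
Let fm eta y := (K y + ps y) * lsol (G eta) y + rm eta y.
(** The fixed points of [Phi] give solutions; it depends on [eta] only through
[e * eta], hence contracts for small [e]. *)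
Let Phi eta y := lsol (G eta) y + corr (fm eta) y.

Lemma solution_of_fixpoint eta : bdm eta -> bdm (G eta) -> bdm (rm eta) ->
  Phi eta =1 eta ->
  let h y := Psi eta y + K y + e * G eta y in
  ip h (fun=> 1) = 0 /\ exists m, forall y,
    Psi eta y = Lp h y + 2^-1 * (ip h c1 * c1 y + ip h s1 * s1 y) - m.
Proof.
move=> be' bG brm fix_eta h; set w := lsol (G eta).
have bw : bdm w by exact: bdm_lsol.
have bfm : bdm (fm eta) by rewrite /fm -/w; bsolve.
have bc := bdm_corr (fm eta); have bc0 := bdm_corr f0.
have p1 : bdm (fun y => K y * ps y + 2^-1 * ps y ^+ 2) by bsolve.
have p2 : bdm (fun y => Ksg y * corr (fm eta) y) by bsolve.
have p3 : bdm (fun y => corr f0 y * corr (fm eta) y) by bsolve.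
have p4 : bdm (fun y => fm eta y + Ksg y * corr (fm eta) y) by bsolve.
have p5 : bdm (fun y => fm eta y + Ksg y * corr (fm eta) y + corr f0 y * corr (fm eta) y) by bsolve.
have p6 : bdm (fun y => e * (fm eta y + Ksg y * corr (fm eta) y + corr f0 y * corr (fm eta) y)) by bsolve.
have EG : G eta =1 fun y => (K y * ps y + 2^-1 * ps y ^+ 2) +
    e * (fm eta y + Ksg y * corr (fm eta) y + corr f0 y * corr (fm eta) y).
  move=> y; transitivity (K y * ps y + 2^-1 * ps y ^+ 2 + e * ((K y + ps y) * eta y + rm eta y)).
    by rewrite /G /gf /rm /Psi; field.
  by rewrite -{1}(fix_eta y) /Phi -/w /fm -/w /ps /Ksg; ring.
have [m1 m2] := corr_mul f0 (fm eta); have [n1 n2] := corr_first (fm eta).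
have [g1 g2] := gps_first.
have Gc : ip (G eta) c1 = 0.
  by rewrite (eq_ip _ EG) (ipD p1 p6)// (ipZ _ p5)// (ipD p4 p3)// (ipD bfm p2)// g1 n1 m1; ring.
have Gs : ip (G eta) s1 = 0.
  by rewrite (eq_ip _ EG) (ipD p1 p6)// (ipZ _ p5)// (ipD p4 p3)// (ipD bfm p2)// g2 n2 m2; ring.
have S := lin_solDZ e bK bG (lsolP bK) (lsolP bG).
have bKG : bdm (fun y => K y + e * G eta y) by bsolve.
have beG : bdm (fun y => e * G eta y) by bsolve.
have Kc' : ip (fun y => K y + e * G eta y) c1 = 0 by rewrite ipD// ipZ// Kc Gc mulr0 addr0.
have Ks' : ip (fun y => K y + e * G eta y) s1 = 0 by rewrite ipD// ipZ// Ks Gs mulr0 addr0.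
have [t1 t2 t3] := lin_sol_modes bKG S.
case: S => bS ES; set wt := fun y => _ in t1 t2 t3 bS ES.
have Esrc : src (fun y => K y + e * G eta y) = fun y => K y + e * G eta y.
  by apply/funext => y; rewrite /src Kc' Ks' !mul0r !subr0.
rewrite Esrc in ES.
pose p := corr_c f0 + e * corr_c (fm eta); pose q := corr_s f0 + e * corr_s (fm eta).
have EP y : Psi eta y = wt y + (p * c1 y + q * s1 y).
  by rewrite /Psi -fix_eta /Phi /ps /wt /p /q /corr /sg; ring.
have bpc : bdm (fun y => p * c1 y) by bsolve.
have bqs : bdm (fun y => q * s1 y) by bsolve.
have bpq : bdm (fun y => p * c1 y + q * s1 y) by bsolve.
have bwK : bdm (fun y => wt y + (K y + e * G eta y)) by bsolve.
have Eh : h = fun y => (wt y + (K y + e * G eta y)) + (p * c1 y + q * s1 y).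
  by apply/funext => y; rewrite /h EP; ring.
have ih g : bdm g -> ip h g = ip wt g + ip (fun y => K y + e * G eta y) g +
    (p * ip c1 g + q * ip s1 g).
  by move=> bg; rewrite Eh (ipD bwK bpq bg) (ipD bS bKG bg) (ipD bpc bqs bg) !ipZ.
have hc : ip h c1 = p.
  by rewrite ih// t2 Kc' ip_c1_c1 (ipC s1) ip_c1_s1; ring.
have hs : ip h s1 = q.
  by rewrite ih// t3 Ks' ip_s1_s1 ip_c1_s1; ring.
split; first by rewrite ih// t1 ip_c1_1 ip_s1_1; ring.
exists (2^-1 * ip (fun y => K y + e * G eta y) (fun=> 1)) => y.
rewrite EP hc hs Eh (LpD _ bwK bpq) (LpD _ bpc bqs) !LpZ// Lp_c1 Lp_s1.
by have := ES y; rewrite -/(wt y) => {1}->; field.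
Qed.

End FixedEps.

(** [D] is chosen so that, for [e] at most [D^-1], the map [Phi] preserves the
ball of radius [M] and has Lipschitz constant at most [1 / 2] there. *)
Theorem perturbation_ex : exists B eps0 : R, [/\ 0 <= B, 0 < eps0, eps0 < 1 &
  forall e, 0 < e -> e <= eps0 -> exists psi G : R -> R,
    [/\ bdm psi, bdm G, forall y, `|psi y| <= B,
      forall y, (1 + e * K y) * expR (e * psi y) = 1 + e * (psi y + K y + e * G y) &
      let h y := psi y + K y + e * G y in
      ip h (fun=> 1) = 0 /\ exists m, forall y,
        psi y = Lp h y + 2^-1 * (ip h c1 * c1 y + ip h s1 * s1 y) - m]].
Proof.
have [mK [A KA]] := bK; have [mps [P psP]] := bps.
have A0 : 0 <= A by exact: le_trans (KA 0).
have P0 : 0 <= P by exact: le_trans (psP 0).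
have B0 : 0 <= P + 1 by rewrite addr_ge0.
have [L L0 HL] := gf_lip A0 B0.
have S0 := @lin_cst_ge0 R; set S := lin_cst in S0.
pose Cg := L * (P + 1).
have Cg0 : 0 <= Cg by rewrite /Cg; nneg.
pose M := S * Cg + corr_cst * ((A + P) * (S * Cg) + (Cg + 1)).
have M0 : 0 <= M by rewrite /M; nneg.
pose Q := S * L + corr_cst * ((A + P) * (S * L) + (L + M)).
have Q0 : 0 <= Q by rewrite /Q; nneg.
pose D := 2 * Q + M ^+ 2 + M + 2.
have D0 : 0 < D by rewrite ltr_wpDl//; nneg.
exists (P + 1), D^-1; split => //; first by rewrite invr_gt0.
  by rewrite invf_lt1// /D; have := sqr_ge0 M; lra.
move=> e e0 eD.
have eD1 : e * D <= 1 by rewrite -ler_pdivlMr// mul1r.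
have eM2 : e * M ^+ 2 <= 1 by apply: le_trans eD1; rewrite ler_pM2l// /D; lra.
have eM : e * M <= 1.
  by apply: le_trans eD1; rewrite ler_pM2l// /D; have := sqr_ge0 M; lra.
have eQ : e * Q <= 2^-1.
  have : e * (2 * Q) <= 1.
    by apply: le_trans eD1; rewrite ler_pM2l// /D; have := sqr_ge0 M; lra.
  lra.
have e1 : e <= 1.
  by apply: le_trans eD _; rewrite invf_le1// /D; have := sqr_ge0 M; lra.
have en : e != 0 by rewrite gt_eqF.
have PsiB (eta : R -> R) (y : R) : (forall y, `|eta y| <= M) -> `|ps y + e * eta y| <= P + 1.
  move=> eB; apply: le_trans (ler_normD _ _) _; apply: lerD => //.
  rewrite normrM (gtr0_norm e0); apply: le_trans eM.
  by rewrite ler_pM2l.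
pose G (eta : R -> R) (y : R) := gf (K y) e (ps y + e * eta y).
pose rm (eta : R -> R) (y : R) := rf (K y) e (ps y + e * eta y) + 2^-1 * (e * eta y ^+ 2).
pose fm (eta : R -> R) (y : R) := (K y + ps y) * lsol (G eta) y + rm eta y.
pose Phi (eta : R -> R) (y : R) := lsol (G eta) y + corr (fm eta) y.
have n0 : `|0 : R| <= P + 1 by rewrite normr0.
have GB (eta : R -> R) (y : R) : (forall y, `|eta y| <= M) -> `|G eta y| <= Cg.
  move=> eB; have PB := PsiB _ y eB.
  have [h1 _] := HL e e0 e1 (K y) _ 0 (KA y) PB n0.
  by move: h1; rewrite gf_0 !subr0 => h1; apply: le_trans h1 _; rewrite ler_wpM2l.
have rB (eta : R -> R) (y : R) : (forall y, `|eta y| <= M) -> `|rm eta y| <= Cg + 1.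
  move=> eB; have PB := PsiB _ y eB.
  have [_ h1] := HL e e0 e1 (K y) _ 0 (KA y) PB n0.
  move: h1; rewrite rf_0 !subr0 => h1; apply: le_trans (ler_normD _ _) _; apply: lerD.
    by apply: le_trans h1 _; rewrite ler_wpM2l.
  have s0 := sqr_ge0 (eta y).
  rewrite ger0_norm; last by apply: mulr_ge0 => //; apply: mulr_ge0 => //; exact: ltW.
  have : e * eta y ^+ 2 <= e * M ^+ 2.
    rewrite ler_pM2l// -(real_normK (num_real (eta y))) lerXn2r ?nnegrE//.
  lra.
have Gm (eta : R -> R) : measurable_fun setT eta -> measurable_fun setT (G eta).
  by move=> me; rewrite /G /gf /rf /E2 /E3; msolve.
have rmm (eta : R -> R) : measurable_fun setT eta -> measurable_fun setT (rm eta).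
  by move=> me; rewrite /rm /rf /E2 /E3; msolve.
have AP y : `|K y + ps y| <= A + P.
  by apply: le_trans (ler_normD _ _) _; apply: lerD.
have Gd (u v : R -> R) (d y : R) : (forall y, `|u y| <= M) -> (forall y, `|v y| <= M) ->
    (forall y, `|u y - v y| <= d) -> `|G u y - G v y| <= L * (e * d) /\
    `|rm u y - rm v y| <= (L + M) * (e * d).
  move=> uM vM uv.
  have [h1 h2] := HL e e0 e1 (K y) _ _ (KA y) (PsiB _ y uM) (PsiB _ y vM).
  have h3 : `|ps y + e * u y - (ps y + e * v y)| <= e * d.
    rewrite (_ : _ - _ = e * (u y - v y)); last by ring.
    by rewrite normrM (gtr0_norm e0) ler_pM2l.
  split; first by apply: le_trans h1 _; rewrite ler_wpM2l.
  rewrite (_ : rm u y - rm v y = (rf (K y) e (ps y + e * u y) - rf (K y) e (ps y + e * v y)) +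
    (2^-1 * (u y + v y)) * (e * (u y - v y))); last by rewrite /rm; field.
  apply: le_trans (ler_normD _ _) _; rewrite [leRHS]mulrDl; apply: lerD.
    by apply: le_trans h2 _; rewrite ler_wpM2l.
  rewrite normrM; apply: ler_pM => //.
    rewrite normrM (@ger0_norm _ 2^-1)//; have := ler_normD (u y) (v y).
    have := uM y; have := vM y; lra.
  by rewrite normrM (gtr0_norm e0) ler_pM2l.
have base (u : R -> R) : measurable_fun setT u -> (forall y, `|u y| <= M) ->
    [/\ bdm (G u), bdm (rm u), bdm (lsol (G u)), bdm (fm u) &
     forall y, `|lsol (G u) y| <= S * Cg].
  move=> mu uM; have bG : bdm (G u) by apply: (@bdm_le _ _ Cg); [exact: Gm|move=> y; exact: GB].
  have br : bdm (rm u) by apply: (@bdm_le _ _ (Cg + 1)); [exact: rmm|move=> y; exact: rB].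
  have bl := bdm_lsol bG; split => //; first by rewrite /fm; bsolve.
  by apply: lsol_le => // y; exact: GB.
have h1 : 0 <= 2^-1 :> R by [].
have h2 : 2^-1 < 1 :> R by rewrite invf_lt1// ltr1n.
have [||eta [me etaM fixe]] := @contraction_fixpoint R Phi M 2^-1 M0 h1 h2.
- move=> u mu uM; have [bG br bl bf lG] := base u mu uM.
  have [mc _] := bdm_corr (fm u); have [ml _] := bl.
  split; first by rewrite /Phi; apply: mfD.
  move=> y; rewrite /Phi /M; apply: le_trans (ler_normD _ _) _; apply: lerD => //.
  apply: corr_le => // z; rewrite /fm; apply: le_trans (ler_normD _ _) _; apply: lerD.
    by rewrite normrM; apply: ler_pM.
  exact: rB.
- move=> u v d mu uM mv vM uv y.
  have [bG br bl bf lG] := base u mu uM; have [bG' br' bl' bf' lG'] := base v mv vM.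
  have d0 : 0 <= d by exact: le_trans (uv 0).
  have hl z : `|lsol (G u) z - lsol (G v) z| <= S * (L * (e * d)).
    by apply: lsol_dist => // t; have [] := Gd u v d t uM vM uv.
  have hf z : `|fm u z - fm v z| <= (A + P) * (S * (L * (e * d))) + (L + M) * (e * d).
    rewrite (_ : _ - _ = (K z + ps z) * (lsol (G u) z - lsol (G v) z) + (rm u z - rm v z)); last by rewrite /fm; ring.
    apply: le_trans (ler_normD _ _) _; apply: lerD.
      by rewrite normrM; apply: ler_pM.
    by have [] := Gd u v d z uM vM uv.
  have hc := corr_dist y bf bf' hf.
  rewrite (_ : Phi u y - Phi v y = (lsol (G u) y - lsol (G v) y) +
    (corr (fm u) y - corr (fm v) y)); last by rewrite /Phi; ring.
  apply: le_trans (ler_normD _ _) _; apply: le_trans (lerD (hl y) hc) _.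
  rewrite (_ : _ + _ = (e * Q) * d); last by rewrite /Q; ring.
  by rewrite ler_wpM2r.
have [bG br bl bf lG] := base eta me etaM.
have beta := bdm_le me etaM.
exists (fun y => ps y + e * eta y), (G eta); split.
- by bsolve.
- exact: bG.
- by move=> y; exact: PsiB.
- by move=> y; rewrite gf_exp.
- exact: (@solution_of_fixpoint e eta beta bG br fixe).
Qed.

End Nonlinear.

(** * Bounded functions and the harmonic extension *)

Section SupNorm.
Context {R : realType}.
Notation mu := (@lebesgue_measure R).

Let muT_gt0 : (0 < mu setT)%E.
Proof.
rewrite (_ : setT = `]-oo, +oo[%classic); last by apply/seteqP; split.
by rewrite lebesgue_measure_itv/= ltry.
Qed.

(** The open set where the function exceeds its essential bound is negligible,
hence empty. *)
Lemma Lfun_continuous_bounded (f : R -> R) : continuous f ->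
  f \in Lfun mu +oo%E -> exists N, forall x, `|f x| <= N.
Proof.
move=> cf; rewrite inE => /andP[_]; rewrite inE /= /finite_norm unlock /=.
rewrite muT_gt0 => /(@ess_supr_bounded _ _ _ mu (Num.norm \o f))[N [A [mA A0 HA]]].
exists N => x; rewrite leNgt; apply/negP => Nx.
have /nbhs_ballP[r /= r0 rb] : \forall y \near x, N < `|f y|.
  have : (Num.norm \o f) y @[y --> x] --> `|f x| by apply: cvg_norm; exact: cf.
  by move=> /cvgr_gt; apply.
have : (mu (ball x r) <= mu A)%E.
  apply: le_measure; rewrite ?inE//; first exact: measurable_ball.
  by move=> y /rb /= Ny; apply: HA => /=; apply/negP; rewrite -ltNge.
rewrite A0 lebesgue_measure_ball ?(ltW r0)// lee_fin.
by rewrite leNgt pmulrn_lgt0 ?r0.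
Qed.

Lemma bounded_Lfun (f : R -> R) (C : R) : measurable_fun setT f ->
  (forall x, `|f x| <= C) ->
  f \in Lfun mu +oo%E /\ ('N[mu]_+oo [EFin \o f] <= C%:E)%E.
Proof.
move=> mf fC.
have H : ('N[mu]_+oo [EFin \o f] <= C%:E)%E.
  by rewrite unlock /= muT_gt0; apply: (@ess_sup_ler _ _ _ mu (Num.norm \o f)) => t; rewrite lee_fin; exact: fC.
split => //; rewrite inE; apply/andP; split; first by rewrite inE.
by rewrite inE /= /finite_norm; apply: le_lt_trans H _; exact: ltry.
Qed.

End SupNorm.

Section PoissonKernel.
Context {R : realType}.
Notation mu := (@lebesgue_measure R).

Let qd (x m t : R) := (t - x) ^+ 2 + m ^+ 2.
Let qd_gt0 (x m t : R) : 0 < m -> 0 < qd x m t.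
Proof. by move=> m0; rewrite /qd ltr_wpDl ?sqr_ge0// exprn_gt0. Qed.

(** The Poisson kernel of the half-plane and its derivatives; it is harmonic,
so that the pure second derivatives are opposite. *)
Definition PN (x m t : R) := m / ((t - x) ^+ 2 + m ^+ 2).
Definition PX (x m t : R) := 2 * m * (t - x) / ((t - x) ^+ 2 + m ^+ 2) ^+ 2.
Definition PM (x m t : R) := ((t - x) ^+ 2 - m ^+ 2) / ((t - x) ^+ 2 + m ^+ 2) ^+ 2.
Definition PXX (x m t : R) :=
  2 * m * (3 * (t - x) ^+ 2 - m ^+ 2) / ((t - x) ^+ 2 + m ^+ 2) ^+ 3.
Definition PXM (x m t : R) :=
  2 * (t - x) * ((t - x) ^+ 2 - 3 * m ^+ 2) / ((t - x) ^+ 2 + m ^+ 2) ^+ 3.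

Let fld (x m t : R) : 0 < m -> (t - x) ^+ 2 + m ^+ 2 != 0.
Proof. by move=> m0; rewrite gt_eqF// qd_gt0. Qed.

Lemma d_PN_x (x m t : R) : 0 < m -> isd (fun x => PN x m t) x (PX x m t).
Proof.
move=> m0; have n0 := @fld x m t m0; rewrite /PN; apply: deq; last by dsolve.
by cbv beta; rewrite /PX /cst; field.
Qed.
Lemma d_PN_m (x m t : R) : 0 < m -> isd (fun m => PN x m t) m (PM x m t).
Proof.
move=> m0; have n0 := @fld x m t m0; rewrite /PN; apply: deq; last by dsolve.
by cbv beta; rewrite /PM /cst; field.
Qed.
Lemma d_PX_x (x m t : R) : 0 < m -> isd (fun x => PX x m t) x (PXX x m t).
Proof.
move=> m0; have n0 := @fld x m t m0; have n1 : ((t - x) ^+ 2 + m ^+ 2) ^+ 2 != 0 by rewrite expf_neq0.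
rewrite /PX; apply: deq; last by dsolve.
by cbv beta; rewrite /PXX /cst; field.
Qed.
Lemma d_PX_m (x m t : R) : 0 < m -> isd (fun m => PX x m t) m (PXM x m t).
Proof.
move=> m0; have n0 := @fld x m t m0; have n1 : ((t - x) ^+ 2 + m ^+ 2) ^+ 2 != 0 by rewrite expf_neq0.
rewrite /PX; apply: deq; last by dsolve.
by cbv beta; rewrite /PXM /cst; field.
Qed.
Lemma d_PM_x (x m t : R) : 0 < m -> isd (fun x => PM x m t) x (PXM x m t).
Proof.
move=> m0; have n0 := @fld x m t m0; have n1 : ((t - x) ^+ 2 + m ^+ 2) ^+ 2 != 0 by rewrite expf_neq0.
rewrite /PM; apply: deq; last by dsolve.
by cbv beta; rewrite /PXM /cst; field.
Qed.
Lemma d_PM_m (x m t : R) : 0 < m -> isd (fun m => PM x m t) m (- PXX x m t).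
Proof.
move=> m0; have n0 := @fld x m t m0; have n1 : ((t - x) ^+ 2 + m ^+ 2) ^+ 2 != 0 by rewrite expf_neq0.
rewrite /PM; apply: deq; last by dsolve.
by cbv beta; rewrite /PXX /cst; field.
Qed.

Let frac_le (n q c : R) (k : nat) : 0 < q -> `|n| <= c * q ^+ k -> `|n / q ^+ k.+1| <= c / q.
Proof.
move=> q0 H; rewrite normrM normfV (@ger0_norm _ (q ^+ _)) ?exprn_ge0 ?(ltW q0)//.
rewrite ler_pdivrMr ?exprn_gt0// exprS mulrA divfK//.
by rewrite gt_eqF.
Qed.

(** Locally uniform integrable majorants, for the differentiation under the
integral sign. *)
Lemma kernel_bounds (x0 m0 : R) : 0 < m0 -> exists C, forall x m t,
  `|x - x0| < m0 / 2 -> `|m - m0| < m0 / 2 ->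
  [/\ 0 < m, `|PN x m t| <= C * om t, `|PX x m t| <= C * om t,
      `|PM x m t| <= C * om t &
      `|PXX x m t| <= C * om t /\ `|PXM x m t| <= C * om t].
Proof.
move=> m00; pose X := `|x0| + m0.
pose C1 := 1 + (1 + 2 * X ^+ 2) * (m0 / 2) ^- 2.
pose C2 := 2 * m0 + 1 + 12 / m0.
exists (C2 * C1) => x m t xx mm.
have m0' : 0 < m0 / 2 by rewrite divr_gt0.
have m1 : m0 / 2 < m by move: mm; rewrite ltr_norml; lra.
have m2 : m < 2 * m0 by move: mm; rewrite ltr_norml; lra.
have mp : 0 < m by exact: lt_trans m1.
have q0 := @qd_gt0 x m t mp; set q := qd x m t in q0.
have X0 : 0 <= X by rewrite /X addr_ge0// ltW.
have xX : `|x| <= X.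
  have := ler_normD (x - x0) x0; rewrite subrK /X; lra.
have qom : q^-1 <= C1 * om t.
  rewrite /om mulrA ler_pdivlMr ?sq1_gt0// ler_pdivrMl//.
  have a1 : 1 + t ^+ 2 <= 1 + 2 * X ^+ 2 + 2 * (t - x) ^+ 2.
    have x2 : x ^+ 2 <= X ^+ 2 by rewrite -(real_normK (num_real x)) lerXn2r ?nnegrE.
    have := sqr_ge0 (t - x - x); move: x2; rewrite !expr2; nra.
  apply: (le_trans a1).
  have a2 : 1 + 2 * X ^+ 2 <= (1 + 2 * X ^+ 2) * (m0 / 2) ^- 2 * q.
    rewrite -mulrA ler_peMr//; first by have := sqr_ge0 X; lra.
    rewrite mulrC ler_pdivlMr ?exprn_gt0// mul1r /q /qd.
    apply: (@le_trans _ _ (m ^+ 2)); last by rewrite lerDr sqr_ge0.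
    by rewrite lerXn2r ?nnegrE ?(ltW m0') ?(ltW mp) ?(ltW m1).
  have a3 : (t - x) ^+ 2 <= q by rewrite /q /qd lerDl sqr_ge0.
  have a4 : 0 <= (1 + 2 * X ^+ 2) * (m0 / 2) ^- 2 * q.
    by apply: le_trans a2; have := sqr_ge0 X; lra.
  rewrite (_ : q * (C1 * 2) = 2 * q + 2 * ((1 + 2 * X ^+ 2) * (m0 / 2) ^- 2 * q)); last first.
    by rewrite /C1; ring.
  lra.
have fin c : 0 <= c -> c <= C2 -> c / q <= C2 * C1 * om t.
  move=> c0 cC; rewrite -mulrA; apply: ler_pM => //.
  by rewrite invr_ge0 ltW.
have i12 : 0 < 12 / m0 by rewrite divr_gt0.
have i6 : 6 / m <= 12 / m0.
  by rewrite ler_pdivrMr// mulrAC ler_pdivlMr//; lra.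
have i60 : 0 <= 6 / m by rewrite divr_ge0// ltW.
have tq : 2 * m * `|t - x| <= q.
  rewrite /q /qd -(real_normK (num_real (t - x))).
  have := sqr_ge0 (`|t - x| - m); rewrite !expr2; nra.
have t3 : `|3 * (t - x) ^+ 2 - m ^+ 2| <= 3 * q.
  have := sqr_ge0 (t - x); have := sqr_ge0 m; rewrite /q /qd ler_norml.
  by move: ((t - x) ^+ 2) (m ^+ 2) => a b; lra.
have t4 : `|(t - x) ^+ 2 - 3 * m ^+ 2| <= 3 * q.
  have := sqr_ge0 (t - x); have := sqr_ge0 m; rewrite /q /qd ler_norml.
  by move: ((t - x) ^+ 2) (m ^+ 2) => a b; lra.
have m2q : m ^+ 2 <= q by rewrite /q /qd lerDr sqr_ge0.
split => //.
- rewrite /PN -/(qd x m t) -/q; apply: le_trans (fin m (ltW mp) _).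
    by rewrite normrM normfV !gtr0_norm.
  by rewrite /C2; lra.
- rewrite /PX -/(qd x m t) -/q; apply: le_trans (fin 1 ler01 _).
    apply: frac_le => //; rewrite expr1 mul1r normrM (@ger0_norm _ (2 * m))//.
    by rewrite mulr_ge0// ltW.
  by rewrite /C2; lra.
- rewrite /PM -/(qd x m t) -/q; apply: le_trans (fin 1 ler01 _).
    apply: frac_le => //; rewrite expr1 mul1r /q /qd ler_norml.
    have := sqr_ge0 (t - x); have := sqr_ge0 m.
    by move: ((t - x) ^+ 2) (m ^+ 2) => a b; lra.
  by rewrite /C2; lra.
split.
- rewrite /PXX -/(qd x m t) -/q; apply: le_trans (fin (6 / m) i60 _).
    apply: frac_le => //; rewrite normrM (@ger0_norm _ (2 * m)); last by rewrite mulr_ge0// ltW.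
    rewrite (_ : 6 / m * q ^+ 2 = (2 * (q / m)) * (3 * q)); last by field; rewrite gt_eqF.
    apply: ler_pM => //; first by rewrite mulr_ge0// ltW.
    by rewrite ler_pM2l// ler_pdivlMr// -expr2.
  by rewrite /C2; lra.
- rewrite /PXM -/(qd x m t) -/q; apply: le_trans (fin (6 / m) i60 _).
    apply: frac_le => //; rewrite normrM.
    rewrite (_ : 6 / m * q ^+ 2 = (2 * (q / m)) * (3 * q)); last by field; rewrite gt_eqF.
    apply: ler_pM => //; rewrite normrM (@ger0_norm _ 2)// ler_pM2l// ler_pdivlMr//.
    have := normr_ge0 (t - x); move: tq; nra.
  by rewrite /C2; lra.
Qed.

End PoissonKernel.

Section HarmonicExtension.
Context {R : realType}.
Notation mu := (@lebesgue_measure R).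
Context (k : R -> R) (bk : bdm k).
Let mk : measurable_fun setT k. Proof. by case: bk. Qed.

Lemma partial0E (F : R * R -> R) (p : R * R) (d : R) :
  isd (fun x => F (x, p.2)) p.1 d -> partial ord0 F p = d.
Proof.
case: p => p1 p2; move=> [_ <-]; rewrite /partial /plane_basis eqxx /derive /=.
have -> : (fun h : R => h^-1 *: (F (h *: (1, 0) + (p1, p2)) - F (p1, p2))) =
  (fun h : R => h^-1 *: (F (h *: 1 + p1, p2) - F (p1, p2))); last by [].
apply/funext => h; congr (_ *: (F _ - _)).
by rewrite /GRing.add/= /add_pair /=; congr (_, _); rewrite [h *: 0]mulr0 add0r.
Qed.

Lemma partial1E (F : R * R -> R) (p : R * R) (d : R) :
  isd (fun m => F (p.1, m)) p.2 d -> partial ord_max F p = d.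
Proof.
case: p => p1 p2; move=> [_ <-]; rewrite /partial /plane_basis /derive /=.
have -> : (fun h : R => h^-1 *: (F (h *: (0, 1) + (p1, p2)) - F (p1, p2))) =
  (fun h : R => h^-1 *: (F (p1, h *: 1 + p2) - F (p1, p2))); last by [].
apply/funext => h; congr (_ *: (F _ - _)).
by rewrite /GRing.add/= /add_pair /=; congr (_, _); rewrite [h *: 0]mulr0 add0r.
Qed.

Let isd_pot (N dN : R -> R -> R) (a e C : R) : 0 < e ->
  (forall x, measurable_fun setT (N x)) ->
  (forall x t, `|x - a| < e -> isd (fun x => N x t) x (dN x t)) ->
  (forall x t, `|x - a| < e -> `|N x t| <= C * om t) ->
  (forall x t, `|x - a| < e -> `|dN x t| <= C * om t) ->
  isd (fun x => pi^-1 * \int[mu]_t (k t * N x t)) a (pi^-1 * \int[mu]_t (k t * dN a t)).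
Proof.
move=> e0 mN dNE NC dNC; have [_ [M kM]] := bk.
have bnd (f : R -> R) : (forall t, `|f t| <= C * om t) -> forall t, `|k t * f t| <= M * C * om t.
  by move=> fC t; rewrite normrM -mulrA; apply: ler_pM.
have H : isd (fun x => \int[mu]_t (k t * N x t)) a (\int[mu]_t (k t * dN a t)).
  apply: (@isd_int R (fun x t => k t * N x t) (fun x t => k t * dN x t)
    (fun t => M * C * om t) a e e0).
  - move=> x xe; apply: (itg_dom _ (itgZ (M * C) (@itg_om R))).
      by have := mN x => ?; msolve.
    by apply: bnd => t; exact: NC.
  - move=> x t xe; apply: deq; last exact: dM (d_cst x (k t)) (dNE x t xe).
    by rewrite /cst; ring.
  - by move=> x t xe; apply: bnd => s; exact: dNC.
  - by apply: itgZ; exact: itg_om.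
by apply: deq; last exact: dM (d_cst a pi^-1) H; rewrite /cst; ring.
Qed.

Let pot (N : R -> R -> R -> R) (x m : R) := pi^-1 * \int[mu]_t (k t * N x m t).

Let P_meas (x m : R) : [/\ measurable_fun setT (PN x m), measurable_fun setT (PX x m),
  measurable_fun setT (PM x m), measurable_fun setT (PXX x m) & measurable_fun setT (PXM x m)].
Proof. by split; rewrite /PN /PX /PM /PXX /PXM; msolve. Qed.

Let half (m : R) : 0 < m -> 0 < m / 2. Proof. by move=> m0; rewrite divr_gt0. Qed.
Let c0 (m : R) : 0 < m -> `|m - m| < m / 2.
Proof. by move=> m0; rewrite subrr normr0 half. Qed.
Let c0' (x m : R) : 0 < m -> `|x - x| < m / 2.
Proof. by move=> m0; rewrite subrr normr0 half. Qed.

Let d_pot_x x m : 0 < m ->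
  [/\ isd (fun x => pot PN x m) x (pot PX x m), isd (fun x => pot PX x m) x (pot PXX x m) &
   isd (fun x => pot PM x m) x (pot PXM x m)].
Proof.
move=> m0; have [C HC] := kernel_bounds x m0.
have B y t (xe : `|y - x| < m / 2) := HC y m t xe (c0 m0).
have ms y := P_meas y m.
split.
- apply: (@isd_pot (fun x => PN x m) (fun x => PX x m) x (m / 2) C (half m0)).
  + by move=> y; case: (ms y).
  + by move=> y t _; exact: d_PN_x.
  + by move=> y t ye; case: (B y t ye).
  + by move=> y t ye; case: (B y t ye).
- apply: (@isd_pot (fun x => PX x m) (fun x => PXX x m) x (m / 2) C (half m0)).
  + by move=> y; case: (ms y).
  + by move=> y t _; exact: d_PX_x.
  + by move=> y t ye; case: (B y t ye).
  + by move=> y t ye; case: (B y t ye) => _ _ _ _ [].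
- apply: (@isd_pot (fun x => PM x m) (fun x => PXM x m) x (m / 2) C (half m0)).
  + by move=> y; case: (ms y).
  + by move=> y t _; exact: d_PM_x.
  + by move=> y t ye; case: (B y t ye).
  + by move=> y t ye; case: (B y t ye) => _ _ _ _ [].
Qed.

Let d_pot_m x m : 0 < m ->
  [/\ isd (fun m => pot PN x m) m (pot PM x m), isd (fun m => pot PX x m) m (pot PXM x m) &
   isd (fun m => pot PM x m) m (pot (fun x m t => - PXX x m t) x m)].
Proof.
move=> m0; have [C HC] := kernel_bounds x m0.
have B y t (xe : `|y - m| < m / 2) := HC x y t (c0' x m0) xe.
have ms y := P_meas x y.
split.
- apply: (@isd_pot (fun m => PN x m) (fun m => PM x m) m (m / 2) C (half m0)).
  + by move=> y; case: (ms y).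
  + by move=> y t ye; case: (B y t ye) => y0 _ _ _ _; exact: d_PN_m.
  + by move=> y t ye; case: (B y t ye).
  + by move=> y t ye; case: (B y t ye).
- apply: (@isd_pot (fun m => PX x m) (fun m => PXM x m) m (m / 2) C (half m0)).
  + by move=> y; case: (ms y).
  + by move=> y t ye; case: (B y t ye) => y0 _ _ _ _; exact: d_PX_m.
  + by move=> y t ye; case: (B y t ye).
  + by move=> y t ye; case: (B y t ye) => _ _ _ _ [].
- apply: (@isd_pot (fun m => PM x m) (fun m t => - PXX x m t) m (m / 2) C (half m0)).
  + by move=> y; case: (ms y).
  + by move=> y t ye; case: (B y t ye) => y0 _ _ _ _; exact: d_PM_m.
  + by move=> y t ye; case: (B y t ye).
  + by move=> y t ye; rewrite normrN; case: (B y t ye) => _ _ _ _ [].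
Qed.

(** Integrals in the variable [y] with [t = x + m y]. *)
Let pot_affine (N : R -> R -> R -> R) (x m C : R) (g : R -> R) : 0 < m ->
  measurable_fun setT (N x m) -> (forall t, `|N x m t| <= C * om t) ->
  (forall y, N x m (x + m * y) = m^-1 * (g y * om y)) ->
  pot N x m = ip (fun y => k (x + m * y)) g.
Proof.
move=> m0 mN NC E; have [_ [M kM]] := bk.
rewrite /pot /ip; congr (_ * _).
have I : itg (fun t => k t * N x m t).
  apply: (itg_dom _ (itgZ (M * C) (@itg_om R))); first by msolve.
  by move=> t; rewrite normrM -mulrA; apply: ler_pM.
have mn : m != 0 by rewrite gt_eqF.
rewrite (int_affine x m0 I) -intZ; last exact: (itg_affine x m0 I).
by apply: eq_int => y; rewrite E; field.
Qed.

Let harm_pot x m : 0 < m -> harmonic_extension k (x, m) = pot PN x m.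
Proof.
move=> m0; have [C HC] := kernel_bounds x m0.
have [m1 _ _ _ _] := P_meas x m.
rewrite (@pot_affine PN x m C (fun=> 2^-1) m0 m1).
- rewrite /harmonic_extension /ip /=; congr (_ * _); apply: eq_int => y.
  by rewrite /om; field; exact: sq1_neq0.
- by move=> t; case: (HC x m t (c0' x m0) (c0 m0)).
move=> y; rewrite /PN /om (_ : (x + m * y - x) ^+ 2 + m ^+ 2 = m ^+ 2 * (1 + y ^+ 2)); last by ring.
by field; rewrite sq1_neq0 gt_eqF.
Qed.

Let near_pos (m : R) : 0 < m -> \near m, 0 < m.
Proof. by move=> m0; exact: (@lt_nbhsr R 0 m m0). Qed.

Let partial_harm x m : 0 < m ->
  partial ord0 (harmonic_extension k) (x, m) = pot PX x m /\
  partial ord_max (harmonic_extension k) (x, m) = pot PM x m.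
Proof.
move=> m0; have [h1 _ _] := d_pot_x x m0; have [h2 _ _] := d_pot_m x m0; split.
- apply: partial0E => /=.
  by rewrite (_ : (fun _ => _) = fun x => pot PN x m)//; apply/funext => y; exact: harm_pot.
- apply: partial1E => /=; apply: near_eq_is_derive h2; near=> y.
  by rewrite harm_pot//; near: y; exact: near_pos.
Unshelve. all: end_near. Qed.

Let hess_harm x m : 0 < m -> let F := harmonic_extension k in
  [/\ partial ord0 (partial ord0 F) (x, m) = pot PXX x m,
      partial ord_max (partial ord0 F) (x, m) = pot PXM x m,
      partial ord0 (partial ord_max F) (x, m) = pot PXM x m &
      partial ord_max (partial ord_max F) (x, m) = pot (fun x m t => - PXX x m t) x m].
Proof.
move=> m0 F; have [_ h1 h2] := d_pot_x x m0; have [_ h3 h4] := d_pot_m x m0; split.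
- apply: partial0E => /=.
  by rewrite (_ : (fun _ => _) = fun x => pot PX x m)//; apply/funext => y; have [] := partial_harm y m0.
- apply: partial1E => /=; apply: near_eq_is_derive h3; near=> y.
  have y0 : 0 < y by near: y; exact: near_pos.
  by have [] := partial_harm x y0.
- apply: partial0E => /=.
  by rewrite (_ : (fun _ => _) = fun x => pot PM x m)//; apply/funext => y; have [] := partial_harm y m0.
- apply: partial1E => /=; apply: near_eq_is_derive h4; near=> y.
  have y0 : 0 < y by near: y; exact: near_pos.
  by have [] := partial_harm x y0.
Unshelve. all: end_near. Qed.

(** The first derivatives of the Poisson kernel are, in the rescaled variable,
multiples of [om * s1] and [om * c1]; the second ones are multiples of
[om * (c1 + c2)] and [om * (s1 + s2)]. At a critical point the Hessian is
therefore built from the second modes of [K] alone. *)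
Lemma critical_point_modes (x m : R) :
  nondegenerate_critical_point (harmonic_extension k) (x, m) ->
  let K y := k (x + m * y) in
  [/\ ip K c1 = 0, ip K s1 = 0 & ip K c2 ^+ 2 + ip K s2 ^+ 2 != 0].
Proof.
move=> [m0 grad hess] K; rewrite /= in m0.
have mn : m != 0 by rewrite gt_eqF.
have [C HC] := kernel_bounds x m0.
have B t := HC x m t (c0' x m0) (c0 m0).
have [_ m2 m3 m4 m5] := P_meas x m.
have q (y : R) : (x + m * y - x) ^+ 2 + m ^+ 2 = m ^+ 2 * (1 + y ^+ 2) by ring.
have bK : bdm K.
  have [_ [M kM]] := bk; apply: (@bdm_le _ _ M); last by move=> y; exact: kM.
  by rewrite /K; msolve.
have n1 := @sq1_neq0 R.
have bc1 := @bdm_c1 R; have bs1 := @bdm_s1 R; have bc2 := @bdm_c2 R; have bs2 := @bdm_s2 R.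
have ipZr c f g : bdm f -> bdm g -> ip f (fun y => c * g y) = c * ip f g.
  by move=> ? ?; rewrite ipC ipZ// ipC.
have ipDr f g h : bdm f -> bdm g -> bdm h -> ip f (fun y => g y + h y) = ip f g + ip f h.
  by move=> ? ? ?; rewrite ipC ipD// ipC (ipC h).
have VX : pot PX x m = (2 * m)^-1 * ip K s1.
  rewrite -ipZr//; apply: (@pot_affine PX x m C _ m0 m2); first by move=> t; case: (B t).
  by move=> y; rewrite /PX q /s1 /om; field; rewrite n1 mn.
have VM : pot PM x m = - (2 * m)^-1 * ip K c1.
  rewrite -ipZr//; apply: (@pot_affine PM x m C _ m0 m3); first by move=> t; case: (B t).
  by move=> y; rewrite /PM q /c1 /om; field; rewrite n1 mn.
have VXX : pot PXX x m = - (2 * m ^+ 2)^-1 * (ip K c1 + ip K c2).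
  rewrite -ipDr// -ipZr//; last by bsolve.
  apply: (@pot_affine PXX x m C _ m0 m4); first by move=> t; case: (B t) => _ _ _ _ [].
  by move=> y; rewrite /PXX q /c2 /c1 /s1 /om; field; rewrite n1 mn.
have VXM : pot PXM x m = - (2 * m ^+ 2)^-1 * (ip K s1 + ip K s2).
  rewrite -ipDr// -ipZr//; last by bsolve.
  apply: (@pot_affine PXM x m C _ m0 m5); first by move=> t; case: (B t) => _ _ _ _ [].
  by move=> y; rewrite /PXM q /s2 /c1 /s1 /om; field; rewrite n1 mn.
have [p0 p1] := partial_harm x m0.
have Ks : ip K s1 = 0.
  have : gradient (harmonic_extension k) (x, m) ord0 ord0 = 0 by rewrite grad mxE.
  rewrite mxE p0 VX => /eqP; rewrite mulf_eq0 invr_eq0 mulf_eq0 (negbTE mn) orbF.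
  by rewrite pnatr_eq0/= => /eqP.
have Kc : ip K c1 = 0.
  have : gradient (harmonic_extension k) (x, m) ord0 ord_max = 0 by rewrite grad mxE.
  rewrite mxE p1 VM => /eqP; rewrite mulf_eq0 oppr_eq0 invr_eq0 mulf_eq0 (negbTE mn) orbF.
  by rewrite pnatr_eq0/= => /eqP.
split => //; apply: contra hess => /eqP D0.
have a0 : ip K c2 = 0.
  apply/eqP; rewrite -sqrf_eq0 eq_le sqr_ge0 andbT -[leRHS]D0 lerDl sqr_ge0//.
have b0 : ip K s2 = 0.
  apply/eqP; rewrite -sqrf_eq0 eq_le sqr_ge0 andbT -[leRHS]D0 lerDr sqr_ge0//.
have [q1 q2 q3 q4] := hess_harm x m0.
have -> : hessian (harmonic_extension k) (x, m) = 0.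
  apply/matrixP => i j; rewrite !mxE.
  have E0 : pot PXX x m = 0 by rewrite VXX Kc a0 addr0 mulr0.
  have E1 : pot PXM x m = 0 by rewrite VXM Ks b0 addr0 mulr0.
  have E2 : pot (fun x m t => - PXX x m t) x m = 0.
    rewrite -[RHS]oppr0 -E0 /pot -mulrN -intN.
      by congr (_ * _); apply: eq_int => t; rewrite mulrN.
    have [_ [M kM]] := bk; apply: (itg_dom _ (itgZ (M * C) (@itg_om R))); first by msolve.
    by move=> t; rewrite normrM -mulrA; apply: ler_pM => //; case: (B t) => _ _ _ _ [].
  have [-> | ->] : i = ord0 \/ i = ord_max.
    by case: i => [[|[|[]]]]// ?; [left|right]; apply/val_inj.
  + have [-> | ->] : j = ord0 \/ j = ord_max.
      by case: j => [[|[|[]]]]// ?; [left|right]; apply/val_inj.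
    * by rewrite q1.
    * by rewrite q3.
  + have [-> | ->] : j = ord0 \/ j = ord_max.
      by case: j => [[|[|[]]]]// ?; [left|right]; apply/val_inj.
    * by rewrite q2.
    * by rewrite q4.
by rewrite det0.
Qed.

End HarmonicExtension.

(** * Hoelder continuity of the solution and conclusion *)

Section BoundedHolder.
Context {R : realType}.
Implicit Types (f g : R -> R).

(** The exponent 1/2 is that of the logarithmic potentials, see [logpot_holder]. *)
Definition bhol f := bdm f /\ exists2 H, 0 <= H &
  forall y z, `|f y - f z| <= H * `|y - z| `^ 2^-1.

Lemma bhol_cst a : bhol (fun=> a).
Proof.
split; first exact: bdm_cst.
by exists 0 => // y z; rewrite subrr normr0 mul0r.
Qed.

Lemma bholD f g : bhol f -> bhol g -> bhol (fun y => f y + g y).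
Proof.
move=> [bf [A A0 fA]] [bg [B B0 gB]]; split; first by bsolve.
exists (A + B) => [|y z]; first exact: addr_ge0.
rewrite (_ : _ - _ = (f y - f z) + (g y - g z)); last by ring.
by apply: le_trans (ler_normD _ _) _; rewrite [leRHS]mulrDl lerD.
Qed.

Lemma bholM f g : bhol f -> bhol g -> bhol (fun y => f y * g y).
Proof.
move=> [bf [A A0 fA]] [bg [B B0 gB]]; split; first by bsolve.
have [_ [M fM]] := bf; have [_ [N gN]] := bg.
have M0 : 0 <= M by exact: le_trans (fM 0).
have N0 : 0 <= N by exact: le_trans (gN 0).
exists (M * B + N * A) => [|y z]; first by nneg.
rewrite (_ : _ - _ = f y * (g y - g z) + g z * (f y - f z)); last by ring.
apply: le_trans (ler_normD _ _) _; rewrite [leRHS]mulrDl -!mulrA; apply: lerD.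
  by rewrite normrM; apply: ler_pM.
by rewrite normrM; apply: ler_pM.
Qed.

Lemma bhol_lip f L : bdm f -> 0 <= L -> (forall y z, `|f y - f z| <= L * `|y - z|) -> bhol f.
Proof.
move=> bf L0 fL; split => //; have [_ [M fM]] := bf.
have M0 : 0 <= M by exact: le_trans (fM 0).
exists (L + 2 * M) => [|y z]; first by nneg.
have p0 : 0 <= `|y - z| `^ 2^-1 by exact: powR_ge0.
have [d1|/ltW d1] := leP `|y - z| 1.
  apply: le_trans (fL y z) _; rewrite [leRHS]mulrDl ler_wpDr//; first by nneg.
  rewrite ler_wpM2l// -{1}(powR_half_sqr (normr_ge0 (y - z))) ler_piMr//.
  have := @ge0_ler_powR R 2^-1 ltac:(by []) `|y - z| 1; rewrite powR1; apply => //; by rewrite nnegrE.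
have p1 : 1 <= `|y - z| `^ 2^-1.
  have := @ge0_ler_powR R 2^-1 ltac:(by []) 1 `|y - z|; rewrite powR1; apply => //; by rewrite nnegrE.
rewrite [leRHS]mulrDl ler_wpDl//; first by nneg.
apply: (@le_trans _ _ (2 * M)); last by rewrite ler_peMr//; nneg.
by apply: le_trans (ler_normB _ _) _; have := fM y; have := fM z; lra.
Qed.

Lemma bhol_affine f (a b : R) : 0 < b -> bhol f -> bhol (fun y => f (a + b * y)).
Proof.
move=> b0 [[mf [M fM]] [A A0 fA]]; split; first by apply: (@bdm_le _ _ M); [msolve|].
exists (A * b `^ 2^-1) => [|y z]; first by nneg.
apply: le_trans (fA _ _) _; rewrite -mulrA ler_wpM2l//.
rewrite (_ : _ - _ = b * (y - z)); last by ring.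
by rewrite normrM (gtr0_norm b0) powRM// ltW.
Qed.

Lemma bhol_exp f : bhol f -> bhol (fun y => expR (f y)).
Proof.
move=> [[mf [M fM]] [A A0 fA]].
have eM y : `|expR (f y)| <= expR M.
  by rewrite ger0_norm ?expR_ge0// ler_expR (le_trans (ler_norm _)).
split; first by apply: (@bdm_le _ _ (expR M)) => //; msolve.
have M0 : 0 <= M by exact: le_trans (fM 0).
exists (expR (3 * M) * A) => [|y z]; first by nneg.
have d x : isd (@expR R) x (expR x) by exact: is_derive_expR.
have [c cz ->] := mvt (f z) (f y) d.
rewrite normrM -mulrA; apply: ler_pM => //.
rewrite ger0_norm ?expR_ge0// ler_expR.
have h1 := ler_normB (f y) (f z); have h2 := ler_norm (c - f z); have h3 := ler_norm (f z).
have := fM y; have := fM z; lra.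
Qed.

Lemma bhol_om : bhol (@om R).
Proof.
apply: (@bhol_lip _ 2) => //.
  apply: (@bdm_le _ _ 2); first exact: om_meas.
  by move=> y; rewrite (gtr0_norm (om_gt0 y)) om_le2.
move=> y z; have [c _ ->] := mvt z y (@om_derive R).
rewrite normrM ler_wpM2r// normrN (_ : c * om c ^+ 2 = s1 c * om c); last first.
  by rewrite /s1 /om; field; exact: sq1_neq0.
rewrite (normrM (s1 c)) -[leRHS]mul1r; apply: ler_pM => //; first exact: s1_le1.
by rewrite (gtr0_norm (om_gt0 c)) om_le2.
Qed.

(** The derivative is bounded: it differs by a Hoelder increment over a distance
at most 1 from a difference quotient of [f] over a unit interval. *)
Lemma bhol_C1alpha (alpha : R) f : 0 < alpha -> is_C1alpha alpha f -> bdm f -> bhol f.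
Proof.
move=> a0 [[df _] [H fH]] bf; have [_ [M fM]] := bf.
have d x : isd f x (derive1 f x) by split; [exact: df|rewrite derive1E].
have M0 : 0 <= M by exact: le_trans (fM 0).
have B x : `|derive1 f x| <= `|H| + 2 * M.
  have [c cx E] := mvt x (x + 1) d.
  rewrite (addrAC x) subrr add0r normr1 in cx; rewrite (addrAC x) subrr add0r mulr1 in E.
  rewrite -(subrK (derive1 f c) (derive1 f x)); apply: le_trans (ler_normD _ _) _.
  apply: lerD.
    apply: le_trans (fH x c I I) _; apply: (@le_trans _ _ (`|H| * `|x - c| `^ alpha)).
      by rewrite ler_wpM2r ?powR_ge0// ler_norm.
    rewrite ler_piMr// distrC.
    have := @ge0_ler_powR R alpha (ltW a0) `|c - x| 1; rewrite powR1; apply => //; by rewrite nnegrE.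
  rewrite -E; apply: le_trans (ler_normB _ _) _; have := fM x; have := fM (x + 1); lra.
apply: (@bhol_lip _ (`|H| + 2 * M)) => //; first by nneg.
by move=> y z; have [c _ ->] := mvt z y d; rewrite normrM ler_wpM2r.
Qed.

End BoundedHolder.

Section Bubble.
Context {R : realType}.
Notation mu := (@lebesgue_measure R).

Let lnom (y : R) : ln (om y) = ln 2 - ln (1 + y ^+ 2).
Proof. by rewrite /om ln_div ?posrE// sq1_gt0. Qed.

(** The trigonometric part of the kernel of [Lp] contributes exactly the first
modes, with the opposite sign. *)
Lemma profile_potential (psi h : R -> R) (m : R) : bdm h -> ip h (fun=> 1) = 0 ->
  (forall y, psi y = Lp h y + 2^-1 * (ip h c1 * c1 y + ip h s1 * s1 y) - m) ->
  exists c, forall y, psi y = c - pi^-1 * logpot (fun z => h z * om z) y.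
Proof.
move=> bh h0 E; have [mh [M hM]] := bh.
have I0 : \int[mu]_y (h y * om y) = 0.
  have p0 : pi^-1 != 0 :> R by rewrite invr_eq0 gt_eqF ?pi_gt0.
  apply: (mulfI p0); rewrite mulr0 -[RHS]h0 /ip; congr (_ * _).
  by apply: eq_int => y; rewrite mulr1.
exists ((2 * pi)^-1 * \int[mu]_y (ln (1 + y ^+ 2) * (h y * om y)) - m) => y.
rewrite E Lp_eq// (int_lD _ mh hM) I0.
have := pi_gt0 R; move: (@pi R) => w w0; field; by rewrite gt_eqF.
Qed.

Lemma logpot_scale (F : R -> R) (x0 m C : R) : 0 < m -> 0 <= C ->
  measurable_fun setT F -> (forall y, `|F y| <= C * om y) ->
  forall x, logpot (fun z => F ((z - x0) / m) / m) x =
    ln m * (\int[mu]_y F y) + logpot F ((x - x0) / m).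
Proof.
move=> m0 C0 mF FC x; have mn : m != 0 by rewrite gt_eqF.
set y := (x - x0) / m.
have IF : itg F by apply: (itg_dom mF _ FC); apply: itgZ; exact: itg_om.
have IL := itg_logpot C0 mF FC y.
pose g w := m^-1 * (ln m * F w + ln `|y - w| * F w).
have Ig : itg g by apply: itgZ; apply: itgD => //; exact: itgZ.
have i0 : 0 < m^-1 by rewrite invr_gt0.
have E : logpot (fun z => F ((z - x0) / m) / m) x = \int[mu]_z g (- x0 / m + m^-1 * z).
  rewrite /logpot; apply: (@eq_int_pt _ x).
  - by msolve.
  - exact: itg_meas (itg_affine _ i0 Ig).
  move=> z zx; rewrite /g (_ : - x0 / m + m^-1 * z = (z - x0) / m); last by field.
  have -> : `|x - z| = m * `|y - (z - x0) / m|.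
    rewrite -{1}(gtr0_norm m0) -normrM; congr `|_|; rewrite /y; field; exact: mn.
  have n0 : 0 < `|y - (z - x0) / m|.
    rewrite normr_gt0 (_ : _ - _ = (x - z) / m); last by rewrite /y; field.
    by rewrite mulf_neq0 ?invr_eq0// subr_eq0 eq_sym.
  by rewrite lnM ?posrE//; field.
rewrite E.
have := int_affine (- x0 / m) i0 Ig => /(congr1 (fun t => m * t)); rewrite mulVKf// => <-.
rewrite /g intZ; last by apply: itgD => //; exact: itgZ.
by rewrite intD ?itgZ// intZ// mulVKf.
Qed.

(** Up to a constant, the perturbed bubble is the logarithmic potential of
[om * (1 + e * h)], which is [om * (1 + e * K) * expR (e * psi)], rescaled. It
only remains to see that this density is Hoelder continuous. *)
Lemma perturbed_bubble_solution (kappa psi h : R -> R) (x0 m e : R) : 0 < m ->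
  0 < e -> bhol (fun y => kappa (x0 + m * y)) -> bdm psi -> bdm h ->
  (forall y, (1 + e * kappa (x0 + m * y)) * expR (e * psi y) = 1 + e * h y) ->
  (exists c, forall y, psi y = c - pi^-1 * logpot (fun z => h z * om z) y) ->
  is_solution (fun x => 1 + e * kappa x)
    (fun x => bubble m x0 x + e * psi ((x - x0) / m)).
Proof.
move=> m0 e0 bk bp bh Eh [c Ec].
have mn : m != 0 by rewrite gt_eqF.
have mo := @om_meas R.
have [mh [Mh hM]] := bh.
have M0 : 0 <= Mh by exact: le_trans (hM 0).
have mhom : measurable_fun setT (fun z => h z * om z) by msolve.
have hom z : `|h z * om z| <= Mh * om z.
  by rewrite normrM (gtr0_norm (om_gt0 z)) ler_pM2r ?om_gt0.
have bpsi : bhol psi.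
  split => //; have [H H0 HH] := logpot_holder M0 mhom hom.
  have p0 : 0 <= pi^-1 :> R by rewrite invr_ge0 pi_ge0.
  exists (pi^-1 * H) => [|y z]; first exact: mulr_ge0.
  have D (p a b : R) : c - p * a - (c - p * b) = - (p * (a - b)) by ring.
  by rewrite !Ec D normrN normrM (ger0_norm p0) -mulrA ler_wpM2l.
pose F y := (1 + e * h y) * om y.
have FE y : F y = ((1 + e * kappa (x0 + m * y)) * expR (e * psi y)) * om y by rewrite Eh.
have bF : bhol F.
  rewrite (_ : F = fun y => ((1 + e * kappa (x0 + m * y)) * expR (e * psi y)) * om y); last first.
    by apply/funext => y; exact: FE.
  apply: bholM; last exact: bhol_om.
  apply: bholM; first by apply: bholD; [exact: bhol_cst|apply: bholM => //; exact: bhol_cst].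
  by apply: bhol_exp; apply: bholM => //; exact: bhol_cst.
have [[mF _] _] := bF.
have C0 : 0 <= 1 + e * Mh by rewrite addr_ge0// mulr_ge0// ltW.
have FC y : `|F y| <= (1 + e * Mh) * om y.
  rewrite /F normrM (gtr0_norm (om_gt0 y)) ler_pM2r ?om_gt0//.
  apply: le_trans (ler_normD _ _) _; rewrite normr1 lerD2l normrM (gtr0_norm e0).
  by rewrite ler_pM2l.
have EF y : logpot F y = pi * ln (1 + y ^+ 2) + e * logpot (fun z => h z * om z) y.
  have I1 := @itg_logpot _ _ _ M0 mhom hom y.
  have o1 (z : R) : `|om z| <= 1 * om z by rewrite mul1r (gtr0_norm (om_gt0 z)).
  have I2 := @itg_logpot _ _ _ ler01 mo o1 y.
  rewrite -logpot_om /logpot -(intZ _ I1) -(intD I2 (itgZ _ I1)).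
  by apply: eq_int => z; rewrite /F; ring.
pose F' z := F ((z - x0) / m) / m.
have mF' : measurable_fun setT F' by rewrite /F'; msolve.
have bF' : bhol F'.
  have i0 : 0 < m^-1 by rewrite invr_gt0.
  have := bholM (bhol_affine (- x0 / m) i0 bF) (bhol_cst m^-1).
  rewrite (_ : (fun y => _) = F')//; apply/funext => z; rewrite /F'; congr (F _ / m); field; exact: mn.
have [_ [H H0 HF']] := bF'.
pose C' := (1 + e * Mh) * (1 + 2 * x0 ^+ 2 + 2 * m ^+ 2) / m.
have s0 := sqr_ge0 x0; have sm := sqr_ge0 m.
have C'0 : 0 <= C'.
  by rewrite /C' divr_ge0 ?(ltW m0)// mulr_ge0//; lra.
have FC' z : `|F' z| <= C' * om z.
  rewrite /F' normrM normfV (gtr0_norm m0) /C' mulrAC ler_wpM2r ?invr_ge0 ?(ltW m0)//.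
  apply: le_trans (FC _) _; rewrite -mulrA ler_wpM2l//.
  set y := (z - x0) / m; have -> : z = x0 + m * y by rewrite /y; field.
  have key : 1 + (x0 + m * y) ^+ 2 <= (1 + 2 * x0 ^+ 2 + 2 * m ^+ 2) * (1 + y ^+ 2).
    rewrite -subr_ge0 (_ : _ - _ =
      (x0 - m * y) ^+ 2 + 2 * m ^+ 2 + y ^+ 2 + 2 * (x0 ^+ 2 * y ^+ 2)); last by ring.
    by nneg.
  rewrite /om mulrCA ler_pM2l// ler_pdivlMr ?sq1_gt0// mulrC ler_pdivrMr ?sq1_gt0//.
pose I0 := \int[mu]_y F y.
pose cc := ln 2 - ln m + e * c + pi^-1 * (ln m * I0).
have Eu x : bubble m x0 x + e * psi ((x - x0) / m) = cc - pi^-1 * logpot F' x.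
  set y := (x - x0) / m.
  have -> : bubble m x0 x = ln 2 - ln m - ln (1 + y ^+ 2).
    rewrite /bubble (_ : _ / _ = om y / m); last first.
      rewrite /om /y; field; rewrite mn/=.
      have q (u : R) : m ^+ 2 + u ^+ 2 != 0 by rewrite gt_eqF// ltr_wpDr ?sqr_ge0// exprn_gt0.
      by rewrite ?q.
    by rewrite ln_div ?posrE ?om_gt0// lnom; ring.
  rewrite /F' (logpot_scale x0 m0 C0 mF FC x) EF Ec -/y -/I0 /cc.
  have := pi_gt0 R; move: (@pi R) => w w0; field; by rewrite gt_eqF.
have [S1 S2] := half_laplacian_logpot C'0 H0 mF' FC' HF' cc.
have Ef : (fun x => bubble m x0 x + e * psi ((x - x0) / m)) = (fun x => cc - pi^-1 * logpot F' x).
  by apply/funext => x; exact: Eu.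
rewrite Ef; split => // x; have [h1 h2] := S2 x; split => //.
rewrite h2 -Eu /F' FE; set y := (x - x0) / m.
have Ex : x0 + m * y = x by rewrite /y; field.
rewrite Ex expRD -!mulrA; congr (_ * _).
have -> : bubble m x0 x = ln (om y / m).
  rewrite /bubble; congr ln; rewrite -Ex /om; field.
  have q (u : R) : m ^+ 2 + u ^+ 2 != 0 by rewrite gt_eqF// ltr_wpDr ?sqr_ge0// exprn_gt0.
  by rewrite mn sq1_neq0 ?(addrC x0) ?addrK ?q.
rewrite lnK; first by rewrite /om; ring.
by rewrite posrE divr_gt0// om_gt0.
Qed.

End Bubble.

Theorem theorem1p1 (R : realType) (alpha : R) (kappa : R -> R)
    (xis mus : R) (alpha_gt0 : 0 < alpha)
    (kappa_C1alpha : is_C1alpha alpha kappa)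
    (kappa_Linfty : kappa \in Lfun (@lebesgue_measure R) +oo%E)
    (crit : nondegenerate_critical_point (harmonic_extension kappa)
              (xis, mus)) :
  exists eps0 C : R, [/\ 0 < eps0, eps0 < 1, 0 < C &
    exists (u phi : R -> R -> R) (xi mu : R -> R),
      (forall eps : R, 0 < eps -> eps <= eps0 ->
         [/\ is_solution (fun x => 1 + eps * kappa x) (u eps),
             0 < mu eps,
             (forall x, u eps x = bubble (mu eps) (xi eps) x + phi eps x),
             phi eps \in Lfun (@lebesgue_measure R) +oo%E &
             ('N[@lebesgue_measure R]_+oo [EFin \o phi eps]
                <= (C * eps)%:E)%E]) /\
      (xi eps, mu eps) @[eps --> 0^'+] --> (xis, mus)].
Proof.
have mus0 : 0 < mus by case: crit.
have cK : continuous kappa.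
  by move=> x; apply/differentiable_continuous; rewrite -derivable1_diffP; case: kappa_C1alpha => [[]].
have [N kN] := Lfun_continuous_bounded cK kappa_Linfty.
have bk : bdm kappa := bdm_le (mfC cK) kN.
have hk := bhol_C1alpha alpha_gt0 kappa_C1alpha bk.
have [Kc Ks De] := critical_point_modes bk crit.
have hK := bhol_affine xis mus0 hk; have [bK _] := hK.
have [B [eps0 [B0 e0 e1 H]]] := perturbation_ex bK Kc Ks De.
have ex (e : R) : exists psi : R -> R, 0 < e -> e <= eps0 ->
    [/\ measurable_fun setT psi, forall y, `|psi y| <= B &
     is_solution (fun x => 1 + e * kappa x)
       (fun x => bubble mus xis x + e * psi ((x - xis) / mus))].
  have [ee|] := pselect (0 < e /\ e <= eps0); last first.
    by move=> ne; exists (fun=> 0) => h1 h2; case: ne.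
  have [psi [G [bp bG pB E [h0 [m Em]]]]] := H e ee.1 ee.2.
  exists psi => _ _; have [mp _] := bp; split => //.
  have bh : bdm (fun y => psi y + kappa (xis + mus * y) + e * G y) by bsolve.
  exact: (perturbed_bubble_solution mus0 ee.1 hK bp bh E (profile_potential bh h0 Em)).
have [psi Hpsi] := choice ex.
exists eps0, (B + 1); split => //; first by rewrite ltr_wpDl.
(* The parameters of the bubble can be kept constant: a displacement of order
[e] changes the bubble by a bounded function of order [e], and belongs to the
first modes of [psi]. *)
exists (fun e x => bubble mus xis x + e * psi e ((x - xis) / mus)),
  (fun e x => e * psi e ((x - xis) / mus)), (fun=> xis), (fun=> mus).
split; last exact: cvg_cst.
move=> e ep ee; have [mp pB sol] := Hpsi e ep ee.
have mphi : measurable_fun setT (fun x : R => e * psi e ((x - xis) / mus)) by msolve.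
have phiB x : `|e * psi e ((x - xis) / mus)| <= (B + 1) * e.
  rewrite normrM (gtr0_norm ep) mulrC ler_pM2r//; apply: le_trans (pB _) _.
  by rewrite lerDl.
by have [h1 h2] := bounded_Lfun mphi phiB.
Qed.
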